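(* Let $\mathbf{K}$ be an algebraically closed field and let $f\in\mathrm{Jonq}(\mathbf{K})$ be a base-wandering Jonquières twist. The exact sequence $$\{1\}\rightarrow \mathrm{Cent}_0(f)\rightarrow \mathrm{Cent}(f) \rightarrow \mathrm{Cent}_b(f)\rightarrow \{1\}$$ satisfies: \begin{itemize} \item $\mathrm{Cent}_0(f)=\mathrm{Cent}(f)\cap\mathrm{Jonq}_0(\mathbf{K})$, if not trivial, is (in suitable coordinates, i.e. up to conjugation in $\mathrm{Jonq}(\mathbf{K})$) $\{(x,y)\mapsto (x,ty)\mid t\in\mathbf{K}^*\}$, or $\{(x,y)\mapsto (x,y+t)\mid t\in\mathbf{K}\}$, or a torsion group which has order two when $\mathrm{char}(\mathbf{K})=0$; \item $\mathrm{Cent}_b(f)\subset \mathrm{PGL}_2(\mathbf{K})$ is isomorphic to the product of a finite cyclic group with $\mathbf{Z}$. The infinite cyclic subgroup generated by $\overline{f}$ has finite index in $\mathrm{Cent}_b(f)$. \end{itemize}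
   Context: $\mathrm{Cr}_2(\mathbf{K})$ is the group of birational transformations of $\mathbb{P}^2_{\mathbf{K}}$. In a fixed affine chart $(x,y)$, $\mathrm{Jonq}(\mathbf{K})\cong \mathrm{PGL}_2(\mathbf{K})\ltimes \mathrm{PGL}_2(\mathbf{K}(x))$ is the subgroup of all transformations $(x,y)\dashrightarrow \left(\frac{ax+b}{cx+d},\frac{A(x)y+B(x)}{C(x)y+D(x)}\right)$; it preserves the rational fibration $(x,y)\mapsto x$. For $f\in\mathrm{Jonq}(\mathbf{K})$, $\overline f\in\mathrm{PGL}_2(\mathbf{K})$ is its action on the base (the $x$-line $\mathbb{P}^1$), and $\mathrm{Jonq}_0(\mathbf{K})\cong\mathrm{PGL}_2(\mathbf{K}(x))$ is the normal subgroup of elements acting trivially on the base. A Jonquières twist is an element whose degree sequence $(\deg f^n)_n$ grows linearly; it is base-wandering if $\overline f$ has infinite order. $\mathrm{Cent}(f)$ is the centralizer of $f$ in $\mathrm{Cr}_2(\mathbf{K})$; it is contained in $\mathrm{Jonq}(\mathbf{K})$ because a Jonquières twist preserves a unique pencil of rational curves. $\mathrm{Cent}_b(f)\subset\mathrm{PGL}_2(\mathbf{K})$ is the image of $\mathrm{Cent}(f)$ under $g\mapsto\overline g$. *)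

(* Defs.v *)
From HB Require Import structures.
From mathcomp Require Import all_boot all_order all_algebra.
From mathcomp Require Import mpoly.

Set Implicit Arguments.
Unset Strict Implicit.
Unset Printing Implicit Defensive.

Import GRing.Theory.
Local Open Scope ring_scope.
Local Open Scope quotient_scope.

Section ProjectiveLinearGroup.
Variables (n : nat) (L : fieldType).

Definition GLn := {M : 'M[L]_n | M \in unitmx}.

Definition pgl_eq : rel GLn :=
  fun M N => is_scalar_mx (invmx (val M) *m val N).

Lemma pgl_eqP (M N : GLn) :
  reflect (exists2 c, c != 0 & val N = c *: val M) (pgl_eq M N).
Proof.
have uM : val M \in unitmx := valP M; have uN : val N \in unitmx := valP N.
apply: (iffP is_scalar_mxP) => [[c Ec]|[c _ ->]]; last first.
  by exists c; rewrite -scalemxAr mulVmx // scalemx1.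
have EN : val N = c *: val M.
  by rewrite -[LHS](mulKVmx uM) Ec mul_mx_scalar.
have [c0|] := eqVneq c 0; last by exists c.
exists 1; rewrite ?oner_eq0 // scale1r.
have N0 : val N = 0 by rewrite EN c0 scale0r.
move: uN; rewrite N0 => u0.
by rewrite -[LHS](mulKVmx u0) mul0mx -[RHS](mulKVmx u0) mul0mx.
Qed.

Lemma pgl_eq_equiv : equiv_class_of pgl_eq.
Proof.
split=> [M | M N | N M P].
- by apply/pgl_eqP; exists 1; rewrite ?oner_eq0 // scale1r.
- by apply/pgl_eqP/pgl_eqP => -[c c0 ->]; exists c^-1;
    rewrite ?invr_eq0 // scalerA mulVf // scale1r.
- move=> /pgl_eqP[c c0 Ec] /pgl_eqP[d d0 Ed]; apply/pgl_eqP.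
  by exists (d * c); rewrite ?mulf_neq0 // Ed Ec scalerA.
Qed.

Canonical pgl_equiv_rel := EquivRelPack pgl_eq_equiv.

Definition PGL := {eq_quot pgl_equiv_rel}.

HB.instance Definition _ := EqQuotient.on PGL.
HB.instance Definition _ := Choice.on PGL.

Definition pgl_class (M : GLn) : PGL := \pi_PGL M.

Lemma pgl_classP (M N : GLn) : reflect (pgl_class M = pgl_class N) (pgl_eq M N).
Proof. exact: eqmodP. Qed.

Definition gl_one : GLn :=
  exist (fun A => A \in unitmx) 1%:M (unitmx1 L n).

Fact gl_mul_subproof (M N : GLn) : val M *m val N \in unitmx.
Proof. by rewrite unitmx_mul (valP M) (valP N). Qed.
Definition gl_mul (M N : GLn) : GLn :=
  exist (fun A => A \in unitmx) _ (gl_mul_subproof M N).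

Fact gl_inv_subproof (M : GLn) : invmx (val M) \in unitmx.
Proof. by rewrite unitmx_inv (valP M). Qed.
Definition gl_inv (M : GLn) : GLn :=
  exist (fun A => A \in unitmx) _ (gl_inv_subproof M).

Definition pgl_one : PGL := pgl_class gl_one.
Definition pgl_mul (P Q : PGL) : PGL := pgl_class (gl_mul (repr P) (repr Q)).
Definition pgl_inv (P : PGL) : PGL := pgl_class (gl_inv (repr P)).

Lemma pgl_reprK (M : GLn) :
  exists2 c, c != 0 & val (repr (pgl_class M)) = c *: val M.
Proof. by apply/pgl_eqP/pgl_classP; rewrite /pgl_class reprK. Qed.

Lemma pgl_classM (M N : GLn) :
  pgl_class (gl_mul M N) = pgl_mul (pgl_class M) (pgl_class N).
Proof.
apply/pgl_classP/pgl_eqP.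
have [c c0 /= ->] := pgl_reprK M; have [d d0 /= ->] := pgl_reprK N.
by exists (c * d); rewrite ?mulf_neq0 //= -scalemxAl -scalemxAr scalerA.
Qed.

Lemma pgl_classV (M : GLn) : pgl_class (gl_inv M) = pgl_inv (pgl_class M).
Proof.
apply/pgl_classP/pgl_eqP; have [c c0 /= ->] := pgl_reprK M.
by exists c^-1; rewrite ?invr_eq0 // invmxZ // unitmxZ ?unitfE // (valP M).
Qed.

Lemma pgl_ind (A : PGL -> Prop) : (forall M, A (pgl_class M)) -> forall P, A P.
Proof. by move=> AM P; rewrite -[P]reprK; apply: AM. Qed.

Lemma pgl_mulA : associative pgl_mul.
Proof.
elim/pgl_ind=> M; elim/pgl_ind=> N; elim/pgl_ind=> P; rewrite -!pgl_classM.
by congr pgl_class; apply: val_inj; rewrite /= mulmxA.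
Qed.

Lemma pgl_mul1 : left_id pgl_one pgl_mul.
Proof.
elim/pgl_ind=> M; rewrite -pgl_classM.
by congr pgl_class; apply: val_inj; rewrite /= mul1mx.
Qed.

Lemma pgl_mulr1 : right_id pgl_one pgl_mul.
Proof.
elim/pgl_ind=> M; rewrite -pgl_classM.
by congr pgl_class; apply: val_inj; rewrite /= mulmx1.
Qed.

Lemma pgl_mulV : left_inverse pgl_one pgl_inv pgl_mul.
Proof.
elim/pgl_ind=> M; rewrite -pgl_classV -pgl_classM.
by congr pgl_class; apply: val_inj; rewrite /= mulVmx ?(valP M).
Qed.

Lemma pgl_mulrV : right_inverse pgl_one pgl_inv pgl_mul.
Proof.
elim/pgl_ind=> M; rewrite -pgl_classV -pgl_classM.
by congr pgl_class; apply: val_inj; rewrite /= mulmxV ?(valP M).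
Qed.

HB.instance Definition _ := isGroup.Build PGL
  pgl_mulA pgl_mul1 pgl_mulr1 pgl_mulV pgl_mulrV.

End ProjectiveLinearGroup.

Section CremonaGroup.
Variable K : fieldType.

Implicit Types F G H : 3.-tuple {mpoly K[3]}.

(* [F_0 : F_1 : F_2] defines a rational map from P^2 to itself. *)
Definition is_rational_map F : bool :=
  [exists i, (tnth F i != 0) &&
    [forall j, tnth F j \is (msize (tnth F i)).-1.-homog]].

Lemma is_rational_mapP F :
  reflect ((exists d, forall j, tnth F j \is d.-homog) /\
           (exists i, tnth F i != 0))
          (is_rational_map F).
Proof.
apply: (iffP existsP) => [[i /andP[Fi0 /forallP Fh]] | [[d Fh] [i Fi0]]].
  by split; [exists (msize (tnth F i)).-1 | exists i].
exists i; rewrite Fi0 /=; apply/forallP=> j.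
by rewrite -(dhomog_uniq Fi0 (Fh i) (dhomog_msize (Fh i))).
Qed.

(* Equality in P^2 of [F_0 : F_1 : F_2] and [G_0 : G_1 : G_2]. *)
Definition proj_eq F G : bool :=
  [forall i, forall j, tnth F i * tnth G j == tnth F j * tnth G i].

Lemma proj_eqP F G :
  reflect (forall i j, tnth F i * tnth G j = tnth F j * tnth G i) (proj_eq F G).
Proof.
by apply: (iffP 'forall_forallP) => h i j; apply/eqP; rewrite h.
Qed.

Definition ratmap_comp F G := [tuple tnth F i \mPo G | i < 3].
Definition ratmap_id : 3.-tuple {mpoly K[3]} := [tuple 'X_i | i < 3].

(* A birational map together with a representative of its inverse. *)
Definition is_birational_pair (p : 3.-tuple {mpoly K[3]} * 3.-tuple {mpoly K[3]}) :=
  [&& is_rational_map p.1, is_rational_map p.2,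
      is_rational_map (ratmap_comp p.1 p.2), proj_eq (ratmap_comp p.1 p.2) ratmap_id,
      is_rational_map (ratmap_comp p.2 p.1) & proj_eq (ratmap_comp p.2 p.1) ratmap_id].

Definition birational_pair := {p | is_birational_pair p}.

Definition birational_eq : rel birational_pair :=
  fun p q => proj_eq (val p).1 (val q).1.

Lemma proj_eq_refl F : proj_eq F F.
Proof. by apply/proj_eqP=> i j; rewrite mulrC. Qed.

Lemma proj_eq_sym F G : proj_eq F G = proj_eq G F.
Proof.
by apply/proj_eqP/proj_eqP => h i j; rewrite mulrC -h mulrC.
Qed.

Lemma proj_eq_trans G F H :
  is_rational_map G -> proj_eq F G -> proj_eq G H -> proj_eq F H.
Proof.
case/is_rational_mapP=> _ [k Gk0] /proj_eqP FG /proj_eqP GH.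
apply/proj_eqP=> i j; apply: (mulfI (mulf_neq0 Gk0 Gk0)).
have E a b : tnth G k * tnth G k * (tnth F a * tnth H b) =
             tnth F k * tnth H k * (tnth G a * tnth G b).
  rewrite mulrACA [tnth G k * tnth F a]mulrC (FG a k) (GH k b).
  by rewrite [tnth G b * _]mulrC mulrACA.
by rewrite !E [tnth G i * _]mulrC.
Qed.

Lemma ratmap_compA F G H :
  ratmap_comp (ratmap_comp F G) H = ratmap_comp F (ratmap_comp G H).
Proof.
apply: eq_from_tnth => i; rewrite !tnth_mktuple.
move: (tnth F i) => p; rewrite (comp_mpolyE p G) raddf_sum /=.
rewrite (comp_mpolyE p (ratmap_comp G H)); apply: eq_bigr => m _.
rewrite comp_mpolyZ rmorph_prod /=; congr (_ *: _).
by apply: eq_bigr => j _; rewrite rmorphXn /= tnth_mktuple.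
Qed.

Lemma ratmap_comp1 F : ratmap_comp F ratmap_id = F.
Proof. by apply: eq_from_tnth => i; rewrite tnth_mktuple comp_mpoly_id. Qed.

Lemma ratmap_1comp F : ratmap_comp ratmap_id F = F.
Proof.
by apply: eq_from_tnth => i; rewrite !tnth_mktuple comp_mpolyXU -tnth_nth.
Qed.

Lemma ratmap_id_rational : is_rational_map ratmap_id.
Proof.
apply/is_rational_mapP; split.
  by exists 1%N => j; rewrite tnth_mktuple dhomogX /= mdeg1.
by exists ord0; rewrite tnth_mktuple -msupp_eq0 msuppX.
Qed.

Lemma comp_homog (p : {mpoly K[3]}) G d e :
  p \is d.-homog -> (forall j, tnth G j \is e.-homog) ->
  p \mPo G \is (d * e)%N.-homog.
Proof.
move=> /dhomogP ph Gh; rewrite comp_mpolyE big_seq.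
apply: rpred_sum => m mp; apply: rpredZ.
rewrite -(ph m mp) /= mdegE big_distrl /=.
elim/big_rec2: _ => [|i k q _ qh]; first exact: dhomog1.
by apply: dhomogM => //; rewrite mulnC; apply: dhomogMn.
Qed.

(* Substituting proportional triples in a form. *)
Lemma comp_scale (p a b : {mpoly K[3]}) G H d :
  p \is d.-homog -> (forall j, a * tnth G j = b * tnth H j) ->
  a ^+ d * (p \mPo G) = b ^+ d * (p \mPo H).
Proof.
move=> /dhomogP ph GH; rewrite !comp_mpolyE !mulr_sumr !big_seq.
apply: eq_bigr => m mp; rewrite -!scalerAr; congr (_ *: _).
rewrite -(ph m mp) /= mdegE !expr_sum -!big_split /=.
by apply: eq_bigr => i _; rewrite -!exprMn GH.
Qed.

Lemma comp_congr F G H :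
  is_rational_map F -> is_rational_map G -> is_rational_map H -> proj_eq G H ->
  exists a b, [/\ a != 0, b != 0 &
    forall i, a * tnth (ratmap_comp F G) i = b * tnth (ratmap_comp F H) i].
Proof.
case/is_rational_mapP=> [[d Fh] _] /is_rational_mapP[_ [k Gk0]].
case/is_rational_mapP=> [_ [l Hl0]] /proj_eqP GH.
have Hk0 : tnth H k != 0.
  apply: contraNneq Hl0 => Hk0; have := GH k l.
  by rewrite Hk0 mulr0 => /eqP; rewrite mulf_eq0 (negPf Gk0).
exists (tnth H k ^+ d), (tnth G k ^+ d).
split; [exact: expf_neq0 | exact: expf_neq0 | move=> i].
rewrite !tnth_mktuple; apply: comp_scale (Fh i) _ => j.
by rewrite mulrC GH.
Qed.

Lemma proj_eq_scale F G (a b : {mpoly K[3]}) :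
  a != 0 -> (forall i, a * tnth F i = b * tnth G i) -> proj_eq F G.
Proof.
move=> a0 E; apply/proj_eqP=> i j; apply: (mulfI a0).
by rewrite !mulrA !E mulrAC.
Qed.

Lemma ratmap_comp_eqr F G H :
  is_rational_map F -> is_rational_map G -> is_rational_map H -> proj_eq G H ->
  proj_eq (ratmap_comp F G) (ratmap_comp F H).
Proof.
move=> rF rG rH GH; have [a [b [a0 _ E]]] := comp_congr rF rG rH GH.
exact: proj_eq_scale a0 E.
Qed.

Lemma ratmap_comp_eql F G H : proj_eq F G -> proj_eq (ratmap_comp F H) (ratmap_comp G H).
Proof.
move/proj_eqP=> FG; apply/proj_eqP=> i j.
by rewrite !tnth_mktuple -!rmorphM /= FG.
Qed.

Lemma ratmap_comp_rational F G G' :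
  is_rational_map F -> is_rational_map G ->
  is_rational_map (ratmap_comp G G') -> proj_eq (ratmap_comp G G') ratmap_id ->
  is_rational_map (ratmap_comp F G).
Proof.
move=> rF rG rGG' GG'; apply/is_rational_mapP; split.
  case/is_rational_mapP: rF => [[d Fh] _]; case/is_rational_mapP: rG => [[e Gh] _].
  by exists (d * e)%N => j; rewrite tnth_mktuple; apply: comp_homog.
have [a [b [a0 b0 E]]] := comp_congr rF rGG' ratmap_id_rational GG'.
case/is_rational_mapP: (rF) => _ [i Fi0]; exists i.
apply: contraNneq Fi0 => FG0; move: (E i).
rewrite -ratmap_compA ratmap_comp1 tnth_mktuple FG0 rmorph0 mulr0.
by move/esym/eqP; rewrite mulf_eq0 (negPf b0).
Qed.

Lemma birational_eq_equiv : equiv_class_of birational_eq.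
Proof.
split=> [p | p q | q p r]; rewrite /birational_eq.
- exact: proj_eq_refl.
- exact: proj_eq_sym.
- by apply: proj_eq_trans; case/and3P: (valP q).
Qed.

Canonical birational_equiv_rel := EquivRelPack birational_eq_equiv.

(* The product f * g is the composite x |-> f (g x). *)
Definition Cremona := {eq_quot birational_equiv_rel}.

HB.instance Definition _ := EqQuotient.on Cremona.
HB.instance Definition _ := Choice.on Cremona.

Definition cr_class (p : birational_pair) : Cremona := \pi_Cremona p.

Lemma cr_classP (p q : birational_pair) :
  reflect (cr_class p = cr_class q) (proj_eq (val p).1 (val q).1).
Proof. exact: eqmodP. Qed.

Fact bir_one_subproof : is_birational_pair (ratmap_id, ratmap_id).
Proof.
by rewrite /is_birational_pair /= ratmap_comp1 ratmap_id_rational proj_eq_refl.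
Qed.
Definition bir_one : birational_pair :=
  exist (fun p => is_birational_pair p) _ bir_one_subproof.

Fact bir_inv_subproof (p : birational_pair) :
  is_birational_pair ((val p).2, (val p).1).
Proof.
case/and5P: (valP p) => r1 r2 r12 e12 /andP[r21 e21].
apply/and5P; split; [exact: r2 | exact: r1 | exact: r21 | exact: e21 |].
by apply/andP; split; [exact: r12 | exact: e12].
Qed.
Definition bir_inv (p : birational_pair) : birational_pair :=
  exist (fun p => is_birational_pair p) _ (bir_inv_subproof p).

Fact bir_comp_aux (p q : birational_pair) :
  [/\ is_rational_map (ratmap_comp (val p).1 (val q).1),
      is_rational_map
        (ratmap_comp (ratmap_comp (val p).1 (val q).1)
                  (ratmap_comp (val q).2 (val p).2)) &
      proj_eq (ratmap_comp (ratmap_comp (val p).1 (val q).1)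
                        (ratmap_comp (val q).2 (val p).2)) ratmap_id].
Proof.
case/and5P: (valP p) => p1 p2 p12 ep12 /andP[p21 ep21].
case/and5P: (valP q) => q1 q2 q12 eq12 /andP[q21 eq21].
have r1 := ratmap_comp_rational p1 q1 q12 eq12.
have r2 := ratmap_comp_rational q2 p2 p21 ep21.
have r2' : is_rational_map (ratmap_comp (ratmap_comp (val q).1 (val q).2) (val p).2).
  exact: ratmap_comp_rational q12 p2 p21 ep21.
have e : proj_eq (ratmap_comp (ratmap_comp (val p).1 (val q).1)
           (ratmap_comp (val q).2 (val p).2)) (ratmap_comp (val p).1 (val p).2).
  rewrite ratmap_compA -[ratmap_comp (val q).1 _]ratmap_compA.
  apply: ratmap_comp_eqr; [exact: p1 | exact: r2' | exact: p2 |].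
  rewrite -[X in proj_eq _ X]ratmap_1comp; exact: ratmap_comp_eql eq12.
split; [exact: r1 | | exact: proj_eq_trans p12 e ep12].
rewrite -ratmap_compA; apply: ratmap_comp_rational p2 p21 ep21.
exact: ratmap_comp_rational r1 q2 q21 eq21.
Qed.

Fact bir_comp_subproof (p q : birational_pair) :
  is_birational_pair (ratmap_comp (val p).1 (val q).1,
                      ratmap_comp (val q).2 (val p).2).
Proof.
have [r1 r12 e12] := bir_comp_aux p q.
have [r2 r21 e21] := bir_comp_aux (bir_inv q) (bir_inv p).
apply/and5P; split; [exact: r1 | exact: r2 | exact: r12 | exact: e12 |].
by apply/andP; split; [exact: r21 | exact: e21].
Qed.
Definition bir_comp (p q : birational_pair) : birational_pair :=
  exist (fun p => is_birational_pair p) _ (bir_comp_subproof p q).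

Definition cr_one : Cremona := cr_class bir_one.
Definition cr_mul (f g : Cremona) : Cremona :=
  cr_class (bir_comp (repr f) (repr g)).
Definition cr_inv (f : Cremona) : Cremona := cr_class (bir_inv (repr f)).

Lemma cr_reprK p : proj_eq (val (repr (cr_class p))).1 (val p).1.
Proof. by apply/cr_classP; rewrite /cr_class reprK. Qed.

Lemma bir_fst (p : birational_pair) : is_rational_map (val p).1.
Proof. by case/and3P: (valP p). Qed.

Lemma cr_classM p q : cr_class (bir_comp p q) = cr_mul (cr_class p) (cr_class q).
Proof.
apply/cr_classP => /=; rewrite proj_eq_sym.
set p' := repr (cr_class p); set q' := repr (cr_class q).
have e : proj_eq (ratmap_comp (val p').1 (val q').1) (ratmap_comp (val p').1 (val q).1).
  by apply: ratmap_comp_eqr; [exact: bir_fst | exact: bir_fst | exact: bir_fst |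
    exact: cr_reprK].
apply: proj_eq_trans e _; first exact: (bir_fst (bir_comp p' q)).
exact/ratmap_comp_eql/cr_reprK.
Qed.

Lemma cr_ind (A : Cremona -> Prop) :
  (forall p, A (cr_class p)) -> forall f, A f.
Proof. by move=> Ap f; rewrite -[f]reprK; apply: Ap. Qed.

Lemma cr_mulA : associative cr_mul.
Proof.
elim/cr_ind=> p; elim/cr_ind=> q; elim/cr_ind=> r; rewrite -!cr_classM.
by apply/cr_classP; rewrite /= ratmap_compA proj_eq_refl.
Qed.

Lemma cr_mul1 : left_id cr_one cr_mul.
Proof.
elim/cr_ind=> p; rewrite -cr_classM.
by apply/cr_classP; rewrite /= ratmap_1comp proj_eq_refl.
Qed.

Lemma cr_mulr1 : right_id cr_one cr_mul.
Proof.
elim/cr_ind=> p; rewrite -cr_classM.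
by apply/cr_classP; rewrite /= ratmap_comp1 proj_eq_refl.
Qed.

Lemma cr_mulV : left_inverse cr_one cr_inv cr_mul.
Proof.
move=> f; rewrite -{2}[f]reprK -cr_classM; apply/cr_classP.
case/and5P: (valP (repr f)) => _ _ _ _ /andP[_ e]; exact: e.
Qed.

Lemma cr_mulrV : right_inverse cr_one cr_inv cr_mul.
Proof.
move=> f; rewrite -{1}[f]reprK -cr_classM; apply/cr_classP.
case/and5P: (valP (repr f)) => _ _ _ e _; exact: e.
Qed.

HB.instance Definition _ := isGroup.Build Cremona
  cr_mulA cr_mul1 cr_mulr1 cr_mulV cr_mulrV.

Definition cr_forms (f : Cremona) : 3.-tuple {mpoly K[3]} := (val (repr f)).1.

Definition no_common_factor F :=
  forall h : {mpoly K[3]},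
    (forall i, exists q, tnth F i = q * h) -> exists c : K, h = c%:MP.

Definition has_degree (f : Cremona) (d : nat) :=
  exists F, [/\ is_rational_map F, proj_eq (cr_forms f) F,
                no_common_factor F & forall i, tnth F i \is d.-homog].

Definition linear_degree_growth (f : Cremona) :=
  exists deg : nat -> nat,
    (forall n, has_degree (f ^+ n)%g (deg n)) /\
    (exists2 A, (0 < A)%N &
       forall n, (0 < n)%N -> (n <= A * deg n)%N /\ (deg n <= A * n)%N).

(* K(x, y) is built as K(x)(y); the affine chart is x = X_0/X_2, y = X_1/X_2. *)
Local Notation Kx := {fraction {poly K}}.
Local Notation Kxy := {fraction {poly {fraction {poly K}}}}.

Definition Kx_to_Kxy : Kx -> Kxy := @tofrac {poly Kx} \o polyC.
HB.instance Definition _ :=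
  GRing.RMorphism.copy Kx_to_Kxy (@tofrac {poly Kx} \o polyC).

Definition K_to_Kxy : K -> Kxy := Kx_to_Kxy \o (@tofrac {poly K} \o polyC).
HB.instance Definition _ :=
  GRing.RMorphism.copy K_to_Kxy (Kx_to_Kxy \o (@tofrac {poly K} \o polyC)).

Definition coord_x : Kxy := Kx_to_Kxy (tofrac ('X : {poly K})).
Definition coord_y : Kxy := tofrac ('X : {poly Kx}).

Definition eval_chart (p : {mpoly K[3]}) : Kxy :=
  mmap K_to_Kxy (tnth [tuple coord_x; coord_y; 1]) p.

(* f is the map (x, y) |-> (u, v). *)
Definition is_affine_map (f : Cremona) (u v : Kxy) :=
  let F := cr_forms f in
  eval_chart (tnth F ord0) / eval_chart (tnth F ord_max) = u /\
  eval_chart (tnth F (inord 1)) / eval_chart (tnth F ord_max) = v.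

Definition homography (L : fieldType) (M : 'M[L]_2) (z : L) : L :=
  (M ord0 ord0 * z + M ord0 ord_max) / (M ord_max ord0 * z + M ord_max ord_max).

(* f belongs to Jonq(K) and acts on the base by P. *)
Definition base_action (f : Cremona) (P : PGL 2 K) :=
  exists (M : GLn 2 K) (A : GLn 2 Kx), P = pgl_class M /\
    is_affine_map f (homography (map_mx K_to_Kxy (val M)) coord_x)
                    (homography (map_mx Kx_to_Kxy (val A)) coord_y).

Definition Jonq (f : Cremona) := exists P, base_action f P.

Definition Jonq0 (f : Cremona) := base_action f 1%g.

Definition jonquieres_twist (f : Cremona) := Jonq f /\ linear_degree_growth f.

Definition base_wandering (f : Cremona) :=
  exists2 P, base_action f P & forall n, (0 < n)%N -> (P ^+ n)%g <> 1%g.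

Definition Cent (f g : Cremona) := commute g f.

Definition Cent0 (f g : Cremona) := Cent f g /\ Jonq0 g.

Definition Centb (f : Cremona) (P : PGL 2 K) :=
  exists2 g, Cent f g & base_action g P.

Definition scaling (g : Cremona) :=
  exists2 t : K, t != 0 & is_affine_map g coord_x (K_to_Kxy t * coord_y).

Definition translation (g : Cremona) :=
  exists t : K, is_affine_map g coord_x (coord_y + K_to_Kxy t).

(* The subset S is {h^-1 g h | g in T} for some h in Jonq(K). *)
Definition Jonq_conjugate (S T : Cremona -> Prop) :=
  exists2 h, Jonq h & forall g, S (g ^ h)%g <-> T g.

End CremonaGroup.

Definition torsion_subset (G : groupType) (S : G -> Prop) :=
  forall g, S g -> exists2 n, (0 < n)%N & (g ^+ n)%g = 1%g.

Definition has_order_two (G : groupType) (S : G -> Prop) :=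
  exists2 s : G, s <> 1%g & forall g, S g <-> g = 1%g \/ g = s.

Definition trivial_subset (G : groupType) (S : G -> Prop) :=
  forall g, S g <-> g = 1%g.

(* 'I_k.+1 is the group Z/(k+1), trivial when k = 0. *)
Definition iso_finite_cyclic_times_Z (G : groupType) (S : G -> Prop) :=
  exists (k : nat) (phi : 'I_k.+1 * int -> G),
    [/\ forall u v, phi (u + v) = (phi u * phi v)%g, injective phi &
        forall g, S g <-> exists u, g = phi u].

Definition cyclic_subset (G : groupType) (a : G) (g : G) :=
  exists n, g = (a ^+ n)%g \/ g = (a ^- n)%g.

Definition finite_index_in (G : groupType) (H S : G -> Prop) :=
  (forall g, H g -> S g) /\
  exists2 s : seq G, (forall q, q \in s -> S q) &
    forall g, S g -> exists2 q, q \in s & H (q^-1 * g)%g.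

(* Main.v *)
(* Write f as (x, y) |-> (M x, A(x) y) with M in GL_2(K) and A in GL_2(K(x)); iterates of f are
   controlled by the matrices A_n of f^n, and deg f^n is bounded by the height of A_n up to 2, so
   these heights are unbounded. As M has infinite order we may assume that it is x |-> ax or
   x |-> x + 1.

   Cent(f) preserves the fibration: if g commutes with f, the pullback h of x by g satisfies
   f^* h = a'h + b'. If h depended on y, then specializing y at three constants would express A_n
   through zeros of binary forms of bounded height.

   Cent_0(f): for g = (x, B(x) y) commuting with f, the quantity tr(B)^2 / det(B) is invariant by M,
   hence constant. If it is nonzero, B can be conjugated to a constant matrix, diagonal or unipotent;
   otherwise g is an involution, and two distinct ones would give anticommuting lifts, whereas any
   two lifts commute because f has unbounded growth.

   Cent_b(f): if the number of zeros of det A_n (for a primitive polynomial representative) outside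
   the fixed points of M is unbounded, then for g in Cent(f) the polynomials det A_n and
   det A_n o g share such a zero, which forces the multiplier of g into finitely many cosets of the
   cyclic group of M. Otherwise the degeneration over a fixed point of M, say infinity, is unbounded.
   Elementary transformations there reduce to the case where the leading matrix of A is singular but
   not nilpotent, and comparing the two leading coefficients of tr(A(gx) B) and tr(B(fx) A) shows
   that a power of the multiplier of g is a power of that of f. So the cyclic group generated by M has
   finite index in Cent_b(f), a subgroup of K^* or of K. *)

From HB Require Import structures.
Require Import Defs.
From mathcomp Require Import all_boot all_order all_algebra.
From mathcomp Require Import mpoly.
From mathcomp Require Import ring zify.
From mathcomp Require cyclic.
From Stdlib Require Import Classical ClassicalEpsilon.

Set Implicit Arguments.
Unset Strict Implicit.
Unset Printing Implicit Defensive.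

Import GRing.Theory.
Local Open Scope ring_scope.


(** * Fields of rational functions *)

(** The growth of degrees is turned at once into [unbounded_growth]: no single height bounds the
    matrices of all iterates. This property is stable under conjugation by Jonquières maps, so
    coordinates can be changed freely. Noncommuting lifts and a second invariant fibration are
    excluded by one principle: either would determine A_n from data whose height does not depend on
    n. The zeros of det A_n are useful because M carries each of them to one of the finitely many
    zeros of det A. If x and g(x) are both zeros of det A_n, the multiplier of g is, up to a power
    of that of M, a quotient (or a difference) of two elements of one finite set. At a fixed point
    of M this gives nothing, and the gap 2 deg A - deg(det A) takes over. A scaling has two fixed
    points, exchanged by x |-> 1/x; a translation has one, and its infinite order forces
    characteristic 0. Finite index of a cyclic group is not yet a product decomposition: the finite
    factor comes from the cyclicity of finite subgroups of K^*, and is trivial for subgroups of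
    K. *)

Lemma frac_numden (R : idomainType) (z : {fraction R}) :
  exists n d : R, d != 0 /\ z = tofrac n / tofrac d.
Proof.
elim/quotW: z => x; have d0 := denom_ratioP x.
exists x.1, x.2; split=> //; have d0' : tofrac x.2 != 0 by rewrite tofrac_eq0.
apply: (mulIf d0'); rewrite divfK //; unlock tofrac.
rewrite -[LHS]FracField.pi_mul; apply/eqmodP; rewrite /= FracField.equivfE.
by rewrite /FracField.mulf !numden_Ratio ?mulr1 ?oner_eq0 // mulrC.
Qed.

(* A presentation of the field L(t). Reasoning from it alone keeps the iterated fraction field
   K(x)(y) folded: conversion problems that unfold [{fraction _}] are intractable. *)
Record ratfun (L : fieldType) := RatFun {
  rf_field :> fieldType;
  rf_emb : {rmorphism L -> rf_field};
  rf_gen : rf_field;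
  rf_eval_eq0 : forall p : {poly L}, (map_poly rf_emb p).[rf_gen] = 0 -> p = 0;
  rf_numden : forall z, exists n d : {poly L},
    d != 0 /\ z = (map_poly rf_emb n).[rf_gen] / (map_poly rf_emb d).[rf_gen] }.

Definition rf_eval (L : fieldType) (F : ratfun L) (p : {poly L}) : F :=
  (map_poly (@rf_emb L F) p).[rf_gen F].

Section Eval.
Variables (L : fieldType) (F : ratfun L).
Local Notation ev := (@rf_eval L F).

Fact rf_eval_zmod : zmod_morphism ev.
Proof. by move=> p q; rewrite /rf_eval rmorphB hornerD hornerN. Qed.
Fact rf_eval_monoid : monoid_morphism ev.
Proof. by split=> [|p q]; rewrite /rf_eval ?rmorph1 ?hornerC // rmorphM hornerM. Qed.
HB.instance Definition _ := GRing.isZmodMorphism.Build {poly L} F ev rf_eval_zmod.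
HB.instance Definition _ := GRing.isMonoidMorphism.Build {poly L} F ev rf_eval_monoid.

Lemma rf_evalC c : ev c%:P = rf_emb F c.
Proof. by rewrite /rf_eval map_polyC hornerC. Qed.

Lemma rf_evalX : ev 'X = rf_gen F.
Proof. by rewrite /rf_eval map_polyX hornerX. Qed.

Lemma rf_eval_inj : injective ev.
Proof.
move=> p q /eqP; rewrite -subr_eq0 -rmorphB => /eqP/rf_eval_eq0/eqP.
by rewrite subr_eq0 => /eqP.
Qed.

Lemma rf_eval_neq0 p : (ev p == 0) = (p == 0).
Proof. by rewrite -(rmorph0 ev) (inj_eq rf_eval_inj). Qed.

Lemma ratfun_ind (P : F -> Prop) :
  (forall c, P (rf_emb F c)) -> P (rf_gen F) ->
  (forall z w, P z -> P w -> P (z + w)) -> (forall z w, P z -> P w -> P (z * w)) ->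
  (forall z, P z -> P z^-1) -> forall z, P z.
Proof.
move=> PC PX PD PM PV z; have [n [d [_ ->]]] := rf_numden z.
have Pp (p : {poly L}) : P (ev p).
  elim/poly_ind: p => [|p c Pp]; first by rewrite rmorph0 -(rmorph0 (rf_emb F)).
  by rewrite rmorphD rmorphM /= rf_evalX rf_evalC; apply: PD; first apply: PM.
by apply: PM; [apply: Pp | apply/PV/Pp].
Qed.

End Eval.

Lemma ord3P (i : 'I_3) : [\/ i = ord0, i = inord 1 | i = ord_max].
Proof.
case: i => [[|[|[|//]]] lti]; [constructor 1 | constructor 2 | constructor 3];
  by apply: val_inj; rewrite //= inordK.
Qed.

Lemma tnth3 (T : Type) (a b c : T) :
  [/\ tnth [tuple a; b; c] ord0 = a, tnth [tuple a; b; c] (inord 1) = b &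
      tnth [tuple a; b; c] ord_max = c].
Proof. by rewrite !(tnth_nth a) /= inordK. Qed.

Lemma big_ord3 (R : Type) (idx : R) (op : Monoid.law idx) (F : 'I_3 -> R) :
  \big[op/idx]_(i < 3) F i = op (F ord0) (op (F (inord 1)) (F ord_max)).
Proof.
have o1 : inord 1 = lift ord0 ord0 :> 'I_3 by apply: val_inj; rewrite /= inordK.
have o2 : ord_max = lift ord0 (lift ord0 ord0) :> 'I_3 by apply: val_inj.
by rewrite !big_ord_recl big_ord0 Monoid.mulm1 o1 o2.
Qed.

Lemma mmap1_tuple3 (S : comNzRingType) (u v w : S) (m : 'X_{1..3}) :
  mmap1 (tnth [tuple u; v; w]) m = u ^+ m ord0 * (v ^+ m (inord 1) * w ^+ m ord_max).
Proof. by rewrite /mmap1 big_ord3; have [-> -> ->] := tnth3 u v w. Qed.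

Lemma mmap1_affine (S : comNzRingType) (u v : S) (m : 'X_{1..3}) :
  mmap1 (tnth [tuple u; v; 1]) m = u ^+ m ord0 * v ^+ m (inord 1).
Proof. by rewrite mmap1_tuple3 expr1n mulr1. Qed.

(** * Forms in three variables and their values in the affine chart *)

Section Charts.
Variables (K : fieldType) (F : ratfun K) (E : ratfun F).

Definition const (c : K) : E := rf_emb E (rf_emb F c).
HB.instance Definition _ := GRing.RMorphism.copy const (rf_emb E \o rf_emb F).

Local Notation X := (rf_emb E (rf_gen F)).
Local Notation Y := (rf_gen E).

Definition eval_at (u v : E) (p : {mpoly K[3]}) : E :=
  mmap const (tnth [tuple u; v; 1]) p.
HB.instance Definition _ u v := GRing.RMorphism.copy (eval_at u v)
  (mmap const (tnth [tuple u; v; 1])).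

Local Notation ch := (eval_at X Y).

Lemma eval_atC u v c : eval_at u v c%:MP = const c.
Proof. exact: mmapC. Qed.

Lemma eval_at_coord u v (i : 'I_3) : eval_at u v 'X_i = tnth [tuple u; v; 1] i.
Proof. by rewrite /eval_at mmapX mmap1U. Qed.

Lemma eval_at_sum u v p :
  eval_at u v p = \sum_(m <- msupp p) const p@_m * (u ^+ m ord0 * v ^+ m (inord 1)).
Proof. by apply: eq_bigr => m _; rewrite mmap1_affine. Qed.

(** With K[x][y] inside E, an identity in E between polynomial expressions can be tested coefficient
    by coefficient. *)
Lemma bivariate_embedding :
  exists2 phi : {rmorphism {poly {poly K}} -> E}, injective phi &
    [/\ forall c, phi c%:P%:P = const c, phi 'X%:P = X & phi 'X = Y].
Proof.
exists (rf_eval E \o map_poly (rf_eval F)); last first.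
  by rewrite /= !map_polyX map_polyC !rf_evalX; split=> [c||] //=;
    rewrite ?map_polyC ?rf_evalC /= ?rf_evalC ?rf_evalX.
by move=> q r /rf_eval_inj/(map_inj_poly (@rf_eval_inj _ _) (rmorph0 _)).
Qed.

(** In a fixed degree the exponents of two variables determine the third, so setting the last
    coordinate to 1 loses nothing. Identities between forms are proved below by checking them in
    E. *)
Lemma form_eq0 d (p : {mpoly K[3]}) :
  p \is d.-homog -> ch p = 0 -> p = 0.
Proof.
move=> ph p0; apply/mpolyP => m; rewrite mcoeff0.
have [->//|/negPf pm] := eqVneq p@_m 0.
have mp : m \in msupp p by rewrite mcoeff_msupp pm.
have [phi phi_inj [phiC phiX phiY]] := bivariate_embedding.
pose b := \sum_(m <- msupp p) ((p@_m)%:P%:P * (('X^(m ord0))%:P * 'X^(m (inord 1)))) :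
  {poly {poly K}}.
have : phi b = ch p.
  rewrite eval_at_sum raddf_sum; apply: eq_bigr => k _ /=.
  by rewrite !rmorphM /= !rmorphXn /= phiC phiX phiY.
rewrite p0 -[0 in RHS](rmorph0 phi) => /phi_inj b0.
have := congr1 (fun q : {poly {poly K}} => q`_(m (inord 1))`_(m ord0)) b0.
rewrite /b coef0 coef0 !coef_sum (bigD1_seq m) ?msupp_uniq //= big_seq_cond.
rewrite big1 => [|k /andP[kp km]].
  by rewrite addr0 !coefCM coefXn eqxx mulr1 coefXn eqxx mulr1.
rewrite !coefCM coefXn; case: (altP eqP) => [E1|]; last first.
  by rewrite !mulr0 coef0 mulr0.
rewrite mulr1 coefXn; case: (altP eqP) => [E0|]; last by rewrite mulr0.
case/negP: km; apply/eqP/mnmP => i.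
have := dhomog_mf ph kp; have := dhomog_mf ph mp; rewrite /= !mdegE.
rewrite !big_ord3 => <-; rewrite -E0 -E1 => /addnI/addnI E2.
by case: (ord3P i) => ->.
Qed.

Lemma dhomogC (c : K) : c%:MP \is [in K[3], 0.-homog].
Proof. by rewrite -[c%:MP]mulr1 mul_mpolyC; apply/rpredZ/dhomog1. Qed.

Definition is_form (z : E) := exists d p, p \is d.-homog /\ ch p = z.

Lemma form_padding d e (p : {mpoly K[3]}) : p \is d.-homog -> (d <= e)%N ->
  exists q, q \is e.-homog /\ ch q = ch p.
Proof.
move=> ph de; exists (p * 'X_ord_max ^+ (e - d)); split; last first.
  by rewrite rmorphM rmorphXn /= eval_at_coord; have [_ _ ->] := tnth3 X Y 1;
    rewrite expr1n mulr1.
rewrite -[X in X.-homog](subnKC de); apply: dhomogM => //.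
rewrite -[X in X.-homog]mul1n; apply: dhomogMn; by rewrite dhomogX /= mdeg1.
Qed.

Lemma is_formD z w : is_form z -> is_form w -> is_form (z + w).
Proof.
move=> [d [p [ph <-]]] [e [q [qh <-]]].
have [p' [ph' <-]] := form_padding ph (leq_maxl d e).
have [q' [qh' <-]] := form_padding qh (leq_maxr d e).
by exists (maxn d e), (p' + q'); rewrite rpredD //= rmorphD.
Qed.

Lemma is_formM z w : is_form z -> is_form w -> is_form (z * w).
Proof.
move=> [d [p [ph <-]]] [e [q [qh <-]]].
by exists (d + e)%N, (p * q); rewrite rmorphM; split=> //; apply: dhomogM.
Qed.

Lemma is_formC c : is_form (const c).
Proof. by exists 0%N, c%:MP; rewrite eval_atC dhomogC. Qed.

Lemma is_formX : is_form X.
Proof.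
exists 1%N, 'X_ord0; rewrite eval_at_coord; have [-> _ _] := tnth3 X Y 1.
by rewrite dhomogX /= mdeg1.
Qed.

Lemma is_formY : is_form Y.
Proof.
exists 1%N, 'X_(inord 1); rewrite eval_at_coord; have [_ -> _] := tnth3 X Y 1.
by rewrite dhomogX /= mdeg1.
Qed.

Lemma ratfun2_ind (P : E -> Prop) :
  (forall c, P (const c)) -> P X -> P Y ->
  (forall z w, P z -> P w -> P (z + w)) -> (forall z w, P z -> P w -> P (z * w)) ->
  (forall z, P z -> P z^-1) -> forall z, P z.
Proof.
move=> PC PX PY PD PM PV; apply: (@ratfun_ind _ E) => // a.
apply: (@ratfun_ind _ F (fun a => P (rf_emb E a))) => [//|//|z w|z w|z] *;
  by rewrite (rmorphD, rmorphM, fmorphV); auto.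
Qed.

(** Quotients of forms contain the generators of E and are closed under the field operations;
    padding by powers of the last coordinate equalizes degrees. *)
Lemma forms_quotient (z : E) : exists d p q,
  [/\ p \is d.-homog, q \is d.-homog, q != 0 & z = ch p / ch q].
Proof.
suff [a [b [[d [p [ph Ea]]] [e [q [qh Eb]]] b0 ->]]] :
    exists a b, [/\ is_form a, is_form b, b != 0 & z = a / b].
  rewrite -{}Ea -{}Eb in b0 *; have [p' [ph' Ep]] := form_padding ph (leq_maxl d e).
  have [q' [qh' Eq]] := form_padding qh (leq_maxr d e).
  exists (maxn d e), p', q'; rewrite {}Ep; split; [exact: ph' | exact: qh' | |].
    by apply: contraNneq b0 => q0; rewrite -Eq q0 rmorph0.
  by rewrite Eq.
have f1 : is_form 1 by rewrite -[1](rmorph1 const); apply: is_formC.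
have int w : is_form w -> exists a b, [/\ is_form a, is_form b, b != 0 & w = a / b].
  by exists w, 1; rewrite oner_eq0 divr1.
elim/ratfun2_ind: z => [c|||z w|z w|z].
- exact/int/is_formC.
- exact/int/is_formX.
- exact/int/is_formY.
- move=> [a [b [fa fb b0 ->]]] [c [d [fc fd d0 ->]]].
  exists (a * d + c * b), (b * d); rewrite mulf_neq0 // addf_div //.
  by split=> //; first apply: is_formD; apply: is_formM.
- move=> [a [b [fa fb b0 ->]]] [c [d [fc fd d0 ->]]].
  by exists (a * c), (b * d); rewrite mulf_neq0 // mulf_div; split=> //; apply: is_formM.
- move=> [a [b [fa fb b0 ->]]]; rewrite invf_div.
  have [->|a0] := eqVneq a 0; last by exists b, a.
  rewrite invr0 mulr0; apply: int; rewrite -[0](rmorph0 const); exact: is_formC.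
Qed.

Definition fixes_K (s : E -> E) := forall c, s (const c) = const c.

Lemma eval_at_morph (s : {rmorphism E -> E}) p : fixes_K s ->
  s (ch p) = eval_at (s X) (s Y) p.
Proof.
move=> sK; rewrite !eval_at_sum raddf_sum; apply: eq_bigr => m _ /=.
by rewrite !rmorphM sK !rmorphXn.
Qed.

Lemma eval_at_scale d (p : {mpoly K[3]}) (G : 3.-tuple {mpoly K[3]}) :
  p \is d.-homog -> ch (tnth G ord_max) != 0 ->
  ch (p \mPo G) = ch (tnth G ord_max) ^+ d *
    eval_at (ch (tnth G ord0) / ch (tnth G ord_max))
            (ch (tnth G (inord 1)) / ch (tnth G ord_max)) p.
Proof.
move=> ph G0; rewrite comp_mpolyE raddf_sum /= (eval_at_sum (_ / _)) mulr_sumr !big_seq.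
apply: eq_bigr => m mp; rewrite -mul_mpolyC rmorphM /= eval_atC big_ord3.
rewrite -(dhomog_mf ph mp) /= mdegE big_ord3 !rmorphM /= !rmorphXn /=.
move: (ch _) (ch _) (ch _) G0 => a b c c0; rewrite [RHS]mulrCA; congr (_ * _).
have {}c0 k : c ^+ k != 0 by rewrite expf_neq0.
by rewrite !exprD !expr_div_n; field; rewrite !c0.
Qed.

(** The hypothesis says that u and v are algebraically independent over K. A quotient of forms in x,
    y is sent to the same quotient in u, v; [R] is the graph of this map, functional by
    [form_eq0]. *)
Lemma exists_morph (u v : E) :
  (forall d (p : {mpoly K[3]}), p \is d.-homog -> p != 0 -> eval_at u v p != 0) ->
  exists s : {rmorphism E -> E}, [/\ fixes_K s, s X = u & s Y = v].
Proof.
move=> nz.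
pose R z w := exists d p q,
  [/\ p \is d.-homog, q \is d.-homog, q != 0, z = ch p / ch q & w = eval_at u v p / eval_at u v q].
have chn0 d q : q \is d.-homog -> q != 0 -> ch q != 0.
  by move=> qh; apply: contraNneq => /(form_eq0 qh) ->.
have Rfun z w w' : R z w -> R z w' -> w = w'.
  move=> [d [p [q [ph qh q0 -> ->]]]] [e [p' [q' [ph' qh' q0' Ez ->]]]].
  move/eqP: Ez; rewrite eqr_div ?(chn0 _ _ qh) ?(chn0 _ _ qh') // -!rmorphM -subr_eq0 -rmorphB.
  have h : p * q' - p' * q \is (d + e).-homog.
    by apply: rpredB; [|rewrite addnC]; apply: dhomogM.
  move/eqP/(form_eq0 h)/eqP; rewrite subr_eq0 => /eqP Epq.
  apply/eqP; rewrite eqr_div ?(nz _ _ qh) ?(nz _ _ qh') // -!rmorphM /= Epq.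
  by rewrite eqxx.
have Rtot z : exists w, R z w.
  have [d [p [q [ph qh q0 ->]]]] := forms_quotient z.
  by exists (eval_at u v p / eval_at u v q), d, p, q.
have [s sR] : exists s : E -> E, forall z, R z (s z).
  by exists (fun z => proj1_sig (constructive_indefinite_description _ (Rtot z)));
    move=> z; apply: proj2_sig.
have sE z w : R z w -> s z = w by apply: Rfun.
have sform z : is_form z -> forall d p, p \is d.-homog -> ch p = z -> s z = eval_at u v p.
  move=> _ d p ph <-; apply: sE; exists d, p, ('X_ord_max ^+ d).
  have xh : 'X_ord_max ^+ d \is [in K[3], d.-homog].
    by rewrite -[X in X.-homog]mul1n; apply: dhomogMn; rewrite dhomogX /= mdeg1.
  rewrite !rmorphXn /= !eval_at_coord.
  have [_ _ ->] := tnth3 X Y 1; have [_ _ ->] := tnth3 u v 1.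
  rewrite expr1n !divr1; split=> //; apply: expf_neq0.
  by rewrite -msupp_eq0 msuppX.
have sK c : s (const c) = const c.
  rewrite (sform _ (is_formC c) 0%N c%:MP) ?eval_atC ?eval_atC //.
  exact: dhomogC.
have sD : nmod_morphism s.
  split=> [|z w]; first by rewrite -[0](rmorph0 const) sK.
  have [d [p [q [ph qh q0 -> ->]]]] := sR z; have [e [p' [q' [ph' qh' q0' -> ->]]]] := sR w.
  apply: sE; exists (d + e)%N, (p * q' + p' * q), (q * q').
  rewrite !rmorphD !rmorphM /= !addf_div ?(chn0 _ _ qh) ?(chn0 _ _ qh') ?(nz _ _ qh) ?(nz _ _ qh') //.
  split; [| exact: dhomogM | exact: mulf_neq0 | by [] | by []].
  by apply: rpredD; [|rewrite addnC]; apply: dhomogM.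
have sM : monoid_morphism s.
  split=> [|z w]; first by rewrite -[1](rmorph1 const) sK.
  have [d [p [q [ph qh q0 -> ->]]]] := sR z; have [e [p' [q' [ph' qh' q0' -> ->]]]] := sR w.
  apply: sE; exists (d + e)%N, (p * p'), (q * q').
  by rewrite !rmorphM /= !mulf_div; split=> //; [apply: dhomogM|apply: dhomogM|apply: mulf_neq0].
pose sa := GRing.isNmodMorphism.Build _ _ s sD.
pose sm := GRing.isMonoidMorphism.Build _ _ s sM.
pose S : {rmorphism E -> E} := HB.pack s sa sm.
have X1 i : 'X_i \is [in K[3], 1.-homog] by rewrite dhomogX /= mdeg1.
exists S; split=> //=.
  rewrite (sform _ is_formX _ _ (X1 ord0)) ?eval_at_coord ?eval_at_coord;
    by [have [-> _ _] := tnth3 u v 1 | have [-> _ _] := tnth3 X Y 1].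
rewrite (sform _ is_formY _ _ (X1 (inord 1))) ?eval_at_coord ?eval_at_coord;
  by [have [_ -> _] := tnth3 u v 1 | have [_ -> _] := tnth3 X Y 1].
Qed.

End Charts.


(** * The Cremona group acting on K(x, y) *)

Section Pullback.
Variables (K : fieldType) (F : ratfun K) (E : ratfun F).
Local Notation X := (rf_emb E (rf_gen F)).
Local Notation Y := (rf_gen E).
Local Notation ch := (@eval_at K F E X Y).
Implicit Types (f g : Cremona K) (G H : 3.-tuple {mpoly K[3]}).

Definition has_chart G (u v : E) :=
  [/\ exists d, forall i, tnth G i \is d.-homog, tnth G ord_max != 0,
      ch (tnth G ord0) / ch (tnth G ord_max) = u &
      ch (tnth G (inord 1)) / ch (tnth G ord_max) = v].

Definition affine_map f (u v : E) :=
  let G := cr_forms f in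
  ch (tnth G ord0) / ch (tnth G ord_max) = u /\
  ch (tnth G (inord 1)) / ch (tnth G ord_max) = v.

(** The comorphism of f on K(x, y); it reverses the order of composition. *)
Definition pullback f (s : {rmorphism E -> E}) := fixes_K s /\ affine_map f (s X) (s Y).

Lemma form_neq0 d (p : {mpoly K[3]}) : p \is d.-homog -> p != 0 -> ch p != 0.
Proof. by move=> ph; apply: contraNneq => /(form_eq0 ph) ->. Qed.

Lemma has_chart_coord G u v : has_chart G u v ->
  forall i, ch (tnth G i) = tnth [tuple u; v; 1] i * ch (tnth G ord_max).
Proof.
case=> [[d Gh] G0 <- <-] i; have c0 := form_neq0 (Gh ord_max) G0.
have [e0 e1 e2] := tnth3 (ch (tnth G ord0) / ch (tnth G ord_max))
  (ch (tnth G (inord 1)) / ch (tnth G ord_max)) 1.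
by case: (ord3P i) => ->; rewrite ?e0 ?e1 ?e2 ?divfK ?mul1r.
Qed.

Lemma has_chart_proj_eq G H u v : has_chart G u v -> has_chart H u v -> proj_eq G H.
Proof.
move=> cG cH; have EG := has_chart_coord cG; have EH := has_chart_coord cH.
case: cG cH => [[d Gh] _ _ _] [[e Hh] _ _ _]; apply/proj_eqP => i j.
apply/eqP; rewrite -subr_eq0; apply/eqP/(@form_eq0 _ F E (d + e)%N).
  by apply: rpredB; apply: dhomogM.
by rewrite rmorphB !rmorphM /= (EG i) (EG j) (EH i) (EH j); ring.
Qed.

Lemma proj_eq_has_chart G H u v d : has_chart G u v -> proj_eq G H ->
  (forall i, tnth H i \is d.-homog) -> (exists i, tnth H i != 0) -> has_chart H u v.
Proof.
move=> cG /proj_eqP GH Hh [k Hk0]; have EG := has_chart_coord cG.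
case: cG => [[e Gh] G0 _ _].
have EH i : tnth H i * tnth G ord_max = tnth G i * tnth H ord_max by rewrite GH mulrC.
have H0 : tnth H ord_max != 0.
  apply: contraNneq Hk0 => H0; have := EH k.
  by rewrite H0 mulr0 => /eqP; rewrite mulf_eq0 (negPf G0) orbF.
have c0 := form_neq0 (Gh _) G0; have d0 := form_neq0 (Hh _) H0.
have chE i : ch (tnth H i) / ch (tnth H ord_max) = tnth [tuple u; v; 1] i.
  apply: (canLR (mulfK d0)); apply: (mulIf c0).
  by rewrite -rmorphM EH rmorphM /= EG; ring.
by have [e0 e1 _] := tnth3 u v 1; split; [exists d | | rewrite chE | rewrite chE].
Qed.

Lemma has_chart_id : has_chart (ratmap_id K) X Y.
Proof.
have [e0 e1 e2] := tnth3 X Y 1.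
split; rewrite ?tnth_mktuple ?eval_at_coord ?e0 ?e1 ?e2 ?divr1 //.
  by exists 1%N => i; rewrite tnth_mktuple dhomogX /= mdeg1.
by rewrite -msupp_eq0 msuppX.
Qed.

Lemma has_chart_comp G H (s t : {rmorphism E -> E}) : fixes_K s -> fixes_K t ->
  has_chart G (s X) (s Y) -> has_chart H (t X) (t Y) ->
  has_chart (ratmap_comp G H) (t (s X)) (t (s Y)).
Proof.
move=> sK tK cG cH; have EG := has_chart_coord cG.
case: cG cH => [[d Gh] G0 uG vG] [[e Hh] H0 uH vH].
have h0 := form_neq0 (Hh _) H0; have g0 := form_neq0 (Gh _) G0.
have E1 i : ch (tnth G i \mPo H) = ch (tnth H ord_max) ^+ d * t (ch (tnth G i)).
  by rewrite (eval_at_scale (Gh i)) // uH vH eval_at_morph.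
have E0 : ch (tnth G ord_max \mPo H) != 0.
  by rewrite E1 mulf_neq0 ?expf_neq0 // fmorph_eq0.
split.
- by exists (d * e)%N => i; rewrite tnth_mktuple; apply: comp_homog.
- by rewrite tnth_mktuple; apply: contraNneq E0 => ->; rewrite rmorph0.
- rewrite !tnth_mktuple !E1 -uG fmorph_div -mulf_div divff ?mul1r //.
  exact: expf_neq0.
rewrite !tnth_mktuple !E1 -vG fmorph_div -mulf_div divff ?mul1r //.
exact: expf_neq0.
Qed.

Lemma exists_forms (u v : E) : exists G, has_chart G u v.
Proof.
have [d [p [q [ph qh q0 ->]]]] := forms_quotient u.
have [e [p' [q' [ph' qh' q0' ->]]]] := forms_quotient v.
exists [tuple p * q'; p' * q; q * q']; rewrite /has_chart.
have [-> -> ->] := tnth3 (p * q') (p' * q) (q * q').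
have c0 := form_neq0 qh q0; have c0' := form_neq0 qh' q0'.
split; last 2 first.
- by rewrite !rmorphM /=; field; rewrite c0 c0'.
- by rewrite !rmorphM /=; field; rewrite c0 c0'.
- exists (d + e)%N => i; have [t0 t1 t2] := tnth3 (p * q') (p' * q) (q * q').
  by case: (ord3P i) => ->; rewrite ?t0 ?t1 ?t2; first [exact: dhomogM | rewrite addnC; exact: dhomogM].
exact: mulf_neq0.
Qed.

Lemma has_chart_rational G u v : has_chart G u v -> is_rational_map G.
Proof. by case=> Gh G0 _ _; apply/is_rational_mapP; split=> //; exists ord_max. Qed.

(** Dominance of f: composing once more with the inverse of f gives back p up to nonzero factors, so
    p cannot vanish on the image. *)
Lemma cr_forms_comp f d (p : {mpoly K[3]}) :
  p \is d.-homog -> p != 0 -> p \mPo cr_forms f != 0.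
Proof.
move=> ph p0; set G := cr_forms f; set H := (val (repr f)).2.
case/and5P: (valP (repr f)) => _ _ rGH eGH _; rewrite -/G -/H in rGH eGH.
case/is_rational_mapP: rGH => _ [k GHk0]; move/proj_eqP: eGH => eGH.
have E1 : 'X_k ^+ d * (p \mPo ratmap_comp G H) =
    tnth (ratmap_comp G H) k ^+ d * (p \mPo ratmap_id K).
  apply: (comp_scale ph) => j.
  by rewrite mulrC; have := eGH j k; rewrite !tnth_mktuple.
apply: contraNneq p0 => pG.
have E2 : p \mPo ratmap_comp G H = (p \mPo G) \mPo H.
  have := congr1 (fun T => tnth T ord0) (ratmap_compA [tuple p; p; p] G H).
  by rewrite !tnth_mktuple.
move: E1; rewrite E2 pG rmorph0 mulr0 comp_mpoly_id => /esym/eqP.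
by rewrite mulf_eq0 expf_eq0 (negPf GHk0) andbF.
Qed.

Lemma cr_forms_homog f : exists d, forall i, tnth (cr_forms f) i \is d.-homog.
Proof. by case/is_rational_mapP: (bir_fst (repr f)). Qed.

Lemma cr_forms_chart f u v : affine_map f u v -> has_chart (cr_forms f) u v.
Proof.
case=> Eu Ev; split=> //; first exact: cr_forms_homog.
have := @cr_forms_comp f 1%N 'X_ord_max; rewrite comp_mpolyXU -tnth_nth; apply.
  by rewrite dhomogX /= mdeg1.
by rewrite -msupp_eq0 msuppX.
Qed.

Lemma affine_map_chart f G u v : proj_eq (cr_forms f) G -> has_chart G u v ->
  affine_map f u v.
Proof.
rewrite proj_eq_sym => fG cG.
case/is_rational_mapP: (bir_fst (repr f)) => [[d h] n0].
by have [_ _ Eu Ev] := proj_eq_has_chart cG fG h n0.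
Qed.

Lemma exists_pullback f : exists s, pullback f s.
Proof.
have [_ G0 _ _] := cr_forms_chart (conj (erefl _) (erefl _) : affine_map f _ _).
have [d Gh] := cr_forms_homog f; have c0 := form_neq0 (Gh _) G0.
set u := ch (tnth (cr_forms f) ord0) / ch (tnth (cr_forms f) ord_max).
set v := ch (tnth (cr_forms f) (inord 1)) / ch (tnth (cr_forms f) ord_max).
have [|s [sK sX sY]] := @exists_morph K F E u v.
  move=> e p ph p0; have pf0 := cr_forms_comp f ph p0.
  have := form_neq0 (comp_homog ph Gh) pf0.
  by rewrite (eval_at_scale ph) // mulf_eq0 negb_or => /andP[].
by exists s; split=> //; rewrite sX sY.
Qed.

Lemma affine_map_fun f u v u' v' :
  affine_map f u v -> affine_map f u' v' -> u = u' /\ v = v'.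
Proof. by case=> <- <- [<- <-]. Qed.

Lemma affine_map_inj f g u v : affine_map f u v -> affine_map g u v -> f = g.
Proof.
move=> /cr_forms_chart cf /cr_forms_chart cg.
by rewrite -[f]reprK -[g]reprK; apply/cr_classP/(has_chart_proj_eq cf cg).
Qed.

Lemma pullback1 : affine_map 1%g X Y.
Proof. exact: affine_map_chart (cr_reprK (bir_one K)) has_chart_id. Qed.

Lemma affine_mapM f g (s t : {rmorphism E -> E}) :
  pullback f s -> pullback g t -> affine_map (f * g)%g (t (s X)) (t (s Y)).
Proof.
case=> [sK /cr_forms_chart cf] [tK /cr_forms_chart cg].
apply: affine_map_chart (cr_reprK (bir_comp (repr f) (repr g))) _.
exact: has_chart_comp cf cg.
Qed.

Lemma pullbackM f g (s t : {rmorphism E -> E}) :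
  pullback f s -> pullback g t -> pullback (f * g)%g (t \o s).
Proof.
move=> fs gt; split; last exact: affine_mapM.
by case: fs gt => sK _ [tK _] c; rewrite /= sK tK.
Qed.

(** The forms read off [s] and [t] are mutually inverse up to proportionality, which is what
    [is_birational_pair] asks. *)
Lemma exists_cremona (s t : {rmorphism E -> E}) : fixes_K s -> fixes_K t ->
  t (s X) = X -> t (s Y) = Y -> s (t X) = X -> s (t Y) = Y ->
  exists f, pullback f s.
Proof.
move=> sK tK tsX tsY stX stY.
have [G cG] := exists_forms (s X) (s Y); have [H cH] := exists_forms (t X) (t Y).
have cGH := has_chart_comp sK tK cG cH; have cHG := has_chart_comp tK sK cH cG.
rewrite tsX tsY in cGH; rewrite stX stY in cHG.
have bGH : is_birational_pair (G, H).
  apply/and5P; split=> /=; [exact: has_chart_rational cG | exact: has_chart_rational cH |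
    exact: has_chart_rational cGH | exact: has_chart_proj_eq cGH has_chart_id |].
  by rewrite (has_chart_rational cHG) (has_chart_proj_eq cHG has_chart_id).
pose p : birational_pair K := exist (fun p => is_birational_pair p) _ bGH.
by exists (cr_class p); split=> //; apply: affine_map_chart (cr_reprK p) cG.
Qed.

End Pullback.


(** * Endomorphisms of fields of rational functions *)

(** A rational root theorem: every term with i > 0 is divisible by p, and p is prime to q, so p
    divides [c 0]. If [c 0] vanishes, a factor p is removed and the degree e drops. *)
Lemma size_root_coprime_num (L : fieldType) (p q : {poly L}) e (c : nat -> {poly L}) m :
  coprimep p q -> \sum_(i < e.+1) c i * p ^+ i * q ^+ (e - i) = 0 ->
  (exists2 i, (i <= e)%N & c i != 0) -> (forall i, (i <= e)%N -> size (c i) <= m)%N ->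
  (size p <= m)%N.
Proof.
move=> pq; elim: e c => [|e IHe] c S0 [i ie ci] cm.
  move: S0; rewrite big_ord1 !expr0 !mulr1 => c0; move: ie ci.
  by rewrite leqn0 => /eqP->; rewrite c0 eqxx.
move: S0; rewrite big_ord_recl expr0 mulr1 subn0.
under eq_bigr => j _ do rewrite /= /bump /= add1n exprS subSS mulrCA -mulrA.
rewrite -mulr_sumr; have [c0|c0] := eqVneq (c 0%N) 0.
  have [-> _|p0] := eqVneq p 0; first by rewrite size_poly0.
  rewrite c0 mul0r add0r => /eqP; rewrite mulf_eq0 (negPf p0) => /eqP S0.
  case: i ie ci => [|i] ie ci; first by rewrite c0 eqxx in ci.
  apply: (IHe (fun j => c j.+1)) => [||j je]; [|by exists i|exact: cm].
  by rewrite -[RHS]S0.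
move/eqP; rewrite addr_eq0 -mulrN => /eqP E1.
have pc : p %| c 0%N.
  rewrite -(Gauss_dvdpl _ (coprimep_expr e.+1 pq)) E1; exact: dvdp_mulr.
exact: leq_trans (dvdp_leq c0 pc) (cm _ _).
Qed.

Lemma size_root_coprime (L : fieldType) (p q : {poly L}) e (c : nat -> {poly L}) m :
  coprimep p q -> \sum_(i < e.+1) c i * p ^+ i * q ^+ (e - i) = 0 ->
  (exists2 i, (i <= e)%N & c i != 0) -> (forall i, (i <= e)%N -> size (c i) <= m)%N ->
  (size p <= m)%N /\ (size q <= m)%N.
Proof.
move=> pq S0 [i ie ci] cm; split.
  by apply: size_root_coprime_num pq S0 _ cm; exists i.
rewrite coprimep_sym in pq.
apply: (@size_root_coprime_num L q p e (fun j => c (e - j)%N)) => //.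
- rewrite (reindex_inj rev_ord_inj) -[RHS]S0; apply: eq_bigr => j _ /=.
  by rewrite !subSS (subKn (ltnSE (ltn_ord j))) mulrAC.
- by exists (e - i)%N; rewrite ?leq_subr // subKn.
by move=> j je; apply: cm; rewrite leq_subr.
Qed.

Lemma horner_div (L M : fieldType) (j : {rmorphism L -> M}) (N : {poly L}) e (P Q : M) :
  Q != 0 -> (size N <= e.+1)%N ->
  Q ^+ e * (map_poly j N).[P / Q] = \sum_(i < e.+1) j N`_i * P ^+ i * Q ^+ (e - i).
Proof.
move=> Q0 Ne; rewrite (@horner_coef_wide _ e.+1) ?size_map_poly // mulr_sumr.
apply: eq_bigr => i _; rewrite coef_map expr_div_n.
have ie : (i <= e)%N by rewrite -ltnS.
rewrite -{1}(subnK ie) exprD.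
have Qi : Q ^+ i != 0 by rewrite expf_neq0.
by field.
Qed.

Lemma frac_morph (R : comNzRingType) (E E' : fieldType)
    (a : {rmorphism R -> E}) (b : {rmorphism R -> E'}) :
  injective a -> injective b -> (forall z, exists n d : R, d != 0 /\ z = a n / a d) ->
  exists s : {rmorphism E -> E'}, forall r, s (a r) = b r.
Proof.
move=> ainj binj quo.
have a0 r : (a r == 0) = (r == 0) by rewrite -(rmorph0 a) (inj_eq ainj).
have b0 r : (b r == 0) = (r == 0) by rewrite -(rmorph0 b) (inj_eq binj).
pose Q z w := exists n d : R, [/\ d != 0, z = a n / a d & w = b n / b d].
have Qfun z w w' : Q z w -> Q z w' -> w = w'.
  move=> [n [d [d0 -> ->]]] [n' [d' [d0' Ez ->]]]; apply/eqP; move/eqP: Ez.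
  by rewrite !eqr_div ?a0 ?b0 // -!rmorphM (inj_eq ainj) (inj_eq binj).
have Qtot z : exists w, Q z w.
  by have [n [d [d0 ->]]] := quo z; exists (b n / b d), n, d.
have [s sQ] : exists s : E -> E', forall z, Q z (s z).
  by exists (fun z => proj1_sig (constructive_indefinite_description _ (Qtot z)));
    move=> z; apply: proj2_sig.
have sE z w : Q z w -> s z = w by apply: Qfun.
have sa r : s (a r) = b r.
  by apply: sE; exists r, 1; rewrite !rmorph1 !divr1 oner_eq0.
have neq0M (d d' : R) : d != 0 -> d' != 0 -> d * d' != 0.
  by move=> d0 d0'; rewrite -a0 rmorphM /= mulf_neq0 ?a0.
have sD : nmod_morphism s.
  split=> [|z w]; first by rewrite -(rmorph0 a) sa rmorph0.
  have [n [d [d0 -> ->]]] := sQ z; have [n' [d' [d0' -> ->]]] := sQ w.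
  apply: sE; exists (n * d' + n' * d), (d * d').
  by rewrite !rmorphD !rmorphM /= !addf_div ?a0 ?b0 // neq0M.
have sM : monoid_morphism s.
  split=> [|z w]; first by rewrite -(rmorph1 a) sa rmorph1.
  have [n [d [d0 -> ->]]] := sQ z; have [n' [d' [d0' -> ->]]] := sQ w.
  apply: sE; exists (n * n'), (d * d').
  by rewrite !rmorphM /= !mulf_div neq0M.
pose sa' := GRing.isNmodMorphism.Build _ _ s sD.
pose sm := GRing.isMonoidMorphism.Build _ _ s sM.
pose S : {rmorphism E -> E'} := HB.pack s sa' sm.
by exists S.
Qed.

Section Ratfun.
Variables (L : fieldType) (F : ratfun L).
Local Notation ev := (@rf_eval L F).
Local Notation emb := (rf_emb F).
Local Notation gen := (rf_gen F).

Lemma rf_coprime (z : F) : exists p q, [/\ q != 0, coprimep p q & z = ev p / ev q].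
Proof.
have [n [d [d0 ->]]] := rf_numden z; rewrite -/(ev n) -/(ev d).
have g0 : gcdp n d != 0 by rewrite gcdp_eq0 (negPf d0) andbF.
exists (n %/ gcdp n d), (d %/ gcdp n d).
have En := divpK (dvdp_gcdl n d); have Ed := divpK (dvdp_gcdr n d).
split.
- by apply: contraNneq d0 => E0; rewrite -Ed E0 mul0r.
- by apply: coprimep_div_gcd; rewrite d0 orbT.
transitivity (ev (n %/ gcdp n d * gcdp n d) / ev (d %/ gcdp n d * gcdp n d)).
  by rewrite En Ed.
by rewrite !rmorphM /= -mulf_div divff ?mulr1 // rf_eval_neq0.
Qed.

(** The rational root theorem with constant coefficients makes numerator and denominator of z
    constant: L is algebraically closed in L(t). *)
Lemma rf_algebraic_const (N : {poly L}) (z : F) :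
  N != 0 -> (map_poly emb N).[z] = 0 -> exists c, z = emb c.
Proof.
move=> N0 Nz; have [p [q [q0 pq Ez]]] := rf_coprime z.
have Nsz : (size N <= (size N).-1.+1)%N by rewrite prednK // lt0n size_poly_eq0.
have := horner_div emb (ev p) (_ : ev q != 0) Nsz.
rewrite rf_eval_neq0 => /(_ q0); rewrite -Ez Nz mulr0 => /esym S0.
have S1 : \sum_(i < (size N).-1.+1) (N`_i)%:P * p ^+ i * q ^+ ((size N).-1 - i) = 0.
  apply: (@rf_eval_inj _ F); rewrite rmorph0 rmorph_sum /= -[RHS]S0.
  by apply: eq_bigr => i _; rewrite !rmorphM !rmorphXn /= rf_evalC.
have [||sp sq] := @size_root_coprime L p q _ (fun i => (N`_i)%:P) 1 pq S1.
- by exists (size N).-1 => //; rewrite polyC_eq0 -/(lead_coef N) lead_coef_eq0.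
- by move=> i _; apply: size_polyC_leq1.
rewrite Ez (size1_polyC sp) (size1_polyC sq) !rf_evalC.
by exists (p`_0 / q`_0); rewrite fmorph_div.
Qed.

Lemma rf_gen_neq_const c : gen <> emb c.
Proof.
move=> E; have : ev ('X - c%:P) = 0 by rewrite rmorphB /= rf_evalX rf_evalC E subrr.
by move=> /rf_eval_eq0/eqP; rewrite polyXsubC_eq0.
Qed.

Lemma rf_morph (F' : fieldType) (j : {rmorphism L -> F'}) (t : F') :
  (forall p : {poly L}, p != 0 -> (map_poly j p).[t] != 0) ->
  exists s : {rmorphism F -> F'}, (forall c, s (emb c) = j c) /\ s gen = t.
Proof.
move=> nz; have cjt : commr_rmorph j t by move=> c; apply: mulrC.
pose h : {rmorphism {poly L} -> F'} := horner_morph cjt.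
have hinj : injective h.
  move=> p q Epq; apply/eqP; rewrite -subr_eq0; apply/negPn/negP => /nz/eqP; apply.
  by have := congr1 (fun z => z - h q) Epq; rewrite subrr -rmorphB.
have [s sE] := frac_morph (@rf_eval_inj L F) hinj (@rf_numden L F).
exists s; split=> [c|].
  by rewrite -rf_evalC sE /h /= horner_morphC.
by rewrite -rf_evalX sE /h /= horner_morphX.
Qed.

Section Homography.
Variable M : 'M[L]_2.
Hypothesis uM : M \in unitmx.

Lemma det2 (R : comNzRingType) (A : 'M[R]_2) :
  \det A = A ord0 ord0 * A ord_max ord_max - A ord0 ord_max * A ord_max ord0.
Proof.
rewrite (expand_det_row _ ord0) !big_ord_recl big_ord0 addr0 /cofactor !det_mx11 !mxE /=.
rewrite !expr0 !expr1 !mul1r mulN1r mulrN.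
by congr (_ * A _ _ - A _ _ * A _ _); apply: val_inj.
Qed.

Lemma homography_den_neq0 : emb (M ord_max ord0) * gen + emb (M ord_max ord_max) != 0.
Proof.
have -> : emb (M ord_max ord0) * gen + emb (M ord_max ord_max) =
    ev ((M ord_max ord0)%:P * 'X + (M ord_max ord_max)%:P).
  by rewrite rmorphD rmorphM /= !rf_evalC rf_evalX.
rewrite rf_eval_neq0; apply/negP => /eqP E.
move: uM; rewrite unitmxE unitfE det2.
have := congr1 (fun p : {poly L} => p`_0) E; have := congr1 (fun p : {poly L} => p`_1) E.
rewrite !coefD !coefMX !coefC /= addr0 add0r => -> ->.
by rewrite !mulr0 subrr eqxx.
Qed.

End Homography.
End Ratfun.


(** * Two-by-two matrices and homographies *)

Lemma mx2_eq (R : Type) (A B : 'M[R]_2) :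
  A ord0 ord0 = B ord0 ord0 -> A ord0 ord_max = B ord0 ord_max ->
  A ord_max ord0 = B ord_max ord0 -> A ord_max ord_max = B ord_max ord_max -> A = B.
Proof.
move=> E00 E01 E10 E11; apply/matrixP => i j.
have I2 (k : 'I_2) : k = ord0 \/ k = ord_max.
  by case: k => [[|[|//]]] ltk; [left | right]; apply: val_inj.
by case: (I2 i) => ->; case: (I2 j) => ->.
Qed.

Definition mx2 (R : Type) (a b c d : R) : 'M[R]_2 :=
  \matrix_(i, j) if i == ord0 then if j == ord0 then a else b
                 else if j == ord0 then c else d.

Lemma mx2E (R : Type) (a b c d : R) :
  ((mx2 a b c d ord0 ord0 = a) * (mx2 a b c d ord0 ord_max = b) *
   (mx2 a b c d ord_max ord0 = c) * (mx2 a b c d ord_max ord_max = d))%type.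
Proof. by rewrite !mxE. Qed.

Lemma mx2P (R : Type) (A : 'M[R]_2) :
  A = mx2 (A ord0 ord0) (A ord0 ord_max) (A ord_max ord0) (A ord_max ord_max).
Proof. by apply: mx2_eq; rewrite !mx2E. Qed.

Lemma mulmx2E (R : pzSemiRingType) (A B : 'M[R]_2) i j :
  (A *m B) i j = A i ord0 * B ord0 j + A i ord_max * B ord_max j.
Proof.
rewrite mxE !big_ord_recl big_ord0 addr0; congr (_ + A _ _ * B _ _); exact: val_inj.
Qed.

Lemma mx2_mul (R : pzSemiRingType) (a b c d a' b' c' d' : R) :
  mx2 a b c d *m mx2 a' b' c' d' =
  mx2 (a * a' + b * c') (a * b' + b * d') (c * a' + d * c') (c * b' + d * d').
Proof. by apply: mx2_eq; rewrite mulmx2E !mx2E. Qed.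

Lemma det_mx2 (R : comNzRingType) (a b c d : R) : \det (mx2 a b c d) = a * d - b * c.
Proof. by rewrite det2 !mx2E. Qed.

Lemma map_mx2 (R S : Type) (f : R -> S) a b c d :
  map_mx f (mx2 a b c d) = mx2 (f a) (f b) (f c) (f d).
Proof. by apply: mx2_eq; rewrite mxE !mx2E. Qed.

Lemma scale_mx2 (R : pzSemiRingType) (k a b c d : R) :
  k *: mx2 a b c d = mx2 (k * a) (k * b) (k * c) (k * d).
Proof. by apply: mx2_eq; rewrite mxE !mx2E. Qed.

Lemma scalar_mx2 (R : pzSemiRingType) (k : R) : k%:M = mx2 k 0 0 k.
Proof. by apply: mx2_eq; rewrite !mxE. Qed.

Lemma mx2_inj (R : Type) (a b c d a' b' c' d' : R) :
  mx2 a b c d = mx2 a' b' c' d' -> [/\ a = a', b = b', c = c' & d = d'].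
Proof.
move=> E; have e i j : mx2 a b c d i j = mx2 a' b' c' d' i j by rewrite E.
by split; [have := e ord0 ord0 | have := e ord0 ord_max | have := e ord_max ord0 |
  have := e ord_max ord_max]; rewrite !mx2E.
Qed.

Section Homographies.
Variable E : fieldType.
Implicit Types (M N : 'M[E]_2) (z : E).

Lemma homography_mul M N z :
  N ord_max ord0 * z + N ord_max ord_max != 0 ->
  homography (M *m N) z = homography M (homography N z).
Proof.
move=> n0; rewrite /homography !mulmx2E; move: n0.
move: (N ord0 ord0) (N ord0 ord_max) (N ord_max ord0) (N ord_max ord_max) => a b c d n0.
have e x y : (x * a + y * c) * z + (x * b + y * d) =
  (x * ((a * z + b) / (c * z + d)) + y) * (c * z + d) by field.
by rewrite !e -mulf_div divff ?mulr1.
Qed.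

Lemma homography_scale c M z : c != 0 -> homography (c *: M) z = homography M z.
Proof.
by move=> c0; rewrite /homography !mxE -!mulrA -!mulrDr -mulf_div divff ?mul1r.
Qed.

Lemma homography1 z : homography 1%:M z = z.
Proof. by rewrite /homography !mxE /= mul1r mul0r addr0 add0r divr1. Qed.

End Homographies.

Lemma homography_morph (E E' : fieldType) (s : {rmorphism E -> E'}) (M : 'M[E]_2) z :
  s (homography M z) = homography (map_mx s M) (s z).
Proof. by rewrite /homography fmorph_div !rmorphD !rmorphM !mxE. Qed.

Lemma map_mx_eq (R S : Type) (f g : R -> S) m n (M : 'M[R]_(m, n)) :
  f =1 g -> map_mx f M = map_mx g M.
Proof. by move=> fg; apply/matrixP => i j; rewrite !mxE. Qed.

Section Homography.
Variables (L : fieldType) (F : ratfun L).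
Local Notation ev := (@rf_eval L F).
Local Notation emb := (rf_emb F).
Local Notation gen := (rf_gen F).
Local Notation hom M := (homography (map_mx emb M) gen).
Implicit Types M N : 'M[L]_2.

Lemma unit_map_mx M : M \in unitmx -> map_mx emb M \in unitmx.
Proof. by rewrite map_unitmx. Qed.

Lemma rf_linear_eq0 a b : emb a * gen + emb b = 0 -> a = 0 /\ b = 0.
Proof.
move=> E0; have : ev (a%:P * 'X + b%:P) = 0.
  by rewrite rmorphD rmorphM /= !rf_evalC rf_evalX.
move=> /rf_eval_eq0 Ep.
have := congr1 (fun p : {poly L} => p`_0) Ep; have := congr1 (fun p : {poly L} => p`_1) Ep.
by rewrite !coefD !coefMX !coefC /= addr0 add0r.
Qed.

Lemma homM M N : N \in unitmx -> hom (M *m N) = homography (map_mx emb M) (hom N).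
Proof.
by move=> uN; rewrite map_mxM homography_mul // !mxE homography_den_neq0.
Qed.

Lemma hom_neq_const M c : M \in unitmx -> hom M <> emb c.
Proof.
move=> uM /eqP; have := homography_den_neq0 F uM; rewrite /homography !mxE => d0.
rewrite eq_sym -subr_eq0 -(inj_eq (mulIf d0)) mul0r mulrBl divfK // => /eqP E0.
have [] := @rf_linear_eq0 (c * M ord_max ord0 - M ord0 ord0)
                          (c * M ord_max ord_max - M ord0 ord_max).
  by rewrite -[RHS]E0 !rmorphB !rmorphM; ring.
move=> /eqP; rewrite subr_eq0 => /eqP E1 /eqP; rewrite subr_eq0 => /eqP E2.
by move: uM; rewrite unitmxE unitfE det2 -E1 -E2 mulrAC subrr eqxx.
Qed.

(** A fixed point satisfies a quadratic equation over L, and the generator is transcendental, so all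
    coefficients of this equation vanish. *)
Lemma hom_fix_scalar M : M \in unitmx -> hom M = gen ->
  exists2 c, c != 0 & M = c%:M.
Proof.
move=> uM; have := homography_den_neq0 F uM; rewrite /homography !mxE => d0.
move/(canRL (divfK d0)) => E0.
have evE a b c : ev (a%:P * 'X^2 + b%:P * 'X + c%:P) = emb a * gen ^+ 2 + emb b * gen + emb c.
  by rewrite !rmorphD !rmorphM /= !rf_evalC !rf_evalX.
pose p := (- M ord_max ord0)%:P * 'X^2 + (M ord0 ord0 - M ord_max ord_max)%:P * 'X
          + (M ord0 ord_max)%:P.
have : ev p = 0.
  rewrite /p evE rmorphB rmorphN /=.
  by rewrite -[RHS](subrr (emb (M ord0 ord0) * gen + emb (M ord0 ord_max))) {2}E0; ring.
move=> /rf_eval_eq0 p0.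
have := congr1 (fun p : {poly L} => p`_0) p0; have := congr1 (fun p : {poly L} => p`_1) p0.
have := congr1 (fun p : {poly L} => p`_2) p0.
rewrite /p !coefD !coefMX !coefCM !coefXn !coefC /= mulr1 mulr0 !addr0 !add0r.
move=> /eqP; rewrite oppr_eq0 => /eqP E2 /eqP; rewrite subr_eq0 => /eqP E1 E3.
exists (M ord0 ord0).
  apply: contraTneq uM => E4; rewrite unitmxE unitfE det2 E3 -E1 E4.
  by rewrite !mul0r subrr eqxx.
by rewrite {1}[M]mx2P scalar_mx2 E2 E3 E1.
Qed.

Lemma hom_inj M N : M \in unitmx -> N \in unitmx -> hom M = hom N ->
  exists2 c, c != 0 & N = c *: M.
Proof.
move=> uM uN EMN; have uV : invmx M \in unitmx by rewrite unitmx_inv.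
have [||c c0 Ec] := @hom_fix_scalar (invmx M *m N).
- by rewrite unitmx_mul uV.
- by rewrite homM // -EMN -homM // mulVmx // map_mx1 homography1.
by exists c; rewrite // -[N](mulKVmx uM) Ec mul_mx_scalar.
Qed.

Lemma hom_transcendental M (F' : fieldType) (j : {rmorphism F -> F'}) (p : {poly L}) :
  M \in unitmx -> p != 0 -> (map_poly emb p).[hom M] != 0.
Proof.
move=> uM p0; apply/negP => /eqP /(rf_algebraic_const p0)[c].
exact: hom_neq_const.
Qed.

(* If [gen = s r] with [r = n / d] and [s gen = p / q], then [p] divides
   [n_0 - gen d_0] and [q] divides [n_e - gen d_e], so both have degree at most one. *)
Lemma rf_surjective_homography (s : {rmorphism F -> F}) (t : L -> L) (r : F) :
  (forall c, s (emb c) = emb (t c)) -> s r = gen ->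
  exists2 M, M \in unitmx & s gen = hom M.
Proof.
move=> st sr; have [n [d [d0 Er]]] := rf_numden r.
have [p [q [q0 pq Es]]] := rf_coprime (s gen).
have eq0 : ev q != 0 by rewrite rf_eval_neq0.
pose j : {rmorphism L -> F} := s \o emb.
have sE (a : {poly L}) : s (map_poly emb a).[gen] = (map_poly j a).[s gen].
  by rewrite -horner_map -map_poly_comp.
have jE c : j c = emb (t c) by rewrite /= st.
have t0 c : t c = 0 -> c = 0.
  move=> tc; have := jE c; rewrite tc rmorph0 => /eqP; rewrite fmorph_eq0.
  by move/eqP.
pose e := (maxn (size n) (size d)).-1.
have e1 : e.+1 = maxn (size n) (size d).
  by rewrite prednK // leq_max [X in _ || X]lt0n size_poly_eq0 d0 orbT.
have [ne de] : (size n <= e.+1)%N /\ (size d <= e.+1)%N.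
  by rewrite e1 leq_maxl leq_maxr.
have sd0 : (map_poly j d).[s gen] != 0.
  rewrite -sE fmorph_eq0; apply/negP => /eqP /rf_eval_eq0 /eqP.
  exact/negP.
have := sr; rewrite Er fmorph_div !sE => /(canRL (divfK sd0)) Enum.
have := horner_div j (ev p) eq0 ne; rewrite -Es Enum mulrCA Es (horner_div j (ev p) eq0 de).
(* The equation s(n) = gen s(d), cleared of the denominator of s gen = p/q and lifted to
   polynomials, where gen becomes 'X. *)
move=> S0; have S1 : \sum_(i < e.+1)
    ((t n`_i)%:P - 'X * (t d`_i)%:P) * p ^+ i * q ^+ (e - i) = 0.
  apply: (@rf_eval_inj _ F); rewrite rmorph0 rmorph_sum /=.
  rewrite -[RHS](subrr (\sum_(i < e.+1) j n`_i * ev p ^+ i * ev q ^+ (e - i))).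
  rewrite -{2}S0 mulr_sumr -sumrB; apply: eq_bigr => i _.
  rewrite !rmorphM rmorphB rmorphM !rmorphXn /= !rf_evalC rf_evalX -!jE.
  by rewrite !mulrBl !mulrA.
have [||sp sq] := @size_root_coprime L p q e
  (fun i => (t n`_i)%:P - 'X * (t d`_i)%:P) 2 pq S1.
- exists (size d).-1 => /=; first by rewrite -ltnS (leq_trans _ de) // prednK // lt0n size_poly_eq0.
  apply/negP => /eqP E0; have := congr1 (fun u : {poly L} => u`_1) E0.
  rewrite coefB coefC coefXM /= coefC /= coef0 sub0r => /eqP; rewrite oppr_eq0 => /eqP/t0/eqP.
  by rewrite -/(lead_coef d) lead_coef_eq0 (negPf d0).
- move=> i _; apply: leq_trans (size_polyD _ _) _; rewrite size_polyN geq_max.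
  rewrite (leq_trans (size_polyC_leq1 _)) // mulrC; apply: leq_trans (size_polyMleq _ _) _.
  by rewrite size_polyX addnS /= addn1 ltnS size_polyC_leq1.
have lin (u : {poly L}) : (size u <= 2)%N -> ev u = emb u`_1 * gen + emb u`_0.
  move=> su; have -> : u = (u`_1)%:P * 'X + (u`_0)%:P.
    apply/polyP => [[|[|i]]]; rewrite coefD coefMX !coefC /= ?add0r ?addr0 //.
    by rewrite nth_default // (leq_trans su).
  by rewrite rmorphD rmorphM /= !rf_evalC rf_evalX !coefD !coefMX !coefC /= add0r addr0.
exists (mx2 p`_1 p`_0 q`_1 q`_0); last first.
  by rewrite /homography !mxE /= -!lin.
(* A zero determinant makes s gen a constant; then s maps all of F to constants, whereas s r =
   gen. *)
rewrite unitmxE unitfE det_mx2 subr_eq0; apply/negP => /eqP E0.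
have [c Ec] : exists c, s gen = emb c.
  have [q1|q1] := eqVneq q`_1 0; last first.
    exists (p`_1 / q`_1); rewrite Es fmorph_div; apply/eqP.
    rewrite eqr_div ?fmorph_eq0 // !lin // !mulrDr !mulrDl -!rmorphM E0 /=; apply/eqP.
    by rewrite !rmorphM; ring.
  have q00 : q`_0 != 0.
    by apply: contraNneq eq0 => q00; rewrite lin // q1 q00 !rmorph0 mul0r addr0.
  exists (p`_0 / q`_0); rewrite Es fmorph_div; apply/eqP.
  rewrite eqr_div ?fmorph_eq0 // !lin // q1 rmorph0 mul0r add0r mulrDl.
  by rewrite mulrAC -rmorphM E0 q1 mulr0 rmorph0 mul0r add0r.
have : exists c', s r = emb c'.
  elim/ratfun_ind: r {Er sr} => [c'||z w [a Ea] [b Eb]|z w [a Ea] [b Eb]|z [a Ea]].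
  - by exists (t c').
  - by exists c.
  - by exists (a + b); rewrite !rmorphD Ea Eb.
  - by exists (a * b); rewrite !rmorphM Ea Eb.
  - by exists a^-1; rewrite !fmorphV Ea.
by case=> c'; rewrite sr; apply: rf_gen_neq_const.
Qed.

End Homography.


(** * The Jonquieres group *)

Section Substitution.
Variables (K : fieldType) (F : ratfun K).
Local Notation emb := (rf_emb F).
Local Notation gen := (rf_gen F).
Implicit Types M N : 'M[K]_2.

Lemma rf_morph_ext (L : fieldType) (G : ratfun L) (G' : fieldType) (s t : {rmorphism G -> G'}) :
  (forall c, s (rf_emb G c) = t (rf_emb G c)) -> s (rf_gen G) = t (rf_gen G) -> s =1 t.
Proof.
move=> EC EX; apply: ratfun_ind => // [z w Ez Ew|z w Ez Ew|z Ez].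
- by rewrite !rmorphD Ez Ew.
- by rewrite !rmorphM Ez Ew.
- by rewrite !fmorphV Ez.
Qed.

Lemma exists_subst M : exists s : {rmorphism F -> F}, M \in unitmx ->
  (forall c, s (emb c) = emb c) /\ s gen = homography (map_mx emb M) gen.
Proof.
have [uM|nuM] := boolP (M \in unitmx); last first.
  by exists (idfun : {rmorphism F -> F}).
have [p|s sP] := @rf_morph _ F F emb (homography (map_mx emb M) gen).
  exact: (hom_transcendental (idfun : {rmorphism F -> F})).
by exists s.
Qed.

(** The substitution x |-> M x as a total function of the matrix, unspecified unless M is
    invertible. *)
Definition subst M : {rmorphism F -> F} :=
  proj1_sig (constructive_indefinite_description _ (exists_subst M)).

Lemma subst_const M c : M \in unitmx -> subst M (emb c) = emb c.
Proof. by rewrite /subst; case: constructive_indefinite_description => s /= sP /sP[]. Qed.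

Lemma subst_gen M : M \in unitmx -> subst M gen = homography (map_mx emb M) gen.
Proof. by rewrite /subst; case: constructive_indefinite_description => s /= sP /sP[]. Qed.

Lemma subst_homography M N : N \in unitmx ->
  subst N (homography (map_mx emb M) gen) = homography (map_mx emb M) (homography (map_mx emb N) gen).
Proof.
move=> uN; rewrite homography_morph subst_gen // -map_mx_comp.
by rewrite (map_mx_eq _ (g := emb)) // => c; apply: subst_const.
Qed.

Lemma substM M N : M \in unitmx -> N \in unitmx ->
  forall z, subst N (subst M z) = subst (M *m N) z.
Proof.
move=> uM uN; have uMN : M *m N \in unitmx by rewrite unitmx_mul uM.
apply: (@rf_morph_ext _ F F (subst N \o subst M) (subst (M *m N))) => [c|] /=.
  by rewrite !subst_const.
by rewrite !subst_gen // subst_homography // homM.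
Qed.

Lemma subst1 z : subst 1%:M z = z.
Proof.
apply: (@rf_morph_ext _ F F (subst 1%:M) idfun) z => [c|] /=.
  by rewrite subst_const ?unitmx1.
by rewrite subst_gen ?unitmx1 // map_mx1 homography1.
Qed.

Lemma subst_scale M c z : M \in unitmx -> c != 0 -> subst (c *: M) z = subst M z.
Proof.
move=> uM c0; have ucM : c *: M \in unitmx by rewrite unitmxZ // unitfE.
apply: (@rf_morph_ext _ F F (subst (c *: M)) (subst M)) z => [a|].
  by rewrite !subst_const.
by rewrite !subst_gen // map_mxZ homography_scale // fmorph_eq0.
Qed.

Local Notation "A ^^ N" := (map_mx (subst N) A) (at level 30).

Lemma subst_mx_mul (A : 'M[F]_2) M N : M \in unitmx -> N \in unitmx ->
  (A ^^ M) ^^ N = A ^^ (M *m N).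
Proof. by move=> uM uN; rewrite -map_mx_comp; apply/map_mx_eq/substM. Qed.

Lemma subst_mx1 (A : 'M[F]_2) : A ^^ 1%:M = A.
Proof. by apply/matrixP => i j; rewrite mxE subst1. Qed.

End Substitution.

Notation "A ^^ N" := (map_mx (subst _ N) A) (at level 30).

Section Jonquieres.
Variables (K : fieldType) (F : ratfun K) (E : ratfun F).
Local Notation X := (rf_emb E (rf_gen F)).
Local Notation Y := (rf_gen E).
Implicit Types (M N : 'M[K]_2) (A B : 'M[F]_2) (f g : Cremona K).

(* [f] is (x, y) |-> (M x, A(x) y). *)
Definition is_jonq f M A := [/\ M \in unitmx, A \in unitmx &
  affine_map f (homography (map_mx (@const _ _ E) M) X) (homography (map_mx (rf_emb E) A) Y)].

Definition jonq_morph (s : {rmorphism E -> E}) M A :=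
  (forall a, s (rf_emb E a) = rf_emb E (subst F M a)) /\
  s Y = homography (map_mx (rf_emb E) A) Y.

Lemma homography_const M :
  homography (map_mx (@const _ _ E) M) X = rf_emb E (homography (map_mx (rf_emb F) M) (rf_gen F)).
Proof. by rewrite homography_morph -map_mx_comp. Qed.

Lemma exists_jonq_morph M A : M \in unitmx -> A \in unitmx -> exists s, jonq_morph s M A.
Proof.
move=> uM uA; have [p p0|s [s1 s2]] := @rf_morph _ E E (rf_emb E \o subst F M)
  (homography (map_mx (rf_emb E) A) Y); last by exists s.
rewrite map_poly_comp; apply: (hom_transcendental (idfun : {rmorphism E -> E}) uA).
by rewrite map_poly_eq0.
Qed.

Lemma jonq_morph_fixes s M A : M \in unitmx -> jonq_morph s M A -> fixes_K s.
Proof. by move=> uM [sF _] c; rewrite /const sF subst_const. Qed.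

Lemma jonq_morphX s M A : M \in unitmx -> jonq_morph s M A ->
  s X = homography (map_mx (@const _ _ E) M) X.
Proof. by move=> uM [sF _]; rewrite sF subst_gen // homography_const. Qed.

Lemma jonq_morph_comp s t M A N B : M \in unitmx -> N \in unitmx -> B \in unitmx ->
  jonq_morph s M A -> jonq_morph t N B -> jonq_morph (t \o s) (M *m N) ((A ^^ N) *m B).
Proof.
move=> uM uN uB [sF sY] [tF tY]; split=> [a|] /=; first by rewrite sF tF substM.
rewrite sY homography_morph -map_mx_comp tY homM //; congr (homography _ _).
by rewrite -map_mx_comp; apply: map_mx_eq => a /=; rewrite tF.
Qed.

Lemma jonq_morph1 s : jonq_morph s 1%:M 1%:M -> s X = X /\ s Y = Y.
Proof. by case=> sF sY; rewrite sF subst1 sY map_mx1 homography1. Qed.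

Lemma jonq_pullback f s M A : is_jonq f M A -> jonq_morph s M A -> pullback f s.
Proof.
case=> uM uA fMA sMA; split; first exact: jonq_morph_fixes sMA.
by rewrite (jonq_morphX uM sMA) (proj2 sMA).
Qed.

Lemma pullback_jonq f s M A : M \in unitmx -> A \in unitmx ->
  pullback f s -> jonq_morph s M A -> is_jonq f M A.
Proof.
move=> uM uA [_ fs] sMA; split=> //.
by rewrite -(jonq_morphX uM sMA) -(proj2 sMA).
Qed.

Lemma subst_unitmx M A : (A ^^ M \in unitmx) = (A \in unitmx).
Proof. by rewrite map_unitmx. Qed.

Lemma is_jonqM f g M A N B : is_jonq f M A -> is_jonq g N B ->
  is_jonq (f * g)%g (M *m N) ((A ^^ N) *m B).
Proof.
move=> jf jg; have [uM uA _] := jf; have [uN uB _] := jg.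
have [s sMA] := exists_jonq_morph uM uA; have [t tNB] := exists_jonq_morph uN uB.
have := pullbackM (jonq_pullback jf sMA) (jonq_pullback jg tNB).
move/pullback_jonq; apply; last exact: jonq_morph_comp.
  by rewrite unitmx_mul uM.
by rewrite unitmx_mul uB subst_unitmx uA.
Qed.

Lemma is_jonq1 : is_jonq 1%g 1%:M 1%:M.
Proof.
split; rewrite ?unitmx1 // !map_mx1 !homography1; exact: pullback1.
Qed.

Lemma is_jonq_inj f g M A : is_jonq f M A -> is_jonq g M A -> f = g.
Proof. by case=> _ _ fu [_ _]; apply: affine_map_inj fu. Qed.

Lemma is_jonq_scale f M A c a : c != 0 -> a != 0 -> is_jonq f M A -> is_jonq f (c *: M) (a *: A).
Proof.
move=> c0 a0 [uM uA fMA]; split; rewrite ?unitmxZ ?unitfE //.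
by rewrite !map_mxZ !homography_scale ?fmorph_eq0.
Qed.

Lemma is_jonq_uniq f M A M' A' : is_jonq f M A -> is_jonq f M' A' ->
  (exists2 c, c != 0 & M' = c *: M) /\ (exists2 a, a != 0 & A' = a *: A).
Proof.
move=> [uM uA fMA] [uM' uA' fMA']; have [EX EY] := affine_map_fun fMA fMA'.
split; last exact: hom_inj EY.
by move: EX; rewrite !homography_const => /fmorph_inj; apply: hom_inj.
Qed.

(** With N = M^-1, the maps (M x, A(x) y) and (N x, A(N x)^-1 y) are inverse to each other, so their
    comorphisms satisfy [exists_cremona]. *)
Lemma exists_jonq M A : M \in unitmx -> A \in unitmx -> exists f, is_jonq f M A.
Proof.
move=> uM uA; pose N := invmx M; have uN : N \in unitmx by rewrite unitmx_inv.
pose B := invmx (A ^^ N); have uB : B \in unitmx by rewrite unitmx_inv subst_unitmx.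
have [s sMA] := exists_jonq_morph uM uA; have [t tNB] := exists_jonq_morph uN uB.
have st := jonq_morph_comp uM uN uB sMA tNB; have ts := jonq_morph_comp uN uM uA tNB sMA.
move: st ts; rewrite mulmxV // mulmxV ?subst_unitmx // /B map_invmx.
rewrite subst_mx_mul // mulVmx // subst_mx1 mulVmx //.
move=> /jonq_morph1[stX stY] /jonq_morph1[tsX tsY].
have [f fs] := exists_cremona (jonq_morph_fixes uM sMA) (jonq_morph_fixes uN tNB) stX stY tsX tsY.
by exists f; apply: pullback_jonq fs sMA.
Qed.

Lemma is_jonqV f M A : is_jonq f M A ->
  is_jonq f^-1%g (invmx M) (invmx (A ^^ (invmx M))).
Proof.
move=> jf; have [uM uA _] := jf; have uN : invmx M \in unitmx by rewrite unitmx_inv.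
have [|g jg] := @exists_jonq (invmx M) (invmx (A ^^ (invmx M))) uN.
  by rewrite unitmx_inv subst_unitmx.
rewrite (_ : f^-1%g = g) //; apply: mulg1_eq; apply: (@is_jonq_inj _ _ 1%:M 1%:M).
  have := is_jonqM jf jg; rewrite !mulmxV //; last by rewrite subst_unitmx.
exact: is_jonq1.
Qed.

End Jonquieres.


(** * Degree and height *)

Section Divisibility.
Variable R : idomainType.
Implicit Types p q u v w g : R.

Definition divides p q := exists r, q = r * p.

Definition prime_element p := p != 0 /\ forall u v, divides p (u * v) -> divides p u \/ divides p v.

(** Each prime of the product divides w, or else divides both n and d; in the first case it is
    cancelled, in the second it goes into g. This replaces unique factorization, since only linear
    factors occur in the application. *)
Lemma cancel_prime_factors (s : seq R) u v n d w :
  (forall p, p \in s -> prime_element p) -> u * \prod_(p <- s) p = n * w ->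
  v * \prod_(p <- s) p = d * w ->
  exists g n' d' w', [/\ n = g * n', d = g * d', u = n' * w' & v = d' * w'].
Proof.
elim: s n d w => [|p s IHs] n d w sP.
  by rewrite big_nil !mulr1 => -> ->; exists 1, n, d, w; rewrite !mul1r.
rewrite !big_cons => Eu Ev.
have [p0 pP] : prime_element p by apply: sP; rewrite inE eqxx.
have {}sP q : q \in s -> prime_element q by move=> qs; apply: sP; rewrite inE qs orbT.
have [[w1 Ew]|npw] := classic (divides p w).
  by apply: (IHs n d w1 sP); apply: (mulfI p0); rewrite mulrCA ?Eu ?Ev Ew; ring.
have dv x y : x * (p * y) = n * w \/ x * (p * y) = d * w ->
    forall z, x * (p * y) = z * w -> exists z', z = p * z'.
  move=> _ z Ez; case: (pP z w) => [|[z' ->]|//]; first by rewrite -Ez; exists (x * y); ring.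
  by exists z'; rewrite mulrC.
have [n1 En] := dv _ _ (or_introl Eu) _ Eu; have [d1 Ed] := dv _ _ (or_intror Ev) _ Ev.
have [||g [n' [d' [w' [E1 E2 E3 E4]]]]] := IHs n1 d1 w sP.
- by apply: (mulfI p0); rewrite mulrCA Eu En mulrA.
- by apply: (mulfI p0); rewrite mulrCA Ev Ed mulrA.
by exists (p * g), n', d', w'; rewrite En Ed E1 E2 !mulrA.
Qed.

End Divisibility.

Section LinearForms.
Variable K : fieldType.
Implicit Types p q u v : {mpoly K[3]}.

Lemma comp_mpolyM (T : 3.-tuple {mpoly K[3]}) p q : (p * q) \mPo T = (p \mPo T) * (q \mPo T).
Proof. exact: (rmorphM (comp_mpoly T)). Qed.

(** The substitution [T] is an endomorphism whose kernel is generated by p: it kills p and is the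
    identity modulo p. The polynomial ring being a domain, this kernel is prime. *)
Lemma retract_prime p (T : 3.-tuple {mpoly K[3]}) : p != 0 -> p \mPo T = 0 ->
  (forall i, divides p ('X_i - tnth T i)) -> prime_element p.
Proof.
move=> p0 pT TX.
have pM q u : divides p q -> divides p (u * q).
  by move=> [r ->]; exists (u * r); rewrite mulrA.
have pD q u : divides p q -> divides p u -> divides p (q + u).
  by move=> [r ->] [r' ->]; exists (r + r'); rewrite mulrDl.
have pS q : divides p (q - (q \mPo T)).
  have cM u v : divides p (u - (u \mPo T)) -> divides p (v - (v \mPo T)) ->
      divides p (u * v - ((u * v) \mPo T)).
    move=> du dv; rewrite comp_mpolyM.
    have -> : u * v - (u \mPo T) * (v \mPo T) =
      v * (u - (u \mPo T)) + (u \mPo T) * (v - (v \mPo T)) by ring.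
    by apply: pD; apply: pM.
  have cC c : divides p (c%:MP - (c%:MP \mPo T)).
    by rewrite comp_mpolyC subrr; exists 0; rewrite mul0r.
  elim/mpolyind: q => [|c m q _ _ IHq]; first by rewrite rmorph0 subrr; exists 0; rewrite mul0r.
  rewrite rmorphD /= opprD addrACA; apply: (pD) IHq.
  rewrite -mul_mpolyC; apply: (cM); first exact: (cC).
  rewrite mpolyXE_id.
  elim/big_rec: _ => [|i x _ IHx]; first exact: (cC 1).
  apply: (cM _ _ _ IHx); elim: (m i) => [|k IHk]; first exact: (cC 1).
  by rewrite exprS; apply: (cM) => [|//]; rewrite comp_mpolyXU -tnth_nth.
split=> // u v [r /(congr1 (comp_mpoly T))].
rewrite !comp_mpolyM pT mulr0 => /eqP; rewrite mulf_eq0.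
have dT q : q \mPo T = 0 -> divides p q by move=> qT; have := pS q; rewrite qT subr0.
by case/orP => /eqP /dT; [left | right].
Qed.

Definition lin_form (a b : K) : {mpoly K[3]} := a%:MP * 'X_ord0 + b%:MP * 'X_ord_max.

Lemma lin_form_neq0 a b : (a != 0) || (b != 0) -> lin_form a b != 0.
Proof.
move=> ab; apply/eqP => /(congr1 (fun p => (p.@[tnth [tuple 1; 0; 0]], p.@[tnth [tuple 0; 0; 1]]))).
rewrite /lin_form !(mevalD, mevalM, mevalC, mevalXU, meval0).
have [-> _ ->] := tnth3 (1 : K) 0 0; have [-> _ ->] := tnth3 (0 : K) 0 1.
rewrite !(mulr1, mulr0, addr0, add0r) => -[a0 b0].
by move: ab; rewrite a0 b0 eqxx.
Qed.

Lemma lin_form_prime a b : (a != 0) || (b != 0) -> prime_element (lin_form a b).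
Proof.
move=> ab; have l0 := lin_form_neq0 ab; have [a0|a0] := eqVneq a 0.
  have b0 : b != 0 by move: ab; rewrite a0 eqxx.
  apply: (@retract_prime _ [tuple 'X_ord0; 'X_(inord 1); 0]) => // [|i];
    have [e0 e1 e2] := tnth3 ('X_ord0 : {mpoly K[3]}) 'X_(inord 1) 0.
    by rewrite rmorphD /= !comp_mpolyM !comp_mpolyC !comp_mpolyXU -!tnth_nth e0 e2 a0
      mulr0 mpolyC0 mul0r addr0.
  case: (ord3P i) => ->; rewrite ?e0 ?e1 ?e2 ?subrr; try by exists 0; rewrite mul0r.
  exists b^-1%:MP; rewrite /lin_form a0 mpolyC0 mul0r add0r mulrA -rmorphM mulVf //=.
  by rewrite subr0 mpolyC1 mul1r.
apply: (@retract_prime _ [tuple - (b / a)%:MP * 'X_ord_max; 'X_(inord 1); 'X_ord_max]) => // [|i];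
  have [e0 e1 e2] := tnth3 (- (b / a)%:MP * 'X_ord_max : {mpoly K[3]}) 'X_(inord 1) 'X_ord_max.
  rewrite rmorphD /= !comp_mpolyM !comp_mpolyC !comp_mpolyXU -!tnth_nth e0 e2.
  by rewrite mulrA mulrN -mpolyCM [a * _]mulrC divfK // mulNr addNr.
case: (ord3P i) => ->; rewrite ?e0 ?e1 ?e2 ?subrr; try by exists 0; rewrite mul0r.
exists a^-1%:MP; rewrite /lin_form mulrDr !mulrA -!mpolyCM mulVf // mpolyC1.
by rewrite mul1r mulNr opprK [a^-1 * b]mulrC.
Qed.

End LinearForms.

(** * The degree of a Jonquières map against the height of its matrix *)

Section DegreeBound.
Variables (K : closedFieldType) (F : ratfun K) (E : ratfun F).
Local Notation X := (rf_emb E (rf_gen F)).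
Local Notation Y := (rf_gen E).
Local Notation ch := (@eval_at K F E X Y).

Definition hom_poly k (p : {poly K}) : {mpoly K[3]} :=
  \sum_(i < k.+1) p`_i *: ('X_ord0 ^+ i * 'X_ord_max ^+ (k - i)).

Lemma homog_coordX (i : 'I_3) k : 'X_i ^+ k \is [in K[3], k.-homog].
Proof. by rewrite -[X in X.-homog]mul1n; apply: dhomogMn; rewrite dhomogX /= mdeg1. Qed.

Lemma hom_poly_homog k p : hom_poly k p \is k.-homog.
Proof.
apply: rpred_sum => i _; apply: rpredZ.
have := dhomogM (homog_coordX ord0 i) (homog_coordX ord_max (k - i)).
by rewrite (subnKC (ltnSE (ltn_ord i))).
Qed.

Lemma chX : [/\ ch 'X_ord0 = X, ch 'X_(inord 1) = Y & ch 'X_ord_max = 1].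
Proof. by rewrite !eval_at_coord; apply: tnth3. Qed.

Lemma ch_hom_poly k (p : {poly K}) : (size p <= k.+1)%N -> ch (hom_poly k p) = rf_emb E (rf_eval F p).
Proof.
move=> sp; rewrite /rf_eval (@horner_coef_wide _ k.+1) ?size_map_poly //.
rewrite /hom_poly !rmorph_sum /=; apply: eq_bigr => i _.
have [c0 _ c2] := chX.
by rewrite -mul_mpolyC !rmorphM !rmorphXn /= eval_atC c0 c2 expr1n mulr1 coef_map.
Qed.

Lemma hom_poly_split k (p : {poly K}) : p != 0 -> (size p <= k.+1)%N ->
  exists2 s : seq {mpoly K[3]}, (forall q, q \in s -> prime_element q) &
    exists2 c : K, c != 0 & hom_poly k p = c%:MP * \prod_(q <- s) q.
Proof.
move=> p0 sp; have [r Er] := closed_field_poly_normal p.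
have c0 : lead_coef p != 0 by rewrite lead_coef_eq0.
have sr : (size p = (size r).+1)%N.
  by rewrite Er size_scale // size_prod_XsubC.
(* The excess of k over deg p is the multiplicity of the root at infinity, hence the extra factors
   equal to the last coordinate. *)
pose s := [seq lin_form 1 (- a) | a <- r] ++ nseq (k - size r) (lin_form 0 1).
exists s => [q|].
  rewrite mem_cat => /orP[/mapP[a _ ->]|/nseqP[-> _]]; apply: lin_form_prime;
    by rewrite oner_eq0 ?orbT.
exists (lead_coef p) => //; apply/eqP; rewrite -subr_eq0; apply/eqP.
have [X0 _ X2] := chX.
have lh (a b : K) : lin_form a b \is 1.-homog.
  by apply: rpredD; rewrite mul_mpolyC; apply: rpredZ; rewrite dhomogX /= mdeg1.
have ph (t : seq {mpoly K[3]}) : all (fun q => q \is 1.-homog) t ->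
    \prod_(q <- t) q \is (size t).-homog.
  elim: t => [|q t IHt] /=; first by rewrite big_nil dhomog1.
  by rewrite big_cons => /andP[qh th]; exact: (dhomogM qh (IHt th)).
have sz : size s = k.
  by rewrite size_cat size_map size_nseq subnKC // -ltnS -sr.
apply: (@form_eq0 _ F E k).
  apply: rpredB; first exact: hom_poly_homog.
  rewrite mul_mpolyC; apply: rpredZ; rewrite -sz; apply: ph.
  apply/allP => q; rewrite mem_cat => /orP[/mapP[a _ ->]|/nseqP[-> _]]; exact: lh.
rewrite rmorphB rmorphM /= ch_hom_poly // eval_atC; apply/eqP; rewrite subr_eq0; apply/eqP.
have lc a b : ch (lin_form a b) = const E a * X + const E b.
  by rewrite /lin_form rmorphD !rmorphM /= !eval_atC X0 X2 mulr1.
rewrite big_cat /= rmorphM /= [X in _ = _ * (_ * X)]rmorph_prod /=.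
rewrite [X in _ = _ * (_ * X)]big1_seq ?mulr1; last first.
  by move=> q /andP[_ /nseqP[-> _]]; rewrite lc rmorph0 rmorph1 mul0r add0r.
rewrite {1}Er -mul_polyC !rmorphM /= rf_evalC; congr (_ * _).
rewrite big_map !rmorph_prod /=; apply: eq_bigr => a _.
by rewrite lc rmorph1 mul1r rmorphN !rmorphB /= rf_evalX rf_evalC.
Qed.

Definition poly_mx (B : 'M[{poly K}]_2) : 'M[F]_2 := map_mx (rf_eval F) B.

(** The matrix counts only up to a scalar of F, whence [s]. The bound is on sizes, so degrees are at
    most m - 1. *)
Definition height_le m (A : 'M[F]_2) := exists (B : 'M[{poly K}]_2) (s : F),
  [/\ s != 0, A = s *: poly_mx B & forall i j, (size (B i j) <= m)%N].

Lemma homog_dvd_degree d e (p q r : {mpoly K[3]}) :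
  p \is d.-homog -> r \is e.-homog -> r != 0 -> p * q = r -> (d <= e)%N.
Proof.
move=> ph rh r0 E1; have p0 : p != 0 by apply: contraNneq r0 => p0; rewrite -E1 p0 mul0r.
have q0 : q != 0 by apply: contraNneq r0 => q0; rewrite -E1 q0 mulr0.
have sz (u : {mpoly K[3]}) k : u != 0 -> u \is k.-homog -> msize u = k.+1.
  move=> u0 uh; rewrite (dhomog_uniq u0 uh (dhomog_msize uh)) prednK //.
  by rewrite lt0n msize_poly_eq0.
have := msizeM p0 q0; rewrite E1 (sz _ _ r0 rh) (sz _ _ p0 ph).
have : (0 < msize q)%N by rewrite lt0n msize_poly_eq0.
by case: (msize q) => // k _; rewrite addSn addnS /= => -[->]; rewrite leq_addr.
Qed.

(** The map is given by (q l1 : n l2 : q l2), where n, q have degree m + 1 and l1, l2 are the linear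
    forms of M; this explains m + 2. The reduced forms G have at most this degree: since det B
    splits into linear factors, the pairs (G_1, G_2) and (n, q) differ by factors that can be
    cancelled one by one, and a common factor of all G_i is constant. *)
Lemma degree_le_height (f : Cremona K) M A m d :
  is_jonq E f M A -> height_le m A -> has_degree f d -> (d <= m + 2)%N.
Proof.
move=> [uM uA fMA] [B [s [s0 EA Bm]]] [G [rG fG ncf Gd]].
have uB : poly_mx B \in unitmx.
  by move: uA; rewrite EA unitmxZ // unitfE.
have {fMA} cG : has_chart G (homography (map_mx (@const _ _ E) M) X)
                              (homography (map_mx (rf_emb E) (poly_mx B)) Y).
  apply: proj_eq_has_chart (cr_forms_chart _) fG Gd _; last by case/is_rational_mapP: rG.
  by move: fMA; rewrite EA map_mxZ homography_scale // fmorph_eq0.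
have EG := has_chart_coord cG; have [_ G2 _ _] := cG.
pose al := hom_poly m (B ord0 ord0); pose be := hom_poly m (B ord0 ord_max).
pose ga := hom_poly m (B ord_max ord0); pose et := hom_poly m (B ord_max ord_max).
pose n := al * 'X_(inord 1) + be * 'X_ord_max.
pose q := ga * 'X_(inord 1) + et * 'X_ord_max.
pose l1 := lin_form (M ord0 ord0) (M ord0 ord_max).
pose l2 := lin_form (M ord_max ord0) (M ord_max ord_max).
have [X0 X1 X2] := chX.
have Bm' i j : (size (B i j) <= m.+1)%N by apply: leq_trans (Bm i j) _.
have chB i j : ch (hom_poly m (B i j)) = rf_emb E (rf_eval F (B i j)) by rewrite ch_hom_poly.
have lh (a b : K) : lin_form a b \is 1.-homog.
  by apply: rpredD; rewrite mul_mpolyC; apply: rpredZ; rewrite dhomogX /= mdeg1.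
have lc a b : ch (lin_form a b) = const E a * X + const E b.
  by rewrite /lin_form rmorphD !rmorphM /= !eval_atC X0 X2 mulr1.
have nq p p' : hom_poly m p * 'X_(inord 1) + hom_poly m p' * 'X_ord_max \is m.+1.-homog.
  have xh i : 'X_i \is [in K[3], 1.-homog] by rewrite dhomogX /= mdeg1.
  by rewrite -[m.+1]addn1; apply: rpredD; apply: dhomogM => //; apply: hom_poly_homog.
have nh : n \is m.+1.-homog.
  exact: nq.
have qh : q \is m.+1.-homog.
  exact: nq.
have chn : ch n = rf_emb E (poly_mx B ord0 ord0) * Y + rf_emb E (poly_mx B ord0 ord_max).
  by rewrite rmorphD !rmorphM /= X1 X2 !chB mulr1 !mxE.
have chq : ch q = rf_emb E (poly_mx B ord_max ord0) * Y + rf_emb E (poly_mx B ord_max ord_max).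
  by rewrite rmorphD !rmorphM /= X1 X2 !chB mulr1 !mxE.
have q0 : ch q != 0 by rewrite chq homography_den_neq0.
have chq' : ch q = rf_emb E (rf_eval F (B ord_max ord0)) * Y +
  rf_emb E (rf_eval F (B ord_max ord_max)) by rewrite chq !mxE.
have l20 : ch l2 != 0.
  rewrite lc /const -!rmorphM -rmorphD /= fmorph_eq0.
  exact: homography_den_neq0.
have nzf p : ch p != 0 -> p != 0 by apply: contraNneq => ->; rewrite rmorph0.
have [e0 e1 e2] := tnth3 (homography (map_mx (@const _ _ E) M) X)
  (homography (map_mx (rf_emb E) (poly_mx B)) Y) 1.
have Enq : tnth G (inord 1) * q = tnth G ord_max * n.
  apply/eqP; rewrite -subr_eq0; apply/eqP/(@form_eq0 _ F E (d + m.+1)%N).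
    by apply: rpredB; apply: dhomogM.
  rewrite rmorphB !rmorphM /= EG e1 chn /homography !mxE -chq'.
  by field.
have El : tnth G ord0 * l2 = tnth G ord_max * l1.
  apply/eqP; rewrite -subr_eq0; apply/eqP/(@form_eq0 _ F E (d + 1)%N).
    have h1 := dhomogM (Gd ord0) (lh (M ord_max ord0) (M ord_max ord_max)).
    have h2 := dhomogM (Gd ord_max) (lh (M ord0 ord0) (M ord0 ord_max)).
    exact: (rpredB h1 h2).
  rewrite rmorphB !rmorphM /= EG e0 !lc /homography !mxE; rewrite lc in l20.
  by field.
have dB0 : \det B != 0.
  apply: contraTneq uB => dB0; rewrite unitmxE unitfE det2 !mxE -!rmorphM -rmorphB /=.
  by rewrite -det2 dB0 rmorph0 eqxx.
have sdB : (size (\det B) <= (m + m).+1)%N.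
  have sM i j k l : (size (B i j * B k l)%R <= (m + m).+1)%N.
    apply: leq_trans (size_polyMleq _ _) _; apply: leq_trans (leq_pred _) _.
    by rewrite ltnW // ltnS leq_add.
  by rewrite det2; apply: leq_trans (size_polyD _ _) _; rewrite size_polyN geq_max !sM.
have [s1 s1P [c c0 Es]] := hom_poly_split dB0 sdB.
have Ed : al * et - be * ga = c%:MP * \prod_(p <- s1) p.
  rewrite -Es; apply/eqP; rewrite -subr_eq0; apply/eqP/(@form_eq0 _ F E (m + m)%N).
    apply: rpredB; last exact: hom_poly_homog.
    by apply: rpredB; apply: dhomogM; apply: hom_poly_homog.
  rewrite !rmorphB !rmorphM /= !chB ch_hom_poly // det2.
  by rewrite !(rmorphB, rmorphM) /= subrr.
(* The form [al * q - ga * n] is det B times the last coordinate; by [Enq], its products with G_1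
   and G_2 are n W and q W. *)
pose W := al * tnth G ord_max - ga * tnth G (inord 1).
have key r : r * (al * q - ga * n) = r * c%:MP * \prod_(p <- lin_form 0 1 :: s1) p.
  rewrite big_cons {1}/lin_form mpolyC0 mpolyC1 mul0r add0r mul1r.
  have -> : al * q - ga * n = (al * et - be * ga) * 'X_ord_max by rewrite /q /n; ring.
  by rewrite Ed; ring.
have [|||g [n' [d' [w' [E1 E2 E3 E4]]]]] := @cancel_prime_factors _ (lin_form 0 1 :: s1)
  (tnth G (inord 1) * c%:MP) (tnth G ord_max * c%:MP) n q W.
- move=> p; rewrite inE => /orP[/eqP->|/s1P//].
  by apply: lin_form_prime; rewrite oner_eq0 orbT.
- rewrite -key /W; set u := tnth G (inord 1) in Enq *; set v := tnth G ord_max in Enq *.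
  by transitivity (al * (u * q) - ga * n * u); [|rewrite Enq]; ring.
- rewrite -key /W; set u := tnth G (inord 1) in Enq *; set v := tnth G ord_max in Enq *.
  by transitivity (al * v * q - ga * (v * n)); [|rewrite -Enq]; ring.
have G2q : tnth G ord_max * c%:MP * g = q * w' by rewrite E4 E2; ring.
have ci (r r' : {mpoly K[3]}) : r * c%:MP = r' -> r = c^-1%:MP * r'.
  by move=> <-; rewrite mulrCA mulrA -mulrA -mpolyCM mulVf // mpolyC1 mulr1.
have l2n0 := nzf _ l20; have qn0 := nzf _ q0.
(* Here w divides all three forms, hence is constant, and G_2 divides q t up to a scalar. *)
have fin w t : (forall i, exists r, tnth G i * c%:MP = r * w) -> w' = w * t ->
    t \is 0.-homog \/ t \is 1.-homog -> (d <= m + 2)%N.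
  move=> wG Ew th; have [|k Ek] := ncf w.
    by move=> i; have [r /ci ->] := wG i; exists (c^-1%:MP * r); rewrite mulrA.
  have Eq : tnth G ord_max * (c%:MP * g) = q * (k *: t).
    by rewrite mulrA G2q Ew Ek mul_mpolyC.
  have w'0 : w' != 0.
    apply: contraNneq G2 => w0; move: E4; rewrite w0 mulr0 => /ci ->; rewrite mulr0.
    exact: eqxx.
  have n0 : q * (k *: t) != 0 by rewrite -mul_mpolyC -Ek -Ew mulf_neq0.
  case: th => th; last first.
    rewrite addn2 -addn1; apply: homog_dvd_degree (Gd _) _ n0 Eq.
    by apply: dhomogM => //; apply: rpredZ.
  apply: leq_trans (_ : m.+1 + 0 <= _)%N; last by rewrite addn0 addn2.
  by apply: homog_dvd_degree (Gd _) _ n0 Eq; apply: dhomogM => //; apply: rpredZ.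
have G0l : tnth G ord0 * c%:MP * l2 = d' * w' * l1 by rewrite mulrAC El -E4; ring.
have one0 : (1 : {mpoly K[3]}) \is 0.-homog by exact: dhomog1.
have [_ pr] : prime_element l2.
  apply: lin_form_prime; apply: contraNT l2n0; rewrite negb_or !negbK => /andP[/eqP a0 /eqP b0].
  by rewrite /l2 /lin_form a0 b0 mpolyC0 !mul0r addr0.
have base (r : {mpoly K[3]}) : tnth G ord0 * c%:MP = r * w' -> (d <= m + 2)%N.
  move=> Er; apply: (fin w' 1) => [i||]; [|by rewrite mulr1|by left].
  by case: (ord3P i) => ->; [exists r | exists n' | exists d'].
have dv : divides l2 (d' * w' * l1) by exists (tnth G ord0 * c%:MP).
(* The prime [l2] divides d', w' or l1. The common factor is w', except in the second case, where it
   is w' / l2. *)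
have [/pr[[r Er]|[r Er]]|[r Er]] := pr _ _ dv.
- by apply: (base (r * l1)); apply: (mulIf l2n0); rewrite G0l Er; ring.
- apply: (fin r l2) => [i|//|]; last by right; apply: lh.
  case: (ord3P i) => ->; [exists (d' * l1) | exists (n' * l2) | exists (d' * l2)].
  + by apply: (mulIf l2n0); rewrite G0l Er; ring.
  + by rewrite E3 Er; ring.
  + by rewrite E4 Er; ring.
by apply: (base (d' * r)); apply: (mulIf l2n0); rewrite G0l Er; ring.
Qed.

End DegreeBound.


(** * Heights of rational functions and of matrices *)

Section Height.
Variables (K : closedFieldType) (F : ratfun K).
Local Notation ev := (@rf_eval K F).
Local Notation emb := (rf_emb F).
Implicit Types (p q : {poly K}) (z w : F) (A B : 'M[F]_2) (N : 'M[K]_2).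

Definition ht_le m z := exists p q,
  [/\ q != 0, z = ev p / ev q, (size p <= m)%N & (size q <= m)%N].

Lemma size_mul_bound p q a b :
  (size p <= a)%N -> (size q <= b)%N -> (size (p * q)%R <= a + b)%N.
Proof.
move=> pa qb; apply: leq_trans (size_polyMleq _ _) _.
exact: leq_trans (leq_pred _) (leq_add pa qb).
Qed.

Lemma size_add_bound p q a :
  (size p <= a)%N -> (size q <= a)%N -> (size (p + q)%R <= a)%N.
Proof. by move=> pa qa; apply: leq_trans (size_polyD _ _) _; rewrite geq_max pa. Qed.

Lemma ht_leW a b z : (a <= b)%N -> ht_le a z -> ht_le b z.
Proof.
by move=> ab [p [q [q0 Ez sp sq]]]; exists p, q; split=> //; apply: leq_trans ab.
Qed.

Lemma ht_leD a b z w : ht_le a z -> ht_le b w -> ht_le (a + b) (z + w).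
Proof.
move=> [p [q [q0 -> sp sq]]] [p' [q' [q0' -> sp' sq']]].
exists (p * q' + p' * q), (q * q'); rewrite mulf_neq0 // size_mul_bound //.
rewrite rmorphD !rmorphM /= addf_div ?rf_eval_neq0 //; split=> //.
by apply: size_add_bound; [|rewrite addnC]; apply: size_mul_bound.
Qed.

Lemma ht_leM a b z w : ht_le a z -> ht_le b w -> ht_le (a + b) (z * w).
Proof.
move=> [p [q [q0 -> sp sq]]] [p' [q' [q0' -> sp' sq']]].
by exists (p * p'), (q * q'); rewrite mulf_neq0 // !size_mul_bound // mulf_div !rmorphM.
Qed.

Lemma ht_le_const c : ht_le 1 (emb c).
Proof.
exists c%:P, 1; rewrite oner_eq0 rmorph1 divr1 rf_evalC size_poly1.
by rewrite size_polyC_leq1.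
Qed.

Lemma ht_leN a z : ht_le a z -> ht_le a (- z).
Proof.
by move=> [p [q [q0 -> sp sq]]]; exists (- p), q; rewrite rmorphN mulNr size_polyN.
Qed.

Lemma ht_leV a z : (0 < a)%N -> ht_le a z -> ht_le a z^-1.
Proof.
move=> a0 [p [q [q0 -> sp sq]]]; have [->|p0] := eqVneq p 0.
  by exists 0, 1; rewrite !rmorph0 !mul0r invr0 oner_eq0 size_poly0 size_poly1.
by exists q, p; rewrite p0 invf_div.
Qed.

Lemma ht_le_exists z : exists m, ht_le m z.
Proof.
have [p [q [q0 ->]]] := rf_numden z.
by exists (maxn (size p) (size q)), p, q; rewrite leq_maxl leq_maxr.
Qed.

(** If z = p/q in lowest terms, p^2 and q^2 divide the numerator and denominator of any fraction
    equal to z^2. This bounds scalars that are known only through determinants. *)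
Lemma ht_le_sqrt a z : ht_le a (z ^+ 2) -> ht_le a z.
Proof.
have [p [q [q0 pq ->]]] := rf_coprime z.
move=> [p' [q' [q0' E sp sq]]]; exists p, q.
have qn := q0; have q'n := q0'; rewrite -(@rf_eval_neq0 _ F) in qn;
  rewrite -(@rf_eval_neq0 _ F) in q'n.
have Epq : p ^+ 2 * q' = p' * q ^+ 2.
  apply: (@rf_eval_inj _ F); move/eqP: E.
  by rewrite expr2 mulf_div eqr_div ?mulf_neq0 // -!rmorphM => /eqP.
have pq2 : coprimep (p ^+ 2) (q ^+ 2) by apply/coprimep_expl/coprimep_expr.
have sq_le (u v : {poly K}) b : v != 0 -> u ^+ 2 %| v -> (size v <= b)%N -> (size u <= b)%N.
  move=> v0 uv vb; have u0 : u != 0 by apply: contraNneq v0 => u0; move: uv;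
    rewrite u0 expr0n /= dvd0p.
  apply: leq_trans (leq_trans (dvdp_leq v0 uv) vb).
  by apply: dvdp_leq; rewrite ?expf_neq0 // expr2 dvdp_mulr.
split=> //; last first.
  apply: (sq_le _ q') => //; rewrite -(Gauss_dvdpr _ (_ : coprimep _ (p ^+ 2))).
    by rewrite Epq dvdp_mull.
  by rewrite coprimep_sym.
have [->|p0] := eqVneq p 0; first by rewrite size_poly0.
apply: (sq_le _ p') => //.
  apply: contraNneq p0 => p'0; move: Epq; rewrite p'0 mul0r => /eqP.
  by rewrite mulf_eq0 (negPf q0') orbF expf_eq0.
by rewrite -(Gauss_dvdpl _ pq2) -Epq dvdp_mulr.
Qed.

Lemma size_lin_exp (a b : K) i : (size ((a%:P * 'X + b%:P) ^+ i)%R <= i.+1)%N.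
Proof.
have s1 : (size (a%:P * 'X + b%:P)%R <= 2)%N.
  by rewrite size_MXaddC; case: ifP => // _; rewrite ltnS size_polyC_leq1.
elim: i => [|i IHi]; first by rewrite expr0 size_poly1.
rewrite exprS; apply: leq_trans (size_polyMleq _ _) _.
by have := leq_add s1 IHi; case: (_ + _)%N.
Qed.

(** The m-th power of the denominator of N clears p(N x) for all p of degree at most m at once. The
    entries of a matrix therefore share the factor [s], and its height does not grow. *)
Lemma subst_poly m N : N \in unitmx -> exists2 g : {poly K} -> {poly K},
  (forall p, (size (g p) <= m.+1)%N) & exists2 s : F, s != 0 &
    forall p, (size p <= m.+1)%N -> ev (g p) = s * subst F N (ev p).
Proof.
move=> uN; set n := N ord0 ord0; set n' := N ord0 ord_max.
set d := N ord_max ord0; set d' := N ord_max ord_max.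
pose P : {poly K} := n%:P * 'X + n'%:P; pose Q : {poly K} := d%:P * 'X + d'%:P.
have evQ : ev Q = emb d * rf_gen F + emb d' by rewrite rmorphD rmorphM /= !rf_evalC rf_evalX.
have evP : ev P = emb n * rf_gen F + emb n' by rewrite rmorphD rmorphM /= !rf_evalC rf_evalX.
have Q0 : ev Q != 0 by rewrite evQ homography_den_neq0.
exists (fun p => \sum_(i < m.+1) p`_i *: (P ^+ i * Q ^+ (m - i))) => [p|].
  apply: (big_ind (fun q => (size q <= m.+1)%N)) => [|q r|i _].
  - by rewrite size_poly0.
  - exact: size_add_bound.
  apply: leq_trans (size_scale_leq _ _) _; apply: leq_trans (size_polyMleq _ _) _.
  have := leq_add (size_lin_exp n n' i) (size_lin_exp d d' (m - i)).
  by rewrite -/P -/Q addSn addnS (subnKC (ltnSE (ltn_ord i))); case: (_ + _)%N.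
exists (ev Q ^+ m); first by rewrite expf_neq0.
move=> p sp; rewrite {2}/rf_eval -horner_map -map_poly_comp subst_gen //.
rewrite (@eq_map_poly _ _ _ emb) => [|c]; last by rewrite /= subst_const.
rewrite /homography !mxE -evQ -evP (horner_div emb (ev P) Q0 sp) rmorph_sum /=.
apply: eq_bigr => i _; rewrite -mul_polyC !rmorphM !rmorphXn /= rf_evalC; ring.
Qed.

Lemma ht_le_subst m z N : N \in unitmx -> ht_le m z -> ht_le m (subst F N z).
Proof.
move=> uN [p [q [q0 -> sp sq]]]; case: m sp sq => [|m] sp sq.
  by move: q0; rewrite -size_poly_eq0 -leqn0 sq.
have [g gs [s s0 gE]] := @subst_poly m N uN; exists (g p), (g q).
have gq := gE q sq; rewrite !gs (gE p) // gq -mulf_div divff // mul1r fmorph_div.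
split=> //; rewrite -(@rf_eval_neq0 _ F) gq mulf_neq0 // fmorph_eq0.
by rewrite rf_eval_neq0.
Qed.

Lemma height_leW a b A : (a <= b)%N -> height_le a A -> height_le b A.
Proof.
by move=> ab [B [s [s0 E Bs]]]; exists B, s; split=> // i j; apply: leq_trans (Bs i j) ab.
Qed.

Lemma height_leM a b A B : height_le a A -> height_le b B -> height_le (a + b) (A *m B).
Proof.
move=> [A' [s [s0 -> As]]] [B' [t [t0 -> Bs]]].
exists (A' *m B'), (s * t); rewrite mulf_neq0 //; split=> // [|i j].
  by rewrite /poly_mx map_mxM -scalemxAl -scalemxAr scalerA.
by rewrite mulmx2E; apply: size_add_bound; apply: size_mul_bound.
Qed.

Lemma height_le_subst m A N : N \in unitmx -> height_le m A -> height_le m (A ^^ N).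
Proof.
move=> uN [B [s [s0 -> Bs]]]; case: m Bs => [|m] Bs.
  exists B, (subst F N s); rewrite fmorph_eq0; split=> //.
  have -> : B = 0.
    by apply/matrixP => i j; apply/eqP; rewrite mxE -size_poly_eq0 -leqn0.
  by rewrite /poly_mx !map_mx0 !scaler0 map_mx0.
have [g gs [t t0 gE]] := @subst_poly m N uN.
exists (map_mx g B), (subst F N s / t); rewrite mulf_neq0 ?invr_eq0 ?fmorph_eq0 //.
split=> // [|i j]; last by rewrite mxE.
apply/matrixP => i j; rewrite !mxE rmorphM /= gE // mulrA divfK //.
Qed.

Lemma height_le_scale m c A : c != 0 -> height_le m A -> height_le m (c *: A).
Proof.
by move=> c0 [B [s [s0 -> Bs]]]; exists B, (c * s); rewrite mulf_neq0 // scalerA.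
Qed.

(** Over the product of the four denominators, each entry becomes one numerator times three
    denominators, whence the factor 4. *)
Lemma ht_le_mx m A : (forall i j, ht_le m (A i j)) -> exists n, height_le n A /\ (n <= 4 * m)%N.
Proof.
move=> Am; have P i j : exists pq : {poly K} * {poly K},
    [/\ pq.2 != 0, A i j = ev pq.1 / ev pq.2, (size pq.1 <= m)%N & (size pq.2 <= m)%N].
  by have [p [q H]] := Am i j; exists (p, q).
have [[p0 q0] /= [z0 E0 a0 b0]] := P ord0 ord0.
have [[p1 q1] /= [z1 E1 a1 b1]] := P ord0 ord_max.
have [[p2 q2] /= [z2 E2 a2 b2]] := P ord_max ord0.
have [[p3 q3] /= [z3 E3 a3 b3]] := P ord_max ord_max.
exists (4 * m)%N; split=> //.
have e0 := z0; have e1 := z1; have e2 := z2; have e3 := z3.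
rewrite -(@rf_eval_neq0 _ F) in e0; rewrite -(@rf_eval_neq0 _ F) in e1.
rewrite -(@rf_eval_neq0 _ F) in e2; rewrite -(@rf_eval_neq0 _ F) in e3.
exists (mx2 (p0 * (q1 * (q2 * q3))) (p1 * (q0 * (q2 * q3)))
            (p2 * (q0 * (q1 * q3))) (p3 * (q0 * (q1 * q2)))),
  (ev q0 * ev q1 * ev q2 * ev q3)^-1; split.
- by rewrite invr_eq0 !mulf_neq0.
- rewrite [LHS]mx2P E0 E1 E2 E3 /poly_mx map_mx2 scale_mx2 !rmorphM /=.
  by congr mx2; field; rewrite ?e0 ?e1 ?e2 ?e3.
have b (a b c d : {poly K}) : (size a <= m)%N -> (size b <= m)%N -> (size c <= m)%N -> (size d <= m)%N ->
    (size (a * (b * (c * d)))%R <= 4 * m)%N.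
  by move=> *; rewrite !mulSn mul0n addn0; do 3![apply: size_mul_bound => //].
have I2 (k : 'I_2) : k = ord0 \/ k = ord_max.
  by case: k => [[|[|//]]] ltk; [left | right]; apply: val_inj.
by move=> i j; case: (I2 i) => ->; case: (I2 j) => ->; rewrite !mx2E; apply: b.
Qed.

Lemma height_le_exists A : exists m, height_le m A.
Proof.
have [a ha] := ht_le_exists (A ord0 ord0); have [b hb] := ht_le_exists (A ord0 ord_max).
have [c hc] := ht_le_exists (A ord_max ord0); have [d hd] := ht_le_exists (A ord_max ord_max).
have [|n [hn _]] := @ht_le_mx (a + b + c + d)%N A; last by exists n.
have I2 (k : 'I_2) : k = ord0 \/ k = ord_max.
  by case: k => [[|[|//]]] ltk; [left | right]; apply: val_inj.
by move=> i j; case: (I2 i) => ->; case: (I2 j) => ->;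
  [apply: ht_leW ha | apply: ht_leW hb | apply: ht_leW hc | apply: ht_leW hd]; lia.
Qed.

End Height.


(** * Normal forms and growth *)

Lemma unitmx2 (L : fieldType) (a b c d : L) : (mx2 a b c d \in unitmx) = (a * d - b * c != 0).
Proof. by rewrite unitmxE unitfE det_mx2. Qed.

(** The expression is det(v, B v) for v = (x, y): a nonscalar matrix has a vector that is not an
    eigenvector. *)
Lemma mx2_cyclic_vector (L : fieldType) (a b c d : L) : ~ is_scalar_mx (mx2 a b c d) ->
  exists x y, x * (c * x + d * y) - y * (a * x + b * y) != 0.
Proof.
move=> nsc; have [c0|c0] := eqVneq c 0; last by exists 1, 0; rewrite !mulr1 !mulr0 mul0r subr0 mul1r addr0.
have [b0|b0] := eqVneq b 0; last first.
  by exists 0, 1; rewrite mul0r mulr0 sub0r oppr_eq0 mul1r add0r mulr1.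
exists 1, 1; rewrite c0 b0 !mul1r !mulr1 add0r addr0 subr_eq0; apply/eqP => da.
by apply: nsc; apply/is_scalar_mxP; exists a; rewrite scalar_mx2 c0 b0 da.
Qed.

(** For a cyclic vector v, Cayley-Hamilton makes (B - r') v and (B - r) v eigenvectors for r and r'.
    If r = r', the columns of C are (B - r) v and v. *)
Lemma mx2_diagonal_or_jordan (L : fieldType) (B : 'M[L]_2) (r r' : L) :
  r + r' = \tr B -> r * r' = \det B -> ~ is_scalar_mx B ->
  exists2 C, C \in unitmx & B *m C = C *m (if r == r' then mx2 r 1 0 r else mx2 r 0 0 r').
Proof.
rewrite /mxtrace !big_ord_recl big_ord0 addr0 det2 [B]mx2P.
move: (B ord0 ord0) (B ord0 ord_max) (B ord_max ord0) (B ord_max ord_max) => a b c d.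
have -> : lift ord0 ord0 = ord_max :> 'I_2 by apply: val_inj.
rewrite !mx2E => Et Ed /mx2_cyclic_vector[x [y]].
set D := x * _ - _ => D0; have Ea : a = r + r' - d by rewrite Et addrK.
have H u : (r * r' - (a * d - b * c)) * u = 0 by rewrite Ed subrr mul0r.
have [Er|r_neq] := eqVneq r r'.
  exists (mx2 (a * x + b * y - r * x) x (c * x + d * y - r * y) y).
    by rewrite unitmx2 (_ : _ - _ = - D) ?oppr_eq0 // /D; ring.
  rewrite !mx2_mul Ea -Er; congr mx2; apply/eqP; rewrite -subr_eq0; apply/eqP; try ring.
    by rewrite -[RHS](H x) Ea -Er; ring.
  by rewrite -[RHS](H y) Ea -Er; ring.
exists (mx2 (a * x + b * y - r' * x) (a * x + b * y - r * x)
            (c * x + d * y - r' * y) (c * x + d * y - r * y)).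
  rewrite unitmx2 (_ : _ - _ = (r - r') * D); last by rewrite /D; ring.
  by apply: mulf_neq0 => //; rewrite subr_eq0.
rewrite !mx2_mul; congr mx2; apply/eqP; rewrite -subr_eq0; apply/eqP.
- by rewrite -[RHS](H x) Ea; ring.
- by rewrite -[RHS](H x) Ea; ring.
- by rewrite -[RHS](H y) Ea; ring.
- by rewrite -[RHS](H y) Ea; ring.
Qed.

Definition aff (L : fieldType) (b s : L) : 'M[L]_2 := mx2 b s 0 1.

Lemma unit_aff (L : fieldType) (b s : L) : (aff b s \in unitmx) = (b != 0).
Proof. by rewrite unitmx2 mulr1 mulr0 subr0. Qed.

Definition infinite_order (L : fieldType) (M : 'M[L]_2) :=
  forall n c, (0 < n)%N -> M ^+ n <> c%:M.

Lemma mx2_expr_diag (L : fieldType) (a d : L) n : mx2 a 0 0 d ^+ n = mx2 (a ^+ n) 0 0 (d ^+ n).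
Proof.
elim: n => [|n IHn]; first by rewrite -scalar_mx2.
by rewrite exprS IHn -[LHS]/(_ *m _) mx2_mul !mulr0 !mul0r !addr0 !add0r !exprS.
Qed.

Lemma mx2_expr_jordan (L : fieldType) (a b : L) n :
  mx2 a b 0 a ^+ n = mx2 (a ^+ n) (a ^+ n.-1 * b *+ n) 0 (a ^+ n).
Proof.
elim: n => [|n IHn]; first by rewrite expr0 mulr0n -scalar_mx2.
rewrite exprS IHn -[LHS]/(_ *m _) mx2_mul !mulr0 !mul0r !addr0 !add0r -!exprS.
congr mx2; rewrite mulrSr -mulrnAr mulrA; case: n {IHn} => [|n]; first by rewrite !mulr0n mulr0 mulrC.
by rewrite -exprS -mulrnAr mulrC [b * _]mulrC.
Qed.

Lemma mx_conj_expr (L : fieldType) (M C J : 'M[L]_2) n :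
  C \in unitmx -> M *m C = C *m J -> M ^+ n *m C = C *m J ^+ n.
Proof.
move=> uC E; elim: n => [|n IHn]; first by rewrite !expr0 mul1mx mulmx1.
by rewrite exprSr -[_ * M]/(_ *m M) -mulmxA E mulmxA IHn -mulmxA exprSr.
Qed.

(** With distinct eigenvalues, a is their quotient. A Jordan block has n-th power scalar as soon as
    n = 0 in K, so infinite order excludes positive characteristic there. *)
Lemma infinite_order_normal_form (K : closedFieldType) (M : 'M[K]_2) :
  M \in unitmx -> infinite_order M ->
  exists2 C, C \in unitmx & exists2 c, c != 0 &
    (exists a, [/\ a != 0, forall n, (0 < n)%N -> a ^+ n != 1 & invmx C *m M *m C = c *: aff a 0]) \/
    ((forall n, (0 < n)%N -> n%:R != 0 :> K) /\ invmx C *m M *m C = c *: aff 1 1).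
Proof.
move=> uM iM; have nsc : ~ is_scalar_mx M.
  by move=> /is_scalar_mxP[c Ec]; apply: (iM 1%N c).
(* An eigenvalue: r^2 = tr(M) r - det(M). *)
have [r Er] := @solve_monicpoly K 2 (fun i => if i == 0%N then - \det M else \tr M) isT.
rewrite !big_ord_recl big_ord0 /= expr0 expr1 mulr1 addr0 in Er.
have [||C uC] := @mx2_diagonal_or_jordan K M r (\tr M - r) _ _ nsc; first by rewrite addrC subrK.
  by rewrite mulrBr -expr2 Er opprD opprK addrCA [r * _]mulrC subrr addr0.
set r' := \tr M - r => EC.
have det0 : r * r' != 0.
  have -> : r * r' = \det M by rewrite mulrBr -expr2 Er opprD opprK addrCA [r * _]mulrC subrr addr0.
  by rewrite -unitfE -unitmxE.
have [r0 r'0] : r != 0 /\ r' != 0 by move: det0; rewrite mulf_eq0 negb_or => /andP[].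
have conj C' c J : C' \in unitmx -> M *m C' = C' *m (c *: J) -> invmx C' *m M *m C' = c *: J.
  by move=> uC' E; rewrite -mulmxA E mulmxA mulVmx // mul1mx.
have scal n c : M ^+ n *m C = C *m c%:M -> M ^+ n = c%:M.
  by move=> E; rewrite -[LHS](mulmxK uC) E mul_mx_scalar -scalemxAl mulmxV // scalemx1.
move: EC; have [_ EJ|_ EJ] := eqVneq r r'.
  exists (C *m mx2 1 0 0 r).
    by rewrite unitmx_mul uC unitmx2 mul1r mul0r subr0.
  exists r => //; right; split=> [n n0|].
    apply/negP => /eqP nK; apply: (iM n (r ^+ n) n0); apply: scal.
    rewrite (mx_conj_expr n uC EJ) mx2_expr_jordan scalar_mx2.
    by rewrite mulr1 -[r ^+ _ *+ n]mulr_natr nK mulr0.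
  apply: conj; first by rewrite unitmx_mul uC unitmx2 mul1r mul0r subr0.
  rewrite mulmxA EJ -!mulmxA; congr (_ *m _).
  by rewrite /aff scale_mx2 !mx2_mul; congr mx2; ring.
exists C => //; exists r' => //; left; exists (r / r'); split=> [|n n0|].
- by rewrite mulf_neq0 ?invr_eq0.
- apply/negP; rewrite expr_div_n => /eqP/(canRL (divfK (expf_neq0 n r'0))).
  rewrite mul1r => En; apply: (iM n (r' ^+ n) n0); apply: scal.
  by rewrite (mx_conj_expr n uC EJ) mx2_expr_diag En scalar_mx2.
apply: conj => //; rewrite EJ /aff scale_mx2 !mulr0 mulr1 mulrC divfK //.
Qed.

(** An antidiagonal N also commutes with the scaling up to a scalar when a = -1; this is excluded by
    a^2 != 1. *)
Lemma centralizer_diag (K : fieldType) (a c : K) (N : 'M[K]_2) :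
  a != 0 -> a != 1 -> a ^+ 2 != 1 -> N \in unitmx -> aff a 0 *m N = c *: (N *m aff a 0) ->
  exists b k : K, [/\ b != 0, k != 0 & N = k *: aff b 0].
Proof.
move=> a0 a1 a2; rewrite [N]mx2P unitmx2.
move: (N ord0 ord0) (N ord0 ord_max) (N ord_max ord0) (N ord_max ord_max) => p q r s d0.
rewrite /aff !mx2_mul scale_mx2 !mul0r !mul1r !mulr0 !mulr1 !addr0 !add0r.
move=> H; have [Ep Eq Er Es] := mx2_inj H.
have a1' : 1 - a != 0 by rewrite subr_eq0 eq_sym.
have [s0|s0] := eqVneq s 0; last first.
  have c1 : c = 1 by apply: (mulIf s0); rewrite mul1r -Es.
  have q0 : q = 0.
    apply/eqP; move: Eq; rewrite c1 mul1r => /eqP; rewrite -subr_eq0 -{2}[q]mul1r -mulrBl.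
    by rewrite mulf_eq0 subr_eq0 (negPf a1).
  have r0 : r = 0.
    apply/eqP; move: Er; rewrite c1 mul1r => /eqP; rewrite -subr_eq0 -{1}[r]mulr1 -mulrBr.
    by rewrite mulf_eq0 (negPf a1') orbF.
  exists (p / s), s; split=> //; last first.
    by rewrite scale_mx2 q0 r0 !mulr0 mulr1 mulrC divfK.
  rewrite mulf_neq0 ?invr_eq0 //; apply: contraNneq d0 => p0.
  by rewrite p0 q0 !mul0r subrr.
have [q0 r0] : q != 0 /\ r != 0.
  by split; apply: contraNneq d0 => z0; rewrite s0 z0 ?mulr0 ?mul0r ?subrr.
have ca : a = c by apply: (mulIf q0).
move: Er; rewrite -ca => Er; case/negP: a2; apply/eqP/(mulfI r0).
by rewrite mulr1 {2}Er; ring.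
Qed.

Lemma centralizer_unipotent (K : fieldType) (c : K) (N : 'M[K]_2) :
  N \in unitmx -> aff 1 1 *m N = c *: (N *m aff 1 1) ->
  exists b k : K, k != 0 /\ N = k *: aff 1 b.
Proof.
rewrite [N]mx2P unitmx2.
move: (N ord0 ord0) (N ord0 ord_max) (N ord_max ord0) (N ord_max ord_max) => p q r s d0.
rewrite /aff !mx2_mul scale_mx2 !mul0r !mul1r !mulr0 !mulr1 !addr0 !add0r.
move=> H; have [Ep Eq Er Es] := mx2_inj H.
have r0 : r = 0.
  apply/eqP/negPn/negP => r0; have c1 : c = 1 by apply: (mulIf r0); rewrite mul1r -Er.
  move: Es; rewrite c1 mul1r -{1}[s]add0r => /addIr E; by rewrite -E eqxx in r0.
rewrite r0 addr0 in Ep; rewrite r0 add0r in Es; rewrite r0 mulr0 subr0 in d0.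
have [p0 s0] : p != 0 /\ s != 0 by move: d0; rewrite mulf_eq0 negb_or => /andP[].
have c1 : c = 1 by apply: (mulIf p0); rewrite mul1r -Ep.
move: Eq; rewrite c1 mul1r [RHS]addrC => /addrI Esp.
by exists (q / s), s; split=> //; rewrite scale_mx2 r0 !mulr1 mulr0 Esp mulrC divfK // -Esp.
Qed.

Section Growth.
Variables (K : closedFieldType) (F : ratfun K) (E : ratfun F).
Implicit Types (f g : Cremona K).

(** Quantifying over all lifts makes the property independent of the choice of matrices. *)
Definition unbounded_growth f := forall m, exists n, forall M A,
  is_jonq E (f ^+ n)%g M A -> ~ height_le m A.

Lemma linear_growth_unbounded f : linear_degree_growth f -> unbounded_growth f.
Proof.
move=> [deg [degP [C C0 Cdeg]]] m; exists (C * (m + 2)).+1 => M A jM hA.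
have [Cn _] := Cdeg (C * (m + 2)).+1 isT.
have := degree_le_height jM hA (degP _).
by move/(leq_mul (leqnn C)) => /(leq_trans Cn); rewrite ltnn.
Qed.

Lemma unbounded_growth_conj f g N C :
  is_jonq E g N C -> unbounded_growth f -> unbounded_growth (f ^ g)%g.
Proof.
move=> jg uf m; have jg' := is_jonqV jg; have [uN _ _] := jg.
have uN' : invmx N \in unitmx by rewrite unitmx_inv.
have [a ha] := height_le_exists C; have [b hb] := height_le_exists (invmx (C ^^ invmx N)).
have [n Hn] := uf (a + m + b)%N; exists n => M A; rewrite -conjXg => jA hA.
have uM : M \in unitmx by case: jA.
have := is_jonqM (is_jonqM jg jA) jg'.
have -> : (g * (f ^+ n) ^ g * g^-1 = f ^+ n)%g by rewrite conjgE mulVKg mulgK.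
move/Hn; apply; apply: height_leM hb; apply: height_le_subst => //.
by apply: height_leM hA; apply: height_le_subst.
Qed.

End Growth.


(** * Elements of the centralizer acting trivially on the base *)

Section CentralizerOverBase.
Variables (K : closedFieldType) (F : ratfun K) (E : ratfun F).
Local Notation emb := (rf_emb F).
Implicit Types (f g h : Cremona K) (M N : 'M[K]_2) (A B C : 'M[F]_2).

Lemma is_jonq_commute f g M A N B : is_jonq E f M A -> is_jonq E g N B -> commute g f ->
  (exists2 c, c != 0 & N *m M = c *: (M *m N)) /\
  (exists2 c, c != 0 & (B ^^ M) *m A = c *: ((A ^^ N) *m B)).
Proof.
move=> jf jg cgf; have jfg := is_jonqM jf jg; have := is_jonqM jg jf.
by rewrite cgf; apply: is_jonq_uniq.
Qed.

Lemma commute_is_jonq f g M A N B c c' : is_jonq E f M A -> is_jonq E g N B ->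
  c != 0 -> c' != 0 -> N *m M = c *: (M *m N) -> (B ^^ M) *m A = c' *: ((A ^^ N) *m B) ->
  commute g f.
Proof.
move=> jf jg c0 c'0 EM EA; have := is_jonqM jg jf; rewrite EM EA => j.
exact: is_jonq_inj j (is_jonq_scale c0 c'0 (is_jonqM jf jg)).
Qed.

Lemma commute_base_id f g M A B : is_jonq E f M A -> is_jonq E g 1%:M B -> commute g f ->
  exists2 c, c != 0 & (B ^^ M) *m A = c *: (A *m B).
Proof.
move=> jf jg cgf; have [_ [c c0 Ec]] := is_jonq_commute jf jg cgf.
by exists c; rewrite // Ec subst_mx1.
Qed.

Lemma unit_col_neq0 (L : fieldType) (C : 'M[L]_2) : C \in unitmx ->
  (C ord0 ord0 != 0) || (C ord_max ord0 != 0).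
Proof.
rewrite unitmxE unitfE det2; apply: contraNT; rewrite negb_or !negbK => /andP[/eqP-> /eqP->].
by rewrite mul0r mulr0 subrr.
Qed.

Lemma kernel_vector (L : fieldType) (a b x y : L) : (a != 0) || (b != 0) ->
  (x != 0) || (y != 0) -> a * x + b * y = 0 ->
  exists2 l, l != 0 & x = l * - b /\ y = l * a.
Proof.
move=> ab xy E0; have [a0|a0] := eqVneq a 0.
  have b0 : b != 0 by move: ab; rewrite a0 eqxx.
  have y0 : y = 0.
    by apply/eqP; move/eqP: E0; rewrite a0 mul0r add0r mulf_eq0 (negPf b0).
  have x0 : x != 0 by move: xy; rewrite y0 eqxx orbF.
  exists (- x / b); first by rewrite mulf_neq0 ?invr_eq0 ?oppr_eq0.
  by rewrite y0 a0 mulr0 mulrN mulNr mulNr opprK divfK.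
have Ex : x = - (b * y) / a by apply: (canRL (mulfK a0)); rewrite mulrC; apply/eqP; rewrite -addr_eq0 E0.
exists (y / a); last by rewrite divfK // Ex; split=> //; field.
rewrite mulf_neq0 ?invr_eq0 //; apply: contraTneq xy => y0.
by rewrite Ex y0 mulr0 oppr0 mul0r eqxx.
Qed.

(* An intertwiner of the pairs [(B1, B2)] and [(P1, P2)] is determined up to a scalar:
   its value at a cyclic vector [w] of [B1] is killed by [P2 - a - b P1], where
   [B2 w = a w + b B1 w]. *)
Lemma intertwiner_formula (L : fieldType) (B1 B2 C : 'M[L]_2) (a b : L) :
  B1 *m B2 <> B2 *m B1 -> C \in unitmx ->
  B1 *m C = C *m mx2 0 (- \det B1) 1 (\tr B1) ->
  (B2 *m C) ord0 ord0 = a * C ord0 ord0 + b * C ord0 ord_max ->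
  (B2 *m C) ord_max ord0 = a * C ord_max ord0 + b * C ord_max ord_max ->
  forall A P1 P2 : 'M[L]_2, A \in unitmx -> P1 *m A = A *m B1 -> P2 *m A = A *m B2 ->
  let T := P2 - a%:M - b *: P1 in
  exists2 l, l != 0 & exists i, A = l *: (mx2 (- T i ord_max)
     (P1 ord0 ord0 * - T i ord_max + P1 ord0 ord_max * T i ord0)
     (T i ord0) (P1 ord_max ord0 * - T i ord_max + P1 ord_max ord_max * T i ord0) *m invmx C).
Proof.
move=> nc uC EB E0 E1 A P1 P2 uA EP1 EP2 T.
have uZ : A *m C \in unitmx by rewrite unitmx_mul uA.
set Z := A *m C in uZ.
have PZ : P1 *m Z = Z *m mx2 0 (- \det B1) 1 (\tr B1) by rewrite mulmxA EP1 -!mulmxA EB.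
have P2Z i : (P2 *m Z) i ord0 = a * Z i ord0 + b * Z i ord_max.
  by rewrite mulmxA EP2 -mulmxA /Z [LHS]mulmx2E E0 E1 !mulmx2E; ring.
have P1Z i : (P1 *m Z) i ord0 = Z i ord_max.
  by rewrite PZ mulmx2E !mx2E; ring.
have TZ i : T i ord0 * Z ord0 ord0 + T i ord_max * Z ord_max ord0 = 0.
  have mxB (U V : 'M[L]_2) j k : (U - V) j k = U j k - V j k by rewrite !mxE.
  have mxS c (U : 'M[L]_2) j k : (c *: U) j k = c * U j k by rewrite mxE.
  rewrite -(mulmx2E T Z) /T !mulmxBl -scalemxAl mul_scalar_mx !mxB !mxS P2Z P1Z; ring.
(* If T = 0, then P2 = a + b P1 commutes with P1, hence B1 with B2. *)
have [i Ti] : exists i, (T i ord0 != 0) || (T i ord_max != 0).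
  have [T0|/negPf T0] := boolP ((T ord0 ord0 != 0) || (T ord0 ord_max != 0)); first by exists ord0.
  have [T1|/negPf T1] := boolP ((T ord_max ord0 != 0) || (T ord_max ord_max != 0)); first by exists ord_max.
  move/negbT: T0; move/negbT: T1; rewrite !negb_or !negbK.
  move=> /andP[/eqP T10 /eqP T11] /andP[/eqP T00 /eqP T01].
  have TE : T = 0 by apply: mx2_eq; rewrite [RHS]mxE.
  case: nc; apply: (can_inj (mulKmx uA)); rewrite !mulmxA -EP1 -EP2 -!mulmxA -EP1 -EP2.
  rewrite !mulmxA; congr (_ *m A).
  have -> : P2 = a%:M + b *: P1.
    by apply/eqP; rewrite -subr_eq0 opprD addrA; apply/eqP.
  by rewrite mulmxDl mulmxDr mul_scalar_mx mul_mx_scalar -scalemxAl -scalemxAr.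
have [l l0 [Zx Zy]] := kernel_vector Ti (unit_col_neq0 uZ) (TZ i).
exists l => //; exists i; rewrite -[A](mulmxK uC) -/Z scalemxAl; congr (_ *m _).
clearbody Z; rewrite [Z]mx2P scale_mx2 -!P1Z !mulmx2E Zx Zy; congr mx2; ring.
Qed.

(** The matrix A_n of f^n intertwines B_i with P_i, a scalar multiple of B_i(M^n x) whose height is
    bounded independently of n. If B1 and B2 did not commute, [intertwiner_formula] would express
    A_n through P1 and P2 and bound its height. *)
Lemma cent0_lifts_commute f g1 g2 M A B1 B2 :
  is_jonq E f M A -> unbounded_growth E f ->
  is_jonq E g1 1%:M B1 -> commute g1 f -> is_jonq E g2 1%:M B2 -> commute g2 f ->
  B1 *m B2 = B2 *m B1.
Proof.
move=> jf uf j1 c1 j2 c2; apply: NNPP => nc.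
have nsc : ~ is_scalar_mx (mx2 (B1 ord0 ord0) (B1 ord0 ord_max) (B1 ord_max ord0) (B1 ord_max ord_max)).
  rewrite -mx2P => /is_scalar_mxP[c Ec]; apply: nc.
  by rewrite Ec mul_scalar_mx mul_mx_scalar.
have [x [y]] := mx2_cyclic_vector nsc.
set u := B1 ord_max ord0 * x + _; set v := _ * x + _ => D0.
(* The columns are a cyclic vector w and B1 w, so B1 becomes a companion matrix. *)
pose C := mx2 x v y u; have uC : C \in unitmx by rewrite unitmx2 mulrC [v * y]mulrC mulrC.
have EB : B1 *m C = C *m mx2 0 (- \det B1) 1 (\tr B1).
  rewrite /mxtrace !big_ord_recl big_ord0 addr0 det2.
  have -> : lift ord0 ord0 = ord_max :> 'I_2 by apply: val_inj.
  rewrite {1}[B1]mx2P /C !mx2_mul; congr mx2; rewrite /v /u; ring.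
pose w := invmx C *m (B2 *m C); pose a := w ord0 ord0; pose b := w ord_max ord0.
have Ew : B2 *m C = C *m w by rewrite mulKVmx.
have E0 : (B2 *m C) ord0 ord0 = a * C ord0 ord0 + b * C ord0 ord_max.
  by rewrite Ew mulmx2E /a /b; ring.
have E1 : (B2 *m C) ord_max ord0 = a * C ord_max ord0 + b * C ord_max ord_max.
  by rewrite Ew mulmx2E /a /b; ring.
have intw := intertwiner_formula nc uC EB E0 E1.
have [k [k0 kB1 kB2 [kd1 kd2] [ka kb]]] : exists k, [/\ (0 < k)%N, forall i j, ht_le k (B1 i j),
    forall i j, ht_le k (B2 i j), ht_le k (\det B1) /\ ht_le k (\det B2) &
    ht_le k a /\ ht_le k b].
  have bd (s : seq F) : exists k, forall z, z \in s -> ht_le k z.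
    elim: s => [|z s [k kP]]; first by exists 0%N.
    have [m hm] := ht_le_exists z; exists (k + m)%N => t; rewrite inE => /orP[/eqP->|/kP].
      by apply: ht_leW hm; rewrite leq_addl.
    by apply: ht_leW; rewrite leq_addr.
  have [k kP] := bd ([:: \det B1; \det B2; a; b] ++
    [seq B1 ij.1 ij.2 | ij <- enum [set: 'I_2 * 'I_2]] ++
    [seq B2 ij.1 ij.2 | ij <- enum [set: 'I_2 * 'I_2]]).
  exists k.+1; split=> // [i j|i j||].
  - apply: ht_leW (leqnSn k) (kP _ _); rewrite !mem_cat; apply/orP; right; apply/orP; left.
    by apply/mapP; exists (i, j); rewrite ?mem_enum ?inE.
  - apply: ht_leW (leqnSn k) (kP _ _); rewrite !mem_cat; apply/orP; right; apply/orP; right.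
    by apply/mapP; exists (i, j); rewrite ?mem_enum ?inE.
  - by split; apply: ht_leW (leqnSn k) (kP _ _); rewrite !inE eqxx ?orbT.
  by split; apply: ht_leW (leqnSn k) (kP _ _); rewrite !inE eqxx ?orbT.
have [mC hC] := height_le_exists (invmx C).
(* Heights: 3k for the P_i (2k for the scalar, k for B_i), 8k for T, hence 2 (3k + 8k) = 22k for the
   entries given by [intertwiner_formula]; 4 comes from [ht_le_mx], and mC accounts for the inverse
   of C. *)
have [n Hn] := uf (4 * (22 * k) + mC)%N.
have jfn : exists N A', is_jonq E (f ^+ n)%g N A'.
  elim: (n) => [|n' [N [A' j]]]; first by exists 1%:M, 1%:M; apply: is_jonq1.
  rewrite expgSr; exists (N *m M), ((A' ^^ M) *m A); exact: is_jonqM.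
have [N [A' jA']] := jfn; apply: (Hn _ _ jA').
have [uN uA' _] := jA'.
have phi g B : is_jonq E g 1%:M B -> commute g f -> (forall i j, ht_le k (B i j)) ->
    ht_le k (\det B) -> exists P, P *m A' = A' *m B /\ forall i j, ht_le (3 * k) (P i j).
  move=> jg cg kB kd; have uB : B \in unitmx by case: jg.
  have [c c0 Ec] := commute_base_id jA' jg (commuteX n cg).
  have dB0 : \det B != 0 by rewrite -unitfE -unitmxE.
  (* Determinants give c up to sign only, which is enough for its height. *)
  have Ec2 : c ^+ 2 = subst F N (\det B) * (\det B)^-1.
    have dA0 : \det A' != 0 by rewrite -unitfE -unitmxE.
    apply: (canRL (mulfK dB0)); apply: (mulIf dA0).
    have := congr1 determinant Ec; rewrite detZ !det_mulmx det_map_mx => ->; ring.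
  have hc : ht_le (2 * k) c.
    apply: ht_le_sqrt; rewrite Ec2 mul2n -addnn; apply: ht_leM (ht_leV k0 kd).
    exact: ht_le_subst.
  exists (c^-1 *: (B ^^ N)); split; first by rewrite -scalemxAl Ec scalerA mulVf // scale1r.
  move=> i j; rewrite !mxE -(addn1 2) mulnDl mul1n; apply: ht_leM; last exact: ht_le_subst.
  by apply: ht_leV; rewrite ?muln_gt0.
have [P1 [EP1 hP1]] := phi _ _ j1 c1 kB1 kd1; have [P2 [EP2 hP2]] := phi _ _ j2 c2 kB2 kd2.
have [l l0 [i ->]] := intw A' P1 P2 uA' EP1 EP2.
set T := P2 - _ - _.
have hT j : ht_le (8 * k) (T i j).
  rewrite /T !mxE; apply: (@ht_leW _ _ (3 * k + k + (k + 3 * k))%N); first by lia.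
  apply: ht_leD; last by apply/ht_leN/ht_leM.
  apply: ht_leD (hP2 _ _) _; apply: ht_leN; case: (_ == _); rewrite ?mulr1n ?mulr0n //.
  by rewrite -(rmorph0 emb); apply: ht_leW (ht_le_const _ _).
apply: height_le_scale => //; apply: height_leM => //.
have [|m [hm le_m]] := @ht_le_mx _ F (22 * k) (mx2 (- T i ord_max)
     (P1 ord0 ord0 * - T i ord_max + P1 ord0 ord_max * T i ord0)
     (T i ord0) (P1 ord_max ord0 * - T i ord_max + P1 ord_max ord_max * T i ord0)); last first.
  exact: height_leW le_m hm.
have hv p q : ht_le (22 * k) (P1 p ord0 * - T i ord_max + P1 p q * T i ord0).
  apply: (@ht_leW _ _ (3 * k + 8 * k + (3 * k + 8 * k))%N); first by lia.
  by apply: ht_leD; apply: ht_leM => //; apply: ht_leN.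
have hu j : ht_le (22 * k) (T i j) by apply: ht_leW (hT j); lia.
move=> p q; rewrite mxE; case: ifP => _; case: ifP => _ //; exact: ht_leN.
Qed.

End CentralizerOverBase.


Lemma commute_conjg (G : groupType) (f g h : G) : commute (g ^ h)%g f <-> commute g (f ^ h^-1)%g.
Proof.
have E : f = ((f ^ h^-1) ^ h)%g by rewrite conjgKV.
rewrite {1}E /commute -!conjMg; split=> [/conjg_inj|->] //.
Qed.

(** * The possible groups Cent_0(f) *)

Section Cent0Structure.
Variables (K : closedFieldType) (F : ratfun K) (E : ratfun F).
Local Notation emb := (rf_emb F).
Implicit Types (f g h : Cremona K) (M N : 'M[K]_2) (A B C : 'M[F]_2).

Definition cent0 f g := commute g f /\ exists B, is_jonq E g 1%:M B.

Lemma is_jonq_scalar g c : is_jonq E g 1%:M c%:M -> g = 1%g.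
Proof.
move=> jg; have c0 : c != 0.
  case: jg => _ uc _; apply: contraTneq uc => ->.
  by rewrite scalar_mx2 unitmx2 mul0r subrr eqxx.
have := is_jonq_scale (oner_neq0 K) (_ : c^-1 != 0) jg.
rewrite invr_eq0 scale1r scale_scalar_mx mulVf // => /(_ c0) j.
exact: is_jonq_inj j (is_jonq1 E).
Qed.

Lemma cent0M f g h : cent0 f g -> cent0 f h -> cent0 f (g * h)%g.
Proof.
move=> [cg [B jB]] [ch [C jC]]; split.
  by apply: commute_sym; apply: commuteM; apply: commute_sym.
by exists ((B ^^ 1%:M) *m C); have := is_jonqM jB jC; rewrite mul1mx.
Qed.

Lemma is_jonq_conj f h M A C : is_jonq E f M A -> is_jonq E h 1%:M C ->
  is_jonq E (f ^ h)%g M ((invmx C) ^^ M *m A *m C).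
Proof.
move=> jf jh; have := is_jonqM (is_jonqV jh) (is_jonqM jf jh).
by rewrite conjgE invmx1 mul1mx !mulmx1 !subst_mx1 mulmxA.
Qed.

Section Fixed.
Variables (f : Cremona K) (M : 'M[K]_2) (A : 'M[F]_2).
Hypotheses (jf : is_jonq E f M A) (uf : unbounded_growth E f).
Hypothesis fixM : forall z, subst F M z = z -> exists c, z = emb c.

Let uM : M \in unitmx. Proof. by case: jf. Qed.
Let uA : A \in unitmx. Proof. by case: jf. Qed.

Lemma const_mx_subst (J : 'M[K]_2) : (map_mx emb J) ^^ M = map_mx emb J.
Proof. by rewrite -map_mx_comp; apply: map_mx_eq => c; apply: subst_const. Qed.

Lemma ratio_const (u v c : F) : c != 0 -> v != 0 -> subst F M u = c * u -> subst F M v = c * v ->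
  exists t, u = emb t * v.
Proof.
move=> c0 v0 Eu Ev; have [|t Et] := @fixM (u / v).
  by rewrite fmorph_div Eu Ev -mulf_div divff // mul1r.
by exists t; rewrite -Et divfK.
Qed.

(** Comparing the traces of J and A^-1 J A shows that the scalar in the commutation relation is
    1. *)
Lemma commute_const_lift g (J : 'M[K]_2) : is_jonq E g 1%:M (map_mx emb J) -> commute g f ->
  \tr J != 0 -> map_mx emb J *m A = A *m map_mx emb J.
Proof.
move=> jg cg tJ; have [c c0] := commute_base_id jf jg cg; rewrite const_mx_subst => Ec.
have : \tr (map_mx emb J *m A *m invmx A) = c * \tr (map_mx emb J).
  by rewrite Ec -scalemxAl linearZ /= mxtrace_mulC mulKmx.
rewrite mulmxK // trace_map_mx => /eqP; rewrite -{1}[emb _]mul1r -subr_eq0 -mulrBl.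
by rewrite mulf_eq0 fmorph_eq0 (negPf tJ) orbF subr_eq0 Ec => /eqP <-; rewrite scale1r.
Qed.

(** One nonscalar constant diagonal lift forces A, and by [cent0_lifts_commute] every other lift B,
    to be diagonal. The quotient of the diagonal entries of B is then invariant by M, hence
    constant. *)
Lemma cent0_scaling g (r r' : K) : r != r' -> r + r' != 0 -> commute g f ->
  is_jonq E g 1%:M (map_mx emb (mx2 r 0 0 r')) ->
  forall k, cent0 f k <-> exists2 t, t != 0 & is_jonq E k 1%:M (mx2 (emb t) 0 0 1).
Proof.
move=> rr' r0 cg jg; have rF : emb r != emb r' by rewrite (inj_eq (fmorph_inj _)).
have diag (B : 'M[F]_2) : map_mx emb (mx2 r 0 0 r') *m B = B *m map_mx emb (mx2 r 0 0 r') ->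
    B = mx2 (B ord0 ord0) 0 0 (B ord_max ord_max).
  rewrite {1 2 3}[B]mx2P map_mx2 !mx2_mul !rmorph0 !mul0r !mulr0 !addr0 !add0r.
  move=> H; have [_ E1 E2 _] := mx2_inj H; congr mx2; apply/eqP.
    move/eqP: E1; rewrite mulrC -subr_eq0 -mulrBr mulf_eq0 subr_eq0 (negPf rF) orbF.
    by move/eqP->.
  move/eqP: E2; rewrite mulrC -subr_eq0 -mulrBr mulf_eq0 subr_eq0 [emb r' == _]eq_sym (negPf rF) orbF.
  by move/eqP->.
have EA : A = mx2 (A ord0 ord0) 0 0 (A ord_max ord_max).
  apply: diag; apply: commute_const_lift jg cg _.
  rewrite /mxtrace !big_ord_recl big_ord0 addr0.
  have -> : lift ord0 ord0 = ord_max :> 'I_2 by apply: val_inj.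
  by rewrite !mx2E.
have [a0 d0] : A ord0 ord0 != 0 /\ A ord_max ord_max != 0.
  have u2 := uA; rewrite EA unitmx2 mulr0 subr0 mulf_eq0 negb_or in u2.
  by case/andP: u2.
move=> k; split=> [[ck [B jB]]|[t t0 jk]].
  have EB := diag B (cent0_lifts_commute jf uf jg cg jB ck).
  have [b0 s0] : B ord0 ord0 != 0 /\ B ord_max ord_max != 0.
    have [_ uB _] := jB; rewrite EB unitmx2 mulr0 subr0 mulf_eq0 negb_or in uB.
    by case/andP: uB.
  have [c c0] := commute_base_id jf jB ck.
  rewrite EA EB map_mx2 !mx2_mul scale_mx2 !rmorph0 !mul0r !mulr0 !addr0 !add0r.
  move=> H; have [E1 _ _ E2] := mx2_inj H.
  have [||t Et] := @ratio_const (B ord0 ord0) (B ord_max ord_max) c c0 s0.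
  - by apply: (mulIf a0); rewrite E1; ring.
  - by apply: (mulIf d0); rewrite E2; ring.
  exists t; first by apply: contraNneq b0 => t0; rewrite Et t0 rmorph0 mul0r.
  have EBs : (B ord_max ord_max)^-1 *: B = mx2 (emb t) 0 0 1.
    by rewrite {2}EB scale_mx2 Et !mulr0 mulVf // mulrC mulfK.
  rewrite -EBs -[1%:M]scale1r; apply: is_jonq_scale jB; rewrite ?oner_eq0 ?invr_eq0 //.
split; last by exists (mx2 (emb t) 0 0 1).
apply: (commute_is_jonq jf jk (oner_neq0 K) (oner_neq0 F)).
  by rewrite mul1mx mulmx1 scale1r.
rewrite scale1r subst_mx1 EA map_mx2 !mx2_mul subst_const // rmorph1 rmorph0.
by rewrite !mul0r !mulr0 !addr0 !add0r mulrC !mulr1 mul1r.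
Qed.

Lemma cent0_translation g (r : K) : r + r != 0 -> commute g f ->
  is_jonq E g 1%:M (map_mx emb (mx2 r 1 0 r)) ->
  forall k, cent0 f k <-> exists t, is_jonq E k 1%:M (mx2 1 (emb t) 0 1).
Proof.
move=> r0 cg jg.
have triang (B : 'M[F]_2) : map_mx emb (mx2 r 1 0 r) *m B = B *m map_mx emb (mx2 r 1 0 r) ->
    B = mx2 (B ord0 ord0) (B ord0 ord_max) 0 (B ord0 ord0).
  rewrite {1 2 3}[B]mx2P map_mx2 !mx2_mul rmorph1 !rmorph0 !mul0r !mulr0 !addr0 !add0r !mul1r !mulr1.
  move=> H; have [E0 E1 _ _] := mx2_inj H; congr mx2; apply/eqP.
    by move/eqP: E0; rewrite mulrC -subr_eq0 addrAC subrr add0r.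
  by move/eqP: E1; rewrite [emb r * _]mulrC addrC -subr_eq0 opprD addrACA subrr addr0 subr_eq0.
have EA : A = mx2 (A ord0 ord0) (A ord0 ord_max) 0 (A ord0 ord0).
  apply: triang; apply: commute_const_lift jg cg _.
  rewrite /mxtrace !big_ord_recl big_ord0 addr0.
  have -> : lift ord0 ord0 = ord_max :> 'I_2 by apply: val_inj.
  by rewrite !mx2E.
have a0 : A ord0 ord0 != 0.
  have u2 := uA; rewrite EA unitmx2 mulr0 subr0 mulf_eq0 negb_or in u2.
  by case/andP: u2.
move=> k; split=> [[ck [B jB]]|[t jk]].
  have EB := triang B (cent0_lifts_commute jf uf jg cg jB ck).
  have b0 : B ord0 ord0 != 0.
    have [_ uB _] := jB; rewrite EB unitmx2 mulr0 subr0 mulf_eq0 negb_or in uB.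
    by case/andP: uB.
  have [c c0] := commute_base_id jf jB ck.
  rewrite EA EB map_mx2 !mx2_mul scale_mx2 !rmorph0 !mul0r !mulr0 !addr0 !add0r.
  move=> H; have [E1 E2 _ _] := mx2_inj H.
  have Eb : subst F M (B ord0 ord0) = c * B ord0 ord0 by apply: (mulIf a0); rewrite E1; ring.
  have [|t Et] := @ratio_const (B ord0 ord_max) (B ord0 ord0) c c0 b0 _ Eb.
    apply: (mulIf a0); apply: (addrI (subst F M (B ord0 ord0) * A ord0 ord_max)).
    by rewrite E2 Eb; ring.
  exists t; have EBs : (B ord0 ord0)^-1 *: B = mx2 1 (emb t) 0 1.
    by rewrite {2}EB scale_mx2 Et !mulr0 mulVf // [_ * (_ * _)]mulrC mulfK.
  rewrite -EBs -[1%:M]scale1r; apply: is_jonq_scale jB; rewrite ?oner_eq0 ?invr_eq0 //.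
split; last by exists (mx2 1 (emb t) 0 1).
apply: (commute_is_jonq jf jk (oner_neq0 K) (oner_neq0 F)).
  by rewrite mul1mx mulmx1 scale1r.
rewrite scale1r subst_mx1 EA map_mx2 !mx2_mul subst_const // rmorph1 rmorph0.
by congr mx2; ring.
Qed.

End Fixed.

Lemma mx2_traceless_sqr (L : fieldType) (B : 'M[L]_2) : \tr B = 0 -> B *m B = (- \det B)%:M.
Proof.
rewrite /mxtrace !big_ord_recl big_ord0 addr0 det2.
have -> : lift ord0 ord0 = ord_max :> 'I_2 by apply: val_inj.
move/eqP; rewrite addr_eq0 => /eqP E0.
by rewrite {1 2}[B]mx2P mx2_mul scalar_mx2 E0; congr mx2; ring.
Qed.

Lemma mx2_traceless_anticommute (L : fieldType) (B C : 'M[L]_2) :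
  \tr B = 0 -> \tr C = 0 -> \tr (B *m C) = 0 -> B *m C = - (C *m B).
Proof.
rewrite /mxtrace !big_ord_recl !big_ord0 !addr0.
have -> : lift ord0 ord0 = ord_max :> 'I_2 by apply: val_inj.
move=> /eqP; rewrite addr_eq0 => /eqP EB /eqP; rewrite addr_eq0 => /eqP EC.
rewrite !mulmx2E EB EC => E0; apply/eqP; rewrite -subr_eq0 opprK; apply/eqP.
apply: mx2_eq; rewrite [LHS]mxE [RHS]mxE !mulmx2E ?EB ?EC; try ring.
  by rewrite -[RHS]E0; ring.
by rewrite -[RHS]E0; ring.
Qed.

Lemma cent0_structure f M A : is_jonq E f M A -> unbounded_growth E f ->
  (forall z, subst F M z = z -> exists c, z = emb c) ->
  (exists2 g, cent0 f g & g <> 1%g) ->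
  (exists2 h, (exists C, is_jonq E h 1%:M C) & forall g, cent0 f (g ^ h)%g <->
     exists2 t, t != 0 & is_jonq E g 1%:M (mx2 (emb t) 0 0 1)) \/
  (exists2 h, (exists C, is_jonq E h 1%:M C) & forall g, cent0 f (g ^ h)%g <->
     exists t, is_jonq E g 1%:M (mx2 1 (emb t) 0 1)) \/
  ((forall g, cent0 f g -> (g * g = 1)%g) /\
   (2%:R != 0 :> K -> exists2 s, s <> 1%g & forall g, cent0 f g <-> g = 1%g \/ g = s)).
Proof.
move=> jf uf fixM [g0 cent_g0 g01]; have [uM uA _] := jf.
have [[g [B [cg jB nsc tB]]]|none] := classic (exists g B,
    [/\ commute g f, is_jonq E g 1%:M B, ~ is_scalar_mx B & \tr B != 0]).
  (* Trace 1 removes the ambiguity of the lift: the scalar between B(M x) and A B A^-1 must be 1, so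
     det B is invariant by M. *)
  have {jB} jB : is_jonq E g 1%:M ((\tr B)^-1 *: B).
    by have := is_jonq_scale (oner_neq0 K) (_ : (\tr B)^-1 != 0) jB;
      rewrite scale1r invr_eq0; apply.
  have {nsc} nsc : ~ is_scalar_mx ((\tr B)^-1 *: B).
    move=> /is_scalar_mxP[c Ec]; apply: nsc; apply/is_scalar_mxP; exists (\tr B * c).
    by rewrite -[B in LHS]scale1r -(mulfV tB) -scalerA Ec -mul_scalar_mx -scalar_mxM.
  have {tB} : \tr ((\tr B)^-1 *: B) = 1 by rewrite linearZ /= mulVf.
  move: ((\tr B)^-1 *: B) jB nsc => {}B jB nsc tB.
  have [c c0 Ec] := commute_base_id jf jB cg.
  have {}Ec : B ^^ M = c *: (A *m B *m invmx A) by rewrite scalemxAl -Ec mulmxK.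
  have c1 : c = 1.
    have := congr1 mxtrace Ec; rewrite linearZ /= mxtrace_mulC mulKmx // trace_map_mx tB.
    by rewrite rmorph1 mulr1.
  have [k Ek] : exists k, \det B = emb k.
    apply: fixM; rewrite -det_map_mx Ec c1 scale1r !det_mulmx det_inv mulrAC mulfV ?mul1r //.
    by rewrite -unitfE -unitmxE.
  (* A root of the characteristic polynomial X^2 - X + k; the other root is 1 - r. *)
  have [r Er] := @solve_monicpoly K 2 (fun i => if i == 0%N then - k else 1) isT.
  rewrite !big_ord_recl big_ord0 /= expr0 expr1 mulr1 mul1r addr0 in Er.
  have [||C uC EC] := @mx2_diagonal_or_jordan F B (emb r) (emb (1 - r)) _ _ nsc.
  - by rewrite -rmorphD addrC subrK rmorph1 tB.
  - by rewrite Ek -rmorphM mulrBr mulr1 -expr2 Er opprD opprK addrCA subrr addr0.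
  have [h jh] := @exists_jonq K F E 1%:M C (unitmx1 _ _) uC.
  have jfh := is_jonq_conj jf jh; have ufh := unbounded_growth_conj jh uf.
  have jgh := is_jonq_conj jB jh.
  have cgh : commute (g ^ h)%g (f ^ h)%g by rewrite /commute -!conjMg cg.
  have jV : exists C', is_jonq E h^-1%g 1%:M C'.
    by eexists; have := is_jonqV jh; rewrite invmx1; apply.
  have centE k' : cent0 f (k' ^ h^-1)%g <-> cent0 (f ^ h)%g k'.
    rewrite /cent0 commute_conjg invgK; split=> -[ck [B' jB']]; split=> //.
      by have := is_jonq_conj jB' jh; rewrite -conjgM mulVg conjg1; eexists; eassumption.
    by have [C' jC'] := jV; eexists; apply: is_jonq_conj jB' jC'.
  have {}jgh : is_jonq E (g ^ h)%g 1%:M (if emb r == emb (1 - r)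
        then mx2 (emb r) 1 0 (emb r) else mx2 (emb r) 0 0 (emb (1 - r))).
    by move: jgh; rewrite subst_mx1 -mulmxA EC mulKmx.
  have r1 : r + (1 - r) != 0 by rewrite addrC subrK oner_eq0.
  case: eqP jgh => [/fmorph_inj Err|/eqP nrr] jgh; [right; left | left]; exists h^-1%g => //.
    move=> k'; rewrite centE; apply: (@cent0_translation _ M _ jfh ufh fixM (g ^ h)%g r) => //.
      by rewrite {2}Err.
    by rewrite map_mx2 (rmorph1 emb) (rmorph0 emb).
  move=> k'; rewrite centE; apply: (@cent0_scaling _ M _ jfh ufh fixM (g ^ h)%g r (1 - r)) => //.
    by apply: contraNneq nrr => {1}->.
  by rewrite map_mx2 rmorph0.
(* From here on every nontrivial element has a traceless lift, whose square is scalar. *)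
right; right.
have tr0 g B : commute g f -> is_jonq E g 1%:M B -> g <> 1%g -> \tr B = 0 /\ ~ is_scalar_mx B.
  move=> cg jB g1; have nsc : ~ is_scalar_mx B.
    by move=> /is_scalar_mxP[c Ec]; apply: g1; rewrite Ec in jB; apply: is_jonq_scalar jB.
  split=> //; apply/eqP/negPn/negP => tB; apply: none; by exists g, B.
have invol g : cent0 f g -> (g * g = 1)%g.
  move=> [cg [B jB]]; have [->|g1] := classic (g = 1%g); first by rewrite mulg1.
  have [tB _] := tr0 g B cg jB g1; have := is_jonqM jB jB.
  by rewrite mulmx1 subst_mx1 mx2_traceless_sqr //; apply: is_jonq_scalar.
split=> // two; exists g0 => // g; split=> [cent_g|[->|->//]]; last first.
  split; first exact/commute_sym/commute1.
  by exists 1%:M; apply: is_jonq1.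
apply: NNPP => /not_or_and[g1 gg0].
have [[cg [B jB]] [cg0 [B0 jB0]]] := (cent_g, cent_g0).
have [cgg0 _] := cent0M cent_g cent_g0.
have jBB0 := is_jonqM jB jB0; rewrite mulmx1 subst_mx1 in jBB0.
have gg01 : (g * g0)%g <> 1%g.
  move=> H; apply: gg0; have := invol _ cent_g0; rewrite -{1}H => /mulIg.
  by move=> <-.
have [tB _] := tr0 _ _ cg jB g1; have [tB0 _] := tr0 _ _ cg0 jB0 g01.
(* The product is again a nontrivial element of the group, so its lift is traceless too, and three
   vanishing traces give anticommutation. *)
have [tBB0 _] := tr0 _ _ cgg0 jBB0 gg01.
have anti := mx2_traceless_anticommute tB tB0 tBB0.
have comm := cent0_lifts_commute jf uf jB cg jB0 cg0.
have uBB0 : B *m B0 \in unitmx by case: jBB0.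
have : 2%:R *: (B *m B0) = 0 by rewrite scaler_nat mulr2n {1}anti -comm addNr.
move/eqP; rewrite scaler_eq0 -(rmorph_nat emb) fmorph_eq0 (negPf two) /= => /eqP E0.
by move: uBB0; rewrite E0 unitmxE unitfE det2 !mxE mul0r subrr eqxx.
Qed.

End Cent0Structure.


(** * Invariance of the fibration under the centralizer *)

Lemma closed_field_fresh (K : closedFieldType) (s : seq K) : exists c, c \notin s.
Proof.
have /closed_nonrootP[c] : \prod_(a <- s) ('X - a%:P) != 0.
  exact/monic_neq0/monic_prod_XsubC.
by rewrite root_prod_XsubC; exists c.
Qed.

Lemma ratfun_nonroot (K : closedFieldType) (F : fieldType) (j : {rmorphism K -> F})
    (d : {poly F}) (s : seq K) :
  d != 0 -> exists c, c \notin s /\ d.[j c] != 0.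
Proof.
move=> d0; apply: NNPP => none.
have all_root c : c \notin s -> root d (j c).
  by move=> cs; apply/negPn/negP => nr; apply: none; exists c.
have [t [ut szt dt]] : exists t : seq K, [/\ uniq t, size t = size d & all (fun c => c \notin s) t].
  elim: (size d) => [|n [t [ut szt dt]]]; first by exists [::].
  have [c] := closed_field_fresh (s ++ t); rewrite mem_cat negb_or => /andP[cs ct].
  by exists (c :: t); rewrite /= ct cs ut szt dt.
have := max_poly_roots d0 (_ : all (root d) (map j t)) (_ : uniq (map j t)).
rewrite size_map szt ltnn => H; suff : false by []; apply: H.
  by apply/allP => _ /mapP[c ct ->]; apply/all_root/(allP dt).
by rewrite map_inj_uniq //; apply: fmorph_inj.
Qed.

(** * Zeros of binary forms of bounded height *)

Section BoundedForms.
Variables (K : closedFieldType) (F : ratfun K).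
Local Notation ev := (@rf_eval K F).

Lemma common_denominator (c : nat -> F) m e : (forall i, (i <= e)%N -> ht_le m (c i)) ->
  exists (D : {poly K}) (c' : nat -> {poly K}), D != 0 /\
    forall i, (i <= e)%N -> c i = ev (c' i) / ev D /\ (size (c' i) <= e.+1 * m)%N.
Proof.
suff : (forall i, (i <= e)%N -> ht_le m (c i)) -> exists (D : {poly K}) (c' : nat -> {poly K}),
    [/\ D != 0, (size D <= e.+1 * m)%N &
    forall i, (i <= e)%N -> c i = ev (c' i) / ev D /\ (size (c' i) <= e.+1 * m)%N].
  by move=> H /H[D [c' [D0 _ H']]]; exists D, c'.
elim: e => [|e IHe] cm.
  have [p [q [q0 Ec sp sq]]] := cm 0%N (leqnn _).
  exists q, (fun _ => p); rewrite mul1n; split=> // i.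
  by rewrite leqn0 => /eqP ->.
have [|D [c' [D0 sD c'P]]] := IHe; first by move=> i ie; apply/cm/leqW.
have [p [q [q0 Ec sp sq]]] := cm e.+1 (leqnn _).
exists (D * q), (fun i => if i == e.+1 then D * p else c' i * q).
have sE : (e.+2 * m = e.+1 * m + m)%N by rewrite mulSn addnC.
split; [exact: mulf_neq0 | by rewrite sE; apply: size_mul_bound |].
have D0' : ev D != 0 by rewrite rf_eval_neq0.
have q0' : ev q != 0 by rewrite rf_eval_neq0.
move=> i; rewrite leq_eqVlt; case: eqP => [-> _|_ /= ie].
  by rewrite sE !rmorphM /= Ec -mulf_div divff // mul1r; split=> //; apply: size_mul_bound.
have [Ei si] := c'P i ie.
by rewrite sE !rmorphM /= Ei -mulf_div divff // mulr1; split=> //; apply: size_mul_bound.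
Qed.

(** A common denominator of the e + 1 coefficients costs a factor e + 1; the rational root theorem
    then bounds the coprime coordinates of the zero. The final + 1 leaves room for the zero (1 :
    0). *)
Lemma form_zero_height (c : nat -> F) (p q : F) m e :
  (forall i, (i <= e)%N -> ht_le m (c i)) -> (exists2 i, (i <= e)%N & c i != 0) ->
  (p != 0) || (q != 0) -> \sum_(i < e.+1) c i * p ^+ i * q ^+ (e - i) = 0 ->
  exists (l : F) (P Q : {poly K}), [/\ l != 0, p = l * ev P, q = l * ev Q,
    (size P <= (e.+1 * m).+1)%N & (size Q <= (e.+1 * m).+1)%N].
Proof.
move=> cm [i0 i0e ci0] pq S0; have [q0|q0] := eqVneq q 0.
  have p0 : p != 0 by move: pq; rewrite q0 eqxx orbF.
  exists p, 1, 0; rewrite rmorph1 rmorph0 mulr1 mulr0 size_poly1 size_poly0; by split.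
have [P [Q [Q0 PQ Epq]]] := rf_coprime (p / q).
have Q0' : ev Q != 0 by rewrite rf_eval_neq0.
have [l [l0 Ep Eq]] : exists l, [/\ l != 0, p = l * ev P & q = l * ev Q].
  exists (q / ev Q); rewrite mulf_neq0 ?invr_eq0 // divfK //; split=> //.
  by rewrite mulrAC -mulrA -Epq mulrCA divff ?mulr1.
have [D [c' [D0 c'P]]] := common_denominator cm.
have D0' : ev D != 0 by rewrite rf_eval_neq0.
have S1 : \sum_(i < e.+1) c' i * P ^+ i * Q ^+ (e - i) = 0.
  apply: (@rf_eval_inj _ F); rewrite rmorph0 rmorph_sum /=.
  apply: (mulfI (mulf_neq0 (expf_neq0 e l0) (_ : (ev D)^-1 != 0))); first by rewrite invr_eq0.
  rewrite mulr0 mulr_sumr -[RHS]S0; apply: eq_bigr => i _.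
  have ie : (i <= e)%N by rewrite -ltnS.
  have [-> _] := c'P i ie; rewrite !rmorphM !rmorphXn /= Eq Ep !exprMn.
  by rewrite -{1}(subnKC ie) exprD; ring.
have [||sP sQ] := size_root_coprime (m := e.+1 * m) PQ S1.
- exists i0 => //; apply: contraNneq ci0 => c0; have [-> _] := c'P i0 i0e.
  by rewrite c0 rmorph0 mul0r.
- by move=> i ie; have [] := c'P i ie.
by exists l, P, Q; split=> //; apply: leqW.
Qed.

(* A homography is determined by the images of three points. *)
Lemma height_three_points (C : 'M[F]_2) (c : 'I_3 -> K) B : injective c -> C \in unitmx ->
  (forall i, exists (l : F) (P Q : {poly K}), [/\ l != 0,
     C ord0 ord0 * rf_emb F (c i) + C ord0 ord_max = l * ev P,
     C ord_max ord0 * rf_emb F (c i) + C ord_max ord_max = l * ev Q,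
     (size P <= B)%N & (size Q <= B)%N]) ->
  height_le (B + B + B + 2) C.
Proof.
move=> cinj uC H.
have [l1 [P1 [Q1 [l10 EP1 EQ1 sP1 sQ1]]]] := H ord0.
have [l2 [P2 [Q2 [l20 EP2 EQ2 sP2 sQ2]]]] := H (inord 1).
have [l3 [P3 [Q3 [l30 EP3 EQ3 sP3 sQ3]]]] := H ord_max.
have d12 : c ord0 - c (inord 1) != 0.
  by rewrite subr_eq0 (inj_eq cinj) -val_eqE /= inordK.
have d13 : c ord0 - c ord_max != 0 by rewrite subr_eq0 (inj_eq cinj) -val_eqE.
have d23 : c (inord 1) - c ord_max != 0.
  by rewrite subr_eq0 (inj_eq cinj) -val_eqE /= inordK.
move: (c ord0) (c (inord 1)) (c ord_max) d12 d13 d23 EP1 EQ1 EP2 EQ2 EP3 EQ3 => a b d.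
move=> dab dad dbd.
have: \det C != 0 by rewrite -unitfE -unitmxE.
rewrite [C]mx2P det_mx2; move: (C ord0 ord0) (C ord0 ord_max) (C ord_max ord0) (C ord_max ord_max) => C0 C1 C2 C3.
rewrite !mx2E => detC EP1 EQ1 EP2 EQ2 EP3 EQ3.
set emb := rf_emb F in EP1 EQ1 EP2 EQ2 EP3 EQ3 *.
have na : emb (a - b) != 0 by rewrite fmorph_eq0.
have nb : emb (a - d) != 0 by rewrite fmorph_eq0.
have nd : emb (b - d) != 0 by rewrite fmorph_eq0.
(* [W i j] is the determinant of the images of the points [i] and [j]. *)
pose W12 := ev P1 * ev Q2 - ev P2 * ev Q1; pose W13 := ev P1 * ev Q3 - ev P3 * ev Q1.
pose W23 := ev P2 * ev Q3 - ev P3 * ev Q2.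
have E12 : l1 * l2 * W12 = emb (a - b) * (C0 * C3 - C1 * C2).
  transitivity ((l1 * ev P1) * (l2 * ev Q2) - (l2 * ev P2) * (l1 * ev Q1)); first by rewrite /W12; ring.
  by rewrite -EP1 -EQ1 -EP2 -EQ2 rmorphB; ring.
have E13 : l1 * l3 * W13 = emb (a - d) * (C0 * C3 - C1 * C2).
  transitivity ((l1 * ev P1) * (l3 * ev Q3) - (l3 * ev P3) * (l1 * ev Q1)); first by rewrite /W13; ring.
  by rewrite -EP1 -EQ1 -EP3 -EQ3 rmorphB; ring.
have E23 : l2 * l3 * W23 = emb (b - d) * (C0 * C3 - C1 * C2).
  transitivity ((l2 * ev P2) * (l3 * ev Q3) - (l3 * ev P3) * (l2 * ev Q2)); first by rewrite /W23; ring.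
  by rewrite -EP2 -EQ2 -EP3 -EQ3 rmorphB; ring.
have W120 : W12 != 0.
  apply: contraNneq detC => W0; move/eqP: E12; rewrite W0 mulr0 eq_sym mulf_eq0 (negPf na).
  exact: id.
pose W13p := P1 * Q3 - P3 * Q1; pose W23p := P2 * Q3 - P3 * Q2.
have W13E : W13 = ev W13p by rewrite /W13 /W13p rmorphB !rmorphM.
have W23E : W23 = ev W23p by rewrite /W23 /W23p rmorphB !rmorphM.
(* [l1 : l2 = (a - d) W23 : (b - d) W13] *)
have ratio : l1 * (emb (b - d) * W13) = l2 * (emb (a - d) * W23).
  apply: (mulfI l30); transitivity (emb (b - d) * (l1 * l3 * W13)); first by ring.
  by rewrite E13; transitivity (emb (a - d) * (l2 * l3 * W23)); [rewrite E23|]; ring.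
have W13n : W13 != 0.
  apply: contraNneq detC => W0; move/eqP: E13; rewrite W0 mulr0 eq_sym mulf_eq0 (negPf nb).
  exact: id.
have W23n : W23 != 0.
  apply: contraNneq detC => W0; move/eqP: E23; rewrite W0 mulr0 eq_sym mulf_eq0 (negPf nd).
  exact: id.
pose L := l1 / (emb (a - d) * W23).
have El1 : l1 = L * (emb (a - d) * W23) by rewrite divfK ?mulf_neq0.
have El2 : l2 = L * (emb (b - d) * W13).
  by apply: (mulIf (mulf_neq0 nb W23n)); rewrite -ratio [RHS]mulrAC -El1.
have L0 : L != 0 by rewrite mulf_neq0 ?invr_eq0 ?mulf_neq0.
(* This is (a - b) C / L, obtained by linear interpolation from the images of a and b, once l1 and
   l2 are written in terms of L. *)
exists (mx2 ((a - d)%:P * W23p * P1 - (b - d)%:P * W13p * P2)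
            (a%:P * ((b - d)%:P * W13p * P2) - b%:P * ((a - d)%:P * W23p * P1))
            ((a - d)%:P * W23p * Q1 - (b - d)%:P * W13p * Q2)
            (a%:P * ((b - d)%:P * W13p * Q2) - b%:P * ((a - d)%:P * W23p * Q1))), (L / emb (a - b)).
have key u w : w * emb (a - b) = L * u -> w = L / emb (a - b) * u.
  by move=> Hw; apply: (mulIf na); rewrite [RHS]mulrAC divfK.
split.
- by rewrite mulf_neq0 ?invr_eq0.
- have F1 : L * (emb (a - d) * W23 * ev P1) = C0 * emb a + C1 by rewrite EP1 El1; ring.
  have F2 : L * (emb (b - d) * W13 * ev P2) = C0 * emb b + C1 by rewrite EP2 El2; ring.
  have F3 : L * (emb (a - d) * W23 * ev Q1) = C2 * emb a + C3 by rewrite EQ1 El1; ring.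
  have F4 : L * (emb (b - d) * W13 * ev Q2) = C2 * emb b + C3 by rewrite EQ2 El2; ring.
  have ev3 u p q : ev (u%:P * p * q) = emb u * ev p * ev q by rewrite !rmorphM /= rf_evalC.
  have ev4 u p : ev (u%:P * p) = emb u * ev p by rewrite rmorphM /= rf_evalC.
  rewrite /poly_mx map_mx2 scale_mx2; congr mx2; apply: key.
  + by rewrite [ev _]rmorphB /= !ev3 -W13E -W23E mulrBr F1 F2 rmorphB; ring.
  + rewrite [ev _]rmorphB /= !ev4 !ev3 -W13E -W23E mulrBr mulrCA F2 mulrCA F1 rmorphB; ring.
  + by rewrite [ev _]rmorphB /= !ev3 -W13E -W23E mulrBr F3 F4 rmorphB; ring.
  + rewrite [ev _]rmorphB /= !ev4 !ev3 -W13E -W23E mulrBr mulrCA F4 mulrCA F3 rmorphB; ring.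
(* A constant factor counts for 1 in [size_mul_bound]: the entries involve a factor of size 2B, one
   of size B and at most two constants, whence 3B + 2. *)
have sC (u : K) : (size u%:P <= 1)%N := size_polyC_leq1 u.
have sW (p q r t : {poly K}) : (size p <= B)%N -> (size q <= B)%N -> (size r <= B)%N -> (size t <= B)%N ->
    (size (p * q - r * t)%R <= B + B)%N.
  by move=> *; apply: size_add_bound; rewrite ?size_polyN; apply: size_mul_bound.
have s3 (u : K) (p q : {poly K}) : (size p <= B + B)%N -> (size q <= B)%N ->
    (size (u%:P * p * q)%R <= B + B + B + 1)%N.
  move=> sp sq; rewrite -[(B + B + B + 1)%N]/(B + B + B + 1)%N addnAC.
  by apply: size_mul_bound => //; rewrite addnC; apply: size_mul_bound.
have s4 (u v : K) (p q p' q' : {poly K}) : (size p <= B + B)%N -> (size q <= B)%N ->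
    (size p' <= B + B)%N -> (size q' <= B)%N ->
    (size (u%:P * p * q - v%:P * p' * q')%R <= B + B + B + 2)%N.
  move=> *; apply: (@leq_trans (B + B + B + 1)%N); last by rewrite leq_add2l.
  by apply: size_add_bound; rewrite ?size_polyN; apply: s3.
have s5 (w w' u v : K) (p q p' q' : {poly K}) : (size p <= B + B)%N -> (size q <= B)%N ->
    (size p' <= B + B)%N -> (size q' <= B)%N ->
    (size (w%:P * (u%:P * p * q) - w'%:P * (v%:P * p' * q'))%R <= B + B + B + 2)%N.
  move=> *; have -> : (B + B + B + 2 = 1 + (B + B + B + 1))%N by rewrite add1n addn1 addn2.
  by apply: size_add_bound; rewrite ?size_polyN; apply: size_mul_bound => //; apply: s3.
have h13 : (size W13p <= B + B)%N by apply: sW.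
have h23 : (size W23p <= B + B)%N by apply: sW.
by move=> i j; rewrite mxE; case: ifP => _; case: ifP => _; first [exact: s4 | exact: s5].
Qed.

End BoundedForms.


(** * Semi-invariant functions depend on x only *)

Section InvariantFibrations.
Variables (K : closedFieldType) (F : ratfun K) (E : ratfun F).
Local Notation emb := (rf_emb F).
Local Notation Y := (rf_gen E).
Implicit Types (f g : Cremona K).

Lemma ht_le_seq (s : seq F) : exists k, forall z, z \in s -> ht_le k z.
Proof.
elim: s => [|z s [k kP]]; first by exists 0%N.
have [m hm] := ht_le_exists z; exists (k + m)%N => t; rewrite inE => /orP[/eqP->|/kP].
  by apply: ht_leW hm; rewrite leq_addl.
by apply: ht_leW; rewrite leq_addr.
Qed.

Lemma jonq_powers f s a b A (h : E) : is_jonq E f (aff a b) A ->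
  jonq_morph s (aff a b) A -> s h = const E a * h + const E b ->
  forall k, exists a' b' A' t, [/\ is_jonq E (f ^+ k)%g (aff a' b') A',
    jonq_morph t (aff a' b') A' & t h = const E a' * h + const E b'].
Proof.
move=> jf sP sh; have [uM uA _] := jf.
have sK := jonq_morph_fixes uM sP.
elim=> [|k [a' [b' [A' [t [jk tP th]]]]]].
  exists 1, 0, 1%:M, idfun; have -> : aff 1 0 = 1%:M :> 'M[K]_2 by rewrite scalar_mx2.
  split; first exact: is_jonq1.
    by split=> [z|] /=; rewrite ?subst1 ?map_mx1 ?homography1.
  by rewrite rmorph1 rmorph0 mul1r addr0.
have [uM' uA' _] := jk.
exists (a' * a), (a' * b + b'), ((A' ^^ aff a b) *m A), (s \o t).
have -> : aff (a' * a) (a' * b + b') = aff a' b' *m aff a b.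
  by rewrite mx2_mul /aff; congr mx2; ring.
rewrite expgSr; split; first exact: is_jonqM.
  exact: jonq_morph_comp.
by rewrite /= th rmorphD rmorphM !sK sh !(rmorphD, rmorphM) /=; ring.
Qed.

(** For h = n/d, clearing denominators in t h = a h + b gives a polynomial identity in y. At y = x
    it says that the vector A (x, 1) is a zero of a binary form of degree e whose coefficients do
    not involve A. *)
Lemma pullback_relation a b A t (n d : {poly F}) e :
  aff a b \in unitmx -> A \in unitmx -> jonq_morph t (aff a b) A ->
  (size n <= e.+1)%N -> (size d <= e.+1)%N -> d != 0 ->
  t (rf_eval E n / rf_eval E d) = const E a * (rf_eval E n / rf_eval E d) + const E b ->
  forall x, \sum_(i < e.+1) (d.[x] * subst F (aff a b) n`_i -
      (emb a * n.[x] + emb b * d.[x]) * subst F (aff a b) d`_i) *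
    (A ord0 ord0 * x + A ord0 ord_max) ^+ i *
    (A ord_max ord0 * x + A ord_max ord_max) ^+ (e - i) = 0.
Proof.
move=> uM uA [tF tY] sn sd d0 tnd x; set mu := subst F (aff a b).
pose j : {rmorphism F -> E} := rf_emb E \o mu.
have tev (p : {poly F}) : t (rf_eval E p) = (map_poly j p).[t Y].
  rewrite /rf_eval -horner_map -map_poly_comp; congr _.[_].
  by apply: eq_map_poly => c /=; rewrite tF.
pose p := (A ord0 ord0)%:P * 'X + (A ord0 ord_max)%:P.
pose q := (A ord_max ord0)%:P * 'X + (A ord_max ord_max)%:P.
have evlin (u v : F) : rf_eval E (u%:P * 'X + v%:P) = rf_emb E u * Y + rf_emb E v.
  by rewrite rmorphD rmorphM /= !rf_evalC rf_evalX.
have q0 : rf_eval E q != 0 by rewrite evlin homography_den_neq0.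
have tYE : t Y = rf_eval E p / rf_eval E q by rewrite tY /homography !mxE !evlin.
have d0' : rf_eval E d != 0 by rewrite rf_eval_neq0.
have td0 : t (rf_eval E d) != 0 by rewrite fmorph_eq0.
have Enum : t (rf_eval E n) * rf_eval E d =
    (const E a * rf_eval E n + const E b * rf_eval E d) * t (rf_eval E d).
  apply: (mulIf (mulf_neq0 d0' (invr_neq0 td0))).
  move: tnd; rewrite fmorph_div => /(congr1 (fun z => z * (rf_eval E d * rf_eval E d))) H.
  transitivity (t (rf_eval E n) / t (rf_eval E d) * (rf_eval E d * rf_eval E d)); first by ring.
  by rewrite H; field; rewrite d0' td0.
have Hn := horner_div j (rf_eval E p) q0 sn; have Hd := horner_div j (rf_eval E p) q0 sd.
rewrite -tYE -tev in Hn; rewrite -tYE -tev in Hd.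
have poly_eq : (\sum_(i < e.+1) (mu n`_i)%:P * p ^+ i * q ^+ (e - i)) * d =
    ((emb a)%:P * n + (emb b)%:P * d) * \sum_(i < e.+1) (mu d`_i)%:P * p ^+ i * q ^+ (e - i).
  have evsum (u : {poly F}) : rf_eval E (\sum_(i < e.+1) (mu u`_i)%:P * p ^+ i * q ^+ (e - i)) =
      \sum_(i < e.+1) j u`_i * rf_eval E p ^+ i * rf_eval E q ^+ (e - i).
    by rewrite rmorph_sum; apply: eq_bigr => i _; rewrite !rmorphM !rmorphXn /= rf_evalC.
  apply: (@rf_eval_inj _ E); rewrite !rmorphM rmorphD !rmorphM /= !evsum -Hn -Hd !rf_evalC.
  by rewrite -mulrA Enum /const; ring.
have := congr1 (fun u : {poly F} => u.[x]) poly_eq.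
rewrite !hornerM hornerD !hornerM !horner_sum !hornerC => H.
rewrite -[RHS](subrr ((emb a * n.[x] + emb b * d.[x]) *
  \sum_(i < e.+1) ((mu d`_i)%:P * p ^+ i * q ^+ (e - i)).[x])) -{1}H.
rewrite mulr_suml mulr_sumr -sumrB; apply: eq_bigr => i _.
by rewrite !hornerM !horner_exp !hornerD !hornerM !hornerC !hornerX; ring.
Qed.

Lemma semi_invariant_base f a b A s (h : E) : is_jonq E f (aff a b) A -> unbounded_growth E f ->
  jonq_morph s (aff a b) A -> s h = const E a * h + const E b -> exists u, h = rf_emb E u.
Proof.
move=> jf uf sP sh; apply: NNPP => nh.
have [n [d [d0 Eh]]] := rf_numden h; rewrite -!/(rf_eval E _) in Eh.
pose e := (maxn (size n) (size d)).-1.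
have e1 : e.+1 = maxn (size n) (size d).
  by rewrite prednK // leq_max [X in _ || X]lt0n size_poly_eq0 d0 orbT.
have ne : (size n <= e.+1)%N by rewrite e1 leq_maxl.
have de : (size d <= e.+1)%N by rewrite e1 leq_maxr.
(* Three distinct constants avoiding the zeros of the denominator of h, as needed by
   [height_three_points]. *)
have [c0 [_ dc0]] := ratfun_nonroot emb [::] d0.
have [c1 [c01 dc1]] := ratfun_nonroot emb [:: c0] d0.
have [c2 [c02 dc2]] := ratfun_nonroot emb [:: c0; c1] d0.
pose c (i : 'I_3) := tnth [tuple c0; c1; c2] i.
have dc i : d.[emb (c i)] != 0.
  by have [e0 e1' e2] := tnth3 c0 c1 c2; rewrite /c; case: (ord3P i) => ->; rewrite ?e0 ?e1' ?e2.
have cinj : injective c.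
  have [e0 e1' e2] := tnth3 c0 c1 c2; move: c01 c02; rewrite !inE negb_or => n10 /andP[n20 n21].
  move=> i i'; rewrite /c; case: (ord3P i) => ->; case: (ord3P i') => ->; rewrite ?e0 ?e1' ?e2 //;
    by move=> E'; move: n10 n20 n21; rewrite ?E' ?eqxx.
have [k kP] := ht_le_seq ([seq n`_i | i <- iota 0 e.+1] ++ [seq d`_i | i <- iota 0 e.+1] ++
  [seq n.[emb (c i)] | i <- enum 'I_3] ++ [seq d.[emb (c i)] | i <- enum 'I_3]).
have kn i : (i <= e)%N -> ht_le k n`_i.
  by move=> ie; apply: kP; rewrite mem_cat map_f // mem_iota.
have kd i : (i <= e)%N -> ht_le k d`_i.
  by move=> ie; apply: kP; rewrite !mem_cat map_f ?orbT // mem_iota.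
have knc i : ht_le k n.[emb (c i)].
  by apply: kP; rewrite !mem_cat (map_f (fun i => n.[emb (c i)])) ?orbT // mem_enum.
have kdc i : ht_le k d.[emb (c i)].
  by apply: kP; rewrite !mem_cat (map_f (fun i => d.[emb (c i)])) ?orbT // mem_enum.
pose m := (k + k + (1 + k + (1 + k) + k))%N; pose B := (e.+1 * m).+1.
have [N HN] := uf (B + B + B + 2)%N.
have [a' [b' [A' [t [jN tP th]]]]] := jonq_powers jf sP sh N.
have [uM uA _] := jN; apply: (HN _ _ jN).
rewrite Eh in th; have rel := pullback_relation uM uA tP ne de d0 th.
apply: (height_three_points cinj uA) => i; have := rel (emb (c i)).
move=> S0.
have [|||l [P [Q [l0 EP EQ sP' sQ']]]] := @form_zero_height K F
  (fun i0 => d.[emb (c i)] * subst F (aff a' b') n`_i0 -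
      (emb a' * n.[emb (c i)] + emb b' * d.[emb (c i)]) * subst F (aff a' b') d`_i0)
  (A' ord0 ord0 * emb (c i) + A' ord0 ord_max)
  (A' ord_max ord0 * emb (c i) + A' ord_max ord_max) m e _ _ _ S0; last by exists l, P, Q.
- move=> i0 i0e; apply: ht_leD.
    by apply: ht_leM (kdc i) _; apply: ht_le_subst => //; apply: kn.
  apply: ht_leN; apply: ht_leM; last by apply: ht_le_subst => //; apply: kd.
  by apply: ht_leD; apply: ht_leM => //; apply: ht_le_const.
(* If all coefficients vanish, n is proportional to d over F and h lies in F. *)
- apply: NNPP => none; apply: nh.
  have all0 i0 : (i0 <= e)%N -> d.[emb (c i)] * subst F (aff a' b') n`_i0 =
      (emb a' * n.[emb (c i)] + emb b' * d.[emb (c i)]) * subst F (aff a' b') d`_i0.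
    move=> i0e; apply/eqP; rewrite -subr_eq0; apply/negPn/negP => H; apply: none.
    by exists i0.
  pose i1 := (size d).-1; have i1e : (i1 <= e)%N.
    by rewrite -ltnS (leq_trans _ de) // prednK // lt0n size_poly_eq0.
  have di1 : d`_i1 != 0 by rewrite -/(lead_coef d) lead_coef_eq0.
  pose w := n`_i1 / d`_i1; have mud : subst F (aff a' b') d`_i1 != 0 by rewrite fmorph_eq0.
  have ww : emb a' * n.[emb (c i)] + emb b' * d.[emb (c i)] = d.[emb (c i)] * subst F (aff a' b') w.
    by apply: (mulIf mud); rewrite -all0 // -mulrA -rmorphM divfK.
  have nw : n = w *: d.
    apply/polyP => i0; rewrite coefZ; have [i0e|i0e] := leqP i0 e; last first.
      by rewrite !nth_default ?mulr0 // (leq_trans _ i0e).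
    apply: (fmorph_inj (subst F (aff a' b'))); apply: (mulfI (dc i)).
    by rewrite all0 // ww -mulrA -rmorphM.
  exists w; rewrite Eh nw -mul_polyC rmorphM /= rf_evalC mulfK // rf_eval_neq0 //.
apply: contraTT isT; rewrite negb_or !negbK => /andP[/eqP p0 /eqP q0].
have : \det A' != 0 by rewrite -unitfE -unitmxE.
case/negP; rewrite det2; apply/eqP.
have -> : A' ord0 ord_max = - (A' ord0 ord0 * emb (c i)) by apply/eqP; rewrite -addr_eq0 addrC p0.
have -> : A' ord_max ord_max = - (A' ord_max ord0 * emb (c i)) by apply/eqP; rewrite -addr_eq0 addrC q0.
ring.
Qed.

(** The pullback of x by g satisfies the same affine equation under f^* as x, so
    [semi_invariant_base] puts it in F; likewise for g^-1. Thus g^* restricts to F with x in its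
    image, and [rf_surjective_homography] applies to F over K, then to E over F. *)
Lemma centralizer_jonq f g a b A : is_jonq E f (aff a b) A -> unbounded_growth E f ->
  commute g f -> exists N B, is_jonq E g N B.
Proof.
move=> jf uf cg; have [uM uA _] := jf.
have [s sP] := exists_jonq_morph E uM uA; have fs := jonq_pullback jf sP.
have sK := jonq_morph_fixes uM sP.
have sX : s (rf_emb E (rf_gen F)) = const E a * rf_emb E (rf_gen F) + const E b.
  rewrite (jonq_morphX uM sP) /homography !mxE /= rmorph0 rmorph1 mul0r add0r divr1.
  by [].
have base k t : commute k f -> pullback k t -> exists u, t (rf_emb E (rf_gen F)) = rf_emb E u.
  move=> ck kt; apply: (semi_invariant_base jf uf sP).
  have [tK _] := kt; have [EX _] := affine_map_fun (affine_mapM fs kt)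
    (eq_ind _ (fun z => affine_map z _ _) (affine_mapM kt fs) _ ck).
  by rewrite -EX sX rmorphD rmorphM !tK.
have [t gt] := exists_pullback E g; have [t' gt'] := exists_pullback E g^-1%g.
have cg' : commute g^-1%g f by apply/commute_sym/commuteV/commute_sym.
have [u tu] := base g t cg gt; have [u' tu'] := base _ t' cg' gt'.
have [tt'X tt'Y] : t (t' (rf_emb E (rf_gen F))) = rf_emb E (rf_gen F) /\ t (t' Y) = Y.
  have := affine_mapM gt' gt; rewrite mulVg => H; exact: affine_map_fun H (pullback1 E).
have [tK _] := gt.
have [p p0|r [rc rg]] := @rf_morph K F F emb u.
  have : t (rf_emb E (rf_eval F p)) != 0 by rewrite !fmorph_eq0 rf_eval_neq0.
  have -> : t (rf_emb E (rf_eval F p)) = rf_emb E (map_poly emb p).[u].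
    rewrite /rf_eval -!horner_map -!map_poly_comp /= tu; congr _.[_].
    by apply: eq_map_poly => c /=; rewrite -/(const E c) tK.
  by rewrite fmorph_eq0.
have tr z : t (rf_emb E z) = rf_emb E (r z).
  apply: (@rf_morph_ext _ F E (t \o rf_emb E) (rf_emb E \o r)) => [c|] /=.
    by rewrite -/(const E c) tK rc.
  by rewrite tu rg.
have ru' : r u' = rf_gen F by apply: (fmorph_inj (rf_emb E)); rewrite -tr -tu'.
have [N uN EN] := rf_surjective_homography rc ru'.
have [B uB EB] := rf_surjective_homography tr tt'Y.
exists N, B; split=> //; have [_ aff_g] := gt.
by rewrite homography_const -EN rg -tu -EB.
Qed.

End InvariantFibrations.


(** * Invariant rational functions *)

Section AffineSubstitution.
Variable K : fieldType.
Implicit Types (p q : {poly K}) (a b : K).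

Definition lin a b : {poly K} := a%:P * 'X + b%:P.

Lemma size_lin a b : a != 0 -> size (lin a b) = 2.
Proof. by move=> a0; rewrite size_MXaddC polyC_eq0 (negPf a0) size_polyC a0. Qed.

Lemma size_comp_lin a b p : a != 0 -> size (p \Po lin a b) = size p.
Proof. by move=> a0; rewrite size_comp_poly2 // size_lin. Qed.

Lemma comp_lin_MXaddC a b p c :
  (p * 'X + c%:P) \Po lin a b = a *: ((p \Po lin a b) * 'X) + b *: (p \Po lin a b) + c%:P.
Proof.
rewrite comp_poly_MXaddC /lin mulrDr -!mul_polyC mulrA [_ * a%:P]mulrC.
by rewrite [_ * b%:P]mulrC mulrA.
Qed.

Lemma coef_comp_lin_top a b p n : (size p <= n.+1)%N -> (p \Po lin a b)`_n = a ^+ n * p`_n.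
Proof.
elim: n p => [|n IHn] p; elim/poly_ind: p => [|p c _] sp; rewrite ?comp_poly0 ?coef0 ?mulr0 //.
  have p0 : p = 0.
    apply/eqP; move: sp; rewrite size_MXaddC; case: ifP => [/andP[] //|_].
    by rewrite ltnS leqn0 size_poly_eq0.
  by rewrite comp_lin_MXaddC p0 comp_poly0 !mul0r !scaler0 !add0r mul1r.
have {}sp : (size p <= n.+1)%N.
  by move: sp; rewrite size_MXaddC; case: ifP => [/andP[/eqP->]|]; rewrite ?size_poly0.
rewrite comp_lin_MXaddC !coefD !coefZ !coefMX !coefC /= !addr0 IHn // exprS -mulrA.
rewrite [X in _ + _ * X]nth_default ?mulr0 ?addr0 //.
have [->|a0] := eqVneq a 0; last by rewrite size_comp_lin.
rewrite /lin mul0r add0r comp_polyCr; exact: leq_trans (size_polyC_leq1 _) _.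
Qed.

Lemma coef_comp_lin_second b p n : (size p <= n.+2)%N ->
  (p \Po lin 1 b)`_n = p`_n + b * p`_n.+1 *+ n.+1.
Proof.
elim: n p => [|n IHn] p; elim/poly_ind: p => [|p c _] sp;
  rewrite ?comp_poly0 ?coef0 ?mulr0 ?mul0rn ?addr0 //.
  have sp1 : (size p <= 1)%N.
    by move: sp; rewrite size_MXaddC; case: ifP => [/andP[/eqP->]|]; rewrite ?size_poly0.
  rewrite comp_lin_MXaddC !coefD !coefZ !coefMX !coefC /= mulr0 add0r addr0 add0r addrC.
  by rewrite (size1_polyC sp1) comp_polyC !coefC.
have {}sp : (size p <= n.+2)%N.
  by move: sp; rewrite size_MXaddC; case: ifP => [/andP[/eqP->]|]; rewrite ?size_poly0.
rewrite comp_lin_MXaddC !coefD !coefZ !coefMX !coefC /= !addr0 IHn // mul1r.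
by rewrite coef_comp_lin_top // expr1n mul1r -addrA -mulrSr.
Qed.

End AffineSubstitution.

Section FixedField.
Variables (K : closedFieldType) (F : ratfun K).
Local Notation emb := (rf_emb F).
Local Notation ev := (@rf_eval K F).
Implicit Types (p q : {poly K}) (a b : K).

Lemma subst_aff a b p : a != 0 -> subst F (aff a b) (ev p) = ev (p \Po lin a b).
Proof.
move=> a0; have uM : aff a b \in unitmx by rewrite unit_aff.
rewrite {1}/rf_eval -horner_map -map_poly_comp (@eq_map_poly _ _ _ emb) => [|c]; last first.
  by rewrite /= subst_const.
rewrite subst_gen // /homography !mxE /= rmorph0 rmorph1 mul0r add0r divr1.
rewrite /rf_eval map_comp_poly horner_comp; congr _.[_].
by rewrite /lin rmorphD rmorphM /= !map_polyC map_polyX hornerD hornerM !hornerC hornerX.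
Qed.

(** In lowest terms the denominator divides its own transform, which has the same degree; they are
    proportional, and the numerator inherits the same factor. *)
Lemma invariant_numden a b z : a != 0 -> subst F (aff a b) z = z ->
  exists p q c, [/\ q != 0, z = ev p / ev q, p \Po lin a b = c *: p & q \Po lin a b = c *: q].
Proof.
move=> a0; have [p [q [q0 pq ->]]] := rf_coprime z.
have q0' : ev q != 0 by rewrite rf_eval_neq0.
have cq0 : q \Po lin a b != 0 by rewrite -size_poly_eq0 size_comp_lin // size_poly_eq0.
have cq0' : ev (q \Po lin a b) != 0 by rewrite rf_eval_neq0.
rewrite fmorph_div !subst_aff // => /eqP; rewrite eqr_div // -!rmorphM => /eqP/rf_eval_inj E0.
have dq : q %| q \Po lin a b.
  have qp : coprimep q p by rewrite coprimep_sym.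
  by rewrite -(Gauss_dvdpr _ qp) -E0 dvdp_mull.
have /eqpf_eq[c c0 Ec] : q \Po lin a b %= q.
  by rewrite eqp_sym -dvdp_size_eqp // size_comp_lin.
exists p, q, c; split=> //; apply: (mulIf q0); rewrite E0 Ec.
by rewrite -scalerAr -scalerAl.
Qed.

(** A polynomial multiplied by c under x |-> a x only has monomials with a^i = c, hence at most one.
    Numerator and denominator share c, so they are multiples of the same monomial. *)
Lemma fixed_field_scaling a z : (forall n, (0 < n)%N -> a ^+ n != 1) -> a != 0 ->
  subst F (aff a 0) z = z -> exists c, z = emb c.
Proof.
move=> a_inf a0 /(invariant_numden a0)[p [q [c [q0 Ez Ep Eq]]]].
have coefE r i : (r \Po lin a 0)`_i = a ^+ i * r`_i.
  elim/poly_ind: r i => [|r u IHr] i; first by rewrite comp_poly0 coef0 mulr0.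
  rewrite comp_lin_MXaddC scale0r addr0 !coefD coefZ !coefMX !coefC.
  by case: i => [|i] /=; rewrite ?mulr0 ?add0r ?mul1r // !addr0 IHr mulrA -exprS.
have coefc r i : r \Po lin a 0 = c *: r -> r`_i != 0 -> a ^+ i = c.
  move=> Er ri; apply: (mulIf ri); rewrite -coefE Er coefZ //.
have ainj i j : a ^+ i = a ^+ j -> i = j.
  wlog ij : i j / (i <= j)%N.
    by move=> H E0; case: (leqP i j) => [|/ltnW] /H; [apply | move=> H'; rewrite H'].
  move=> E0; apply/eqP; rewrite eqn_leq ij /= leqNgt; apply/negP => lt_ij.
  have := a_inf (j - i)%N; rewrite subn_gt0 lt_ij => /(_ isT)/negP; apply; apply/eqP.
  apply: (mulIf (expf_neq0 i a0)).
  by rewrite -exprD subnK // mul1r E0.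
pose k := (size q).-1; have qk : q`_k != 0 by rewrite -/(lead_coef q) lead_coef_eq0.
have mono r : r \Po lin a 0 = c *: r -> r = r`_k *: 'X^k.
  move=> Er; apply/polyP => i; rewrite coefZ coefXn; case: eqP => [->|ik]; first by rewrite mulr1.
  rewrite mulr0; apply/eqP/negPn/negP => ri; apply: ik; apply: ainj.
  by rewrite (coefc r i Er ri) (coefc q k Eq qk).
have xk : ev 'X^k != 0 by rewrite rf_eval_neq0 -size_poly_eq0 size_polyXn.
exists (p`_k / q`_k); rewrite fmorph_div.
transitivity (ev ((p`_k)%:P * 'X^k) / ev ((q`_k)%:P * 'X^k)).
  by rewrite !mul_polyC -(mono p Ep) -(mono q Eq).
by rewrite !(rmorphM ev) /= !rf_evalC -mulf_div divff ?mulr1.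
Qed.

(** The leading coefficient shows c = 1. In degree n > 0 the next coefficient changes by n times the
    leading one, which is nonzero in characteristic 0. *)
Lemma fixed_field_translation z : (forall n, (0 < n)%N -> n%:R != 0 :> K) ->
  subst F (aff 1 1) z = z -> exists c, z = emb c.
Proof.
move=> char0 /(invariant_numden (oner_neq0 K))[p [q [c [q0 Ez Ep Eq]]]].
have const r : r \Po lin 1 1 = c *: r -> c = 1 \/ r = 0.
  move=> H; have [->|r0] := eqVneq r 0; [by right | left].
  have r1 : r`_(size r).-1 != 0 by rewrite -/(lead_coef r) lead_coef_eq0.
  apply: (mulIf r1); rewrite -coefZ -H coef_comp_lin_top ?expr1n //.
  by rewrite prednK // lt0n size_poly_eq0.
have [c1|q00] := const q Eq; last by rewrite q00 eqxx in q0.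
have size1 r : r \Po lin 1 1 = c *: r -> (size r <= 1)%N.
  move=> Er; rewrite leqNgt; apply/negP => sr.
  case Es : (size r) sr => [|[|n]] // _.
  have := coef_comp_lin_second 1 (_ : (size r <= n.+2)%N); rewrite Es => /(_ (leqnn _)).
  rewrite Er c1 scale1r mul1r -{1}[r`_n]addr0 => /addrI/esym/eqP.
  rewrite -mulr_natr mulf_eq0 (negPf (char0 n.+1 isT)) orbF.
  by have := lead_coef_eq0 r; rewrite /lead_coef Es /= => ->; rewrite -size_poly_eq0 Es.
rewrite Ez (size1_polyC (size1 p Ep)) (size1_polyC (size1 q Eq)) !rf_evalC -fmorph_div.
by eexists.
Qed.

Lemma fixed_field (M : 'M[K]_2) : M \in unitmx -> infinite_order M ->
  forall z, subst F M z = z -> exists c, z = emb c.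
Proof.
move=> uM iM z Ez; have [C uC [c c0 cases]] := infinite_order_normal_form uM iM.
have [J [uJ EJ fixJ]] : exists J : 'M[K]_2, [/\ J \in unitmx, invmx C *m M *m C = c *: J &
    forall z, subst F J z = z -> exists c, z = emb c].
  case: cases => [[a [a0 ai EJ]]|[ch0 EJ]].
    exists (aff a 0); rewrite unit_aff; split=> // w; exact: fixed_field_scaling.
  exists (aff 1 1); rewrite unit_aff oner_eq0; split=> // w; exact: fixed_field_translation.
have CM : C *m (c *: J) = M *m C by rewrite -EJ -!mulmxA mulKVmx.
have ucJ : c *: J \in unitmx by rewrite unitmxZ // unitfE.
have [|k Ek] := fixJ (subst F C z).
  by rewrite -(subst_scale (subst F C z) uJ c0) substM // CM -substM // Ez.
exists k; apply: (fmorph_inj (subst F C)); rewrite Ek subst_const //.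
Qed.

End FixedField.


(** * Degeneration at infinity *)

Lemma size_polyM_leq (R : nzSemiRingType) (p q : {poly R}) n m :
  (size p <= n.+1)%N -> (size q <= m.+1)%N -> (size (p * q)%R <= (n + m).+1)%N.
Proof.
move=> sp sq; apply: leq_trans (size_polyMleq _ _) _.
by have := leq_add sp sq; rewrite addSn addnS; case: (_ + _)%N.
Qed.

Lemma size_polyD_leq (R : nzSemiRingType) (p q : {poly R}) n :
  (size p <= n)%N -> (size q <= n)%N -> (size (p + q)%R <= n)%N.
Proof. by move=> sp sq; apply: leq_trans (size_polyD _ _) _; rewrite geq_max sp. Qed.

Lemma mxtrace2 (R : pzSemiRingType) (A : 'M[R]_2) : \tr A = A ord0 ord0 + A ord_max ord_max.
Proof.
by rewrite /mxtrace !big_ord_recl big_ord0 addr0; congr (_ + A _ _); apply: val_inj.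
Qed.

Section Jets.
Variable K : fieldType.
Implicit Types (p q : {poly K}) (a b : K).

(* For a polynomial of degree at most [n], [p`_n] and [(p * 'X)`_n] are its first two
   coefficients at infinity (the second one is 0 when [n = 0]). *)
Lemma coefM_top p q n m : (size p <= n.+1)%N -> (size q <= m.+1)%N ->
  (p * q)`_(n + m) = p`_n * q`_m.
Proof.
move=> sp sq; have ln : (n < (n + m).+1)%N by rewrite ltnS leq_addr.
rewrite coefM (bigD1 (Ordinal ln)) //= addKn big1 ?addr0 // => -[j lj] /=.
rewrite -val_eqE /= neq_ltn => /orP[jn|nj]; last by rewrite nth_default ?mul0r ?(leq_trans sp).
rewrite [q`_ _]nth_default ?mulr0 //; apply: leq_trans sq _.
by rewrite ltn_subRL ltn_add2r.
Qed.

Lemma coef_mul_support p q n k : (forall i, p`_i != 0 -> (i <= k)%N -> q`_(k - i) != 0 ->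
   i = n \/ i = n.+1) -> (n <= k)%N ->
  (p * q)`_k = p`_n * q`_(k - n) + (if (n < k)%N then p`_n.+1 * q`_(k - n.+1) else 0).
Proof.
move=> supp nk; rewrite coefM -(big_mkord xpredT (fun i => p`_i * q`_(k - i))).
have zero i : (i <= k)%N -> i != n -> i != n.+1 -> p`_i * q`_(k - i) = 0.
  move=> ik in1 in2; apply/eqP; rewrite mulf_eq0; apply/negPn/negP; rewrite negb_or => /andP[p0 q0].
  by have [E|E] := supp i p0 ik q0; [move: in1 | move: in2]; rewrite E eqxx.
rewrite (big_cat_nat _ (n := n)) //=; last exact: leqW.
rewrite big_nat big1 ?add0r => [|i /andP[_ lin]]; last first.
  by apply: zero; rewrite ?ltn_eqF // ?(leq_trans (ltnW lin)) // ltnW.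
rewrite big_ltn; last by rewrite ltnS.
congr (_ + _); case: ltnP => nk'; last by rewrite big_geq.
rewrite big_ltn; last by rewrite ltnS.
rewrite big_nat big1 ?addr0 // => i /andP[l1 l2].
by apply: zero; rewrite ?gtn_eqF // ltnW.
Qed.

Lemma coefMX_second p q n m : (size p <= n.+1)%N -> (size q <= m.+1)%N ->
  (p * q * 'X)`_(n + m) = p`_n * (q * 'X)`_m + (p * 'X)`_n * q`_m.
Proof.
move=> sp sq; rewrite mulrAC.
have supp i : (p * 'X)`_i != 0 -> (i <= n + m)%N -> q`_(n + m - i) != 0 -> i = n \/ i = n.+1.
  move=> pi ik qi.
  have : (i < n.+2)%N.
    rewrite ltnNge; apply: contra pi => ni; rewrite coefMX; case: i ni {ik qi} => // i ni.
    by rewrite /= nth_default // (leq_trans sp).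
  have : (n <= i)%N.
    rewrite leqNgt; apply: contra qi => ni; rewrite nth_default //; apply: leq_trans sq _.
    by rewrite ltn_subRL ltn_add2r.
  by rewrite leq_eqVlt => /orP[/eqP->|ni]; [left | move=> ni2; right; apply/eqP; rewrite eqn_leq -ltnS ni2].
rewrite (coef_mul_support supp) ?leq_addr //.
rewrite addKn addrC; congr (_ + _); rewrite ![(_ * 'X)`_ _]coefMX /=.
case: m {sq supp} => [|m]; first by rewrite addn0 ltnn mulr0.
by rewrite addnS ltnS leq_addr subSS addKn.
Qed.

Lemma coefMX_second4 p q (r : {poly K}) m n k :
  (size p <= m.+1)%N -> (size q <= n.+1)%N -> (size r <= k.+1)%N ->
  (p * p * (q * r) * 'X)`_(m + m + (n + k)) =
    p`_m * p`_m * (q`_n * (r * 'X)`_k + (q * 'X)`_n * r`_k) +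
    (p`_m * (p * 'X)`_m + (p * 'X)`_m * p`_m) * (q`_n * r`_k).
Proof.
move=> sp sq sr.
by rewrite coefMX_second ?size_polyM_leq // !(coefMX_second, coefM_top).
Qed.

Lemma coefMX_comp_lin b p n : (size p <= n.+1)%N ->
  ((p \Po lin 1 b) * 'X)`_n = (p * 'X)`_n + b * p`_n *+ n.
Proof.
by case: n => [|n] sp; rewrite !coefMX /= ?mulr0n ?addr0 // coef_comp_lin_second.
Qed.

End Jets.

Section PolyMatrices.
Variable K : fieldType.
Implicit Types (P Q : 'M[{poly K}]_2) (a b : K).

Definition comp_mx a b P := map_mx (comp_poly (lin a b)) P.
(** The value at infinity of P / x^n, when the entries have degree at most n. *)
Definition top_mx n P : 'M[K]_2 := map_mx (coefp n) P.

Lemma det_comp_mx a b P : \det (comp_mx a b P) = \det P \Po lin a b.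
Proof. by rewrite /comp_mx det_map_mx. Qed.

Lemma size_det_neq0 P : (\det P != 0) = (0 < size (\det P))%N.
Proof. by rewrite lt0n size_poly_eq0. Qed.

(** The leading coefficients give be^(2d) a^nq = a^(2e) be^np; substituting 2d = np + l and 2e = nq
    + k leaves the relation between gaps. *)
Lemma top_relation (T lp lq a be : K) d e np nq l k :
  a != 0 -> be != 0 -> T != 0 -> lp != 0 -> lq != 0 -> (np + l = d + d)%N -> (nq + k = e + e)%N ->
  be ^+ d * T * (be ^+ d * T) * (a ^+ nq * lq * lp) =
    a ^+ e * T * (a ^+ e * T) * (be ^+ np * lp * lq) ->
  be ^+ l = a ^+ k.
Proof.
move=> a0 be0 T0 p0 q0 Enp Enq C1.
have n0 : T * T * (lp * lq) * (be ^+ np * a ^+ nq) != 0 by rewrite !mulf_neq0 // expf_neq0.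
apply: (mulfI n0); have := congr1 (GRing.exp be) Enp; have := congr1 (GRing.exp a) Enq.
rewrite !exprD; move: C1 {Enp Enq n0}; move: (be ^+ np) (a ^+ nq) (be ^+ l) (a ^+ k) (be ^+ d) (a ^+ e).
move=> x y z w x' y' C1 E1 E2.
transitivity (x * z * T * T * (lp * lq) * y); first by ring.
transitivity (y * w * T * T * (lp * lq) * x); last by ring.
rewrite E1 E2; transitivity (x' * T * (x' * T) * (y * lq * lp)); first by ring.
by rewrite C1; ring.
Qed.

(* The identity tau^2 det(Q)(a x + b) det(P) = tau'^2 det(P)(be x + t) det(Q), for the traces of
   both sides of the commutation relation, is compared in its two leading coefficients. *)
Lemma hyperbolic_relation a b be t u v P Q d e l k :
  a != 0 -> be != 0 -> u != 0 -> v != 0 ->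
  u *: (comp_mx a b Q *m P) = v *: (comp_mx be t P *m Q) ->
  (forall i j, (size (P i j) <= d.+1)%N) -> (forall i j, (size (Q i j) <= e.+1)%N) ->
  \det P != 0 -> \det Q != 0 ->
  (size (\det P) + l = (d + d).+1)%N -> (size (\det Q) + k = (e + e).+1)%N ->
  \tr (top_mx d P *m top_mx e Q) != 0 ->
  be ^+ l = a ^+ k /\ (a = 1 -> be = 1 -> t * l%:R = b * k%:R).
Proof.
move=> a0 be0 u0 v0 E0 sP sQ dP dQ lP lQ; set T := \tr _ => T0.
pose tau := \tr (comp_mx be t P *m Q); pose tau' := \tr (comp_mx a b Q *m P).
have Etr : u * tau' = v * tau by have := congr1 mxtrace E0; rewrite !mxtraceZ.
have := congr1 determinant E0; rewrite !detZ !det_mulmx !det_comp_mx => Edet.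
(* The squared trace divided by the determinant does not see the unknown factors u and v. *)
have ID : tau * tau * ((\det Q \Po lin a b) * \det P) = tau' * tau' * ((\det P \Po lin be t) * \det Q).
  apply: (mulfI (mulf_neq0 (expf_neq0 2 u0) (expf_neq0 2 v0))).
  transitivity ((v * tau) * (v * tau) * (u ^+ 2 * ((\det Q \Po lin a b) * \det P))); first by ring.
  by rewrite Edet -Etr; ring.
have stau : (size tau <= (d + e).+1)%N /\ (size tau' <= (d + e).+1)%N.
  have cP i j : (size (comp_mx be t P i j) <= d.+1)%N by rewrite mxE size_comp_lin.
  have cQ i j : (size (comp_mx a b Q i j) <= e.+1)%N by rewrite mxE size_comp_lin.
  rewrite /tau /tau' !mxtrace2 !mulmx2E; split.
    by rewrite !size_polyD_leq ?size_polyM_leq.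
  by rewrite addnC !size_polyD_leq ?size_polyM_leq.
case: stau => stau stau'.
pose np := (size (\det P)).-1; pose nq := (size (\det Q)).-1.
have snp : size (\det P) = np.+1 by rewrite prednK // -size_det_neq0.
have snq : size (\det Q) = nq.+1 by rewrite prednK // -size_det_neq0.
have lp0 : (\det P)`_np != 0 by rewrite -/(lead_coef _) lead_coef_eq0.
have lq0 : (\det Q)`_nq != 0 by rewrite -/(lead_coef _) lead_coef_eq0.
have Enp : (np + l = d + d)%N by move: lP; rewrite snp addSn => -[].
have Enq : (nq + k = e + e)%N by move: lQ; rewrite snq addSn => -[].
have Ttau : tau`_(d + e) = be ^+ d * T.
  rewrite /tau /T !mxtrace2 !mulmx2E !coefD !coefM_top ?mxE ?size_comp_lin //.
  by rewrite !coef_comp_lin_top //=; ring.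
have Ttau' : tau'`_(d + e) = a ^+ e * T.
  rewrite addnC /tau' /T !mxtrace2 !mulmx2E !coefD !coefM_top ?mxE ?size_comp_lin //.
  by rewrite !coef_comp_lin_top //=; ring.
have snp' : (size (\det P) <= np.+1)%N by rewrite snp.
have snq' : (size (\det Q) <= nq.+1)%N by rewrite snq.
have scp : (size (\det P \Po lin be t) <= np.+1)%N by rewrite size_comp_lin.
have scq : (size (\det Q \Po lin a b) <= nq.+1)%N by rewrite size_comp_lin.
have s1 := size_polyM_leq stau stau; have s2 := size_polyM_leq stau' stau'.
have s3 := size_polyM_leq scq snp'; have s4 := size_polyM_leq scp snq'.
have C1 := congr1 (fun p : {poly K} => p`_(d + e + (d + e) + (nq + np))) ID.
rewrite /= coefM_top // coefM_top // coefM_top // in C1.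
rewrite [(nq + np)%N]addnC coefM_top // coefM_top // coefM_top // in C1.
rewrite !coef_comp_lin_top // Ttau Ttau' in C1.
have Elead : be ^+ l = a ^+ k.
  by apply: top_relation C1.
split=> // a1 be1; move: ID C1 Ttau Ttau' scp scq s3 s4; rewrite a1 be1 => ID _ Ttau Ttau' scp scq s3 s4.
rewrite !expr1n !mul1r in Ttau Ttau'.
(* Multiplying by 'X makes the coefficient of index d + e the second one; S is the part of it common
   to both traces. *)
pose S := \tr (top_mx d (P *m 'X%:M) *m top_mx e Q) + \tr (top_mx d P *m top_mx e (Q *m 'X%:M)).
have Stau : (tau * 'X)`_(d + e) = S + t * T *+ d.
  rewrite /tau /S /T be1 !mul_mx_scalar !mxtrace2 !mulmx2E !mulrDl !coefD.
  rewrite !coefMX_second ?mxE ?size_comp_lin ?oner_eq0 //=.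
  rewrite !coefMX_comp_lin // !coef_comp_lin_top // ![_ * (Q _ _ )](mulrC) !expr1n.
  rewrite ![('X * _)](mulrC); ring.
have Stau' : (tau' * 'X)`_(d + e) = S + b * T *+ e.
  rewrite addnC /tau' /S /T a1 !mul_mx_scalar !mxtrace2 !mulmx2E !mulrDl !coefD.
  rewrite !coefMX_second ?mxE ?size_comp_lin ?oner_eq0 //=.
  rewrite !coefMX_comp_lin // !coef_comp_lin_top // !expr1n.
  rewrite ![('X * _)](mulrC); ring.
have C2 := congr1 (fun p : {poly K} => (p * 'X)`_(d + e + (d + e) + (nq + np))) ID.
rewrite /= coefMX_second4 // [(nq + np)%N]addnC coefMX_second4 // in C2.
rewrite !coefMX_comp_lin // !coef_comp_lin_top // Stau Stau' Ttau Ttau' !expr1n in C2.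
move: C2; set x := (_ * 'X)`_np; set y := (_ * 'X)`_nq; set lp := (\det P)`_np; set lq := (\det Q)`_nq => C2.
have n0 : T * T * (lp * lq) != 0 by rewrite !mulf_neq0.
clearbody T lp lq x y S; clear -C2 n0 Enp Enq.
apply: (mulfI n0).
have El : l%:R = d%:R + d%:R - np%:R :> K by rewrite -natrD -Enp natrD; ring.
have Ek : k%:R = e%:R + e%:R - nq%:R :> K by rewrite -natrD -Enq natrD; ring.
rewrite El Ek; apply/eqP; rewrite -subr_eq0; apply/eqP.
move: C2 => /eqP; rewrite -subr_eq0 => /eqP <-.
ring.
Qed.

End PolyMatrices.



Section Representatives.
Variables (K : closedFieldType) (F : ratfun K).
Local Notation emb := (rf_emb F).
Local Notation ev := (@rf_eval K F).
Implicit Types (P Q : 'M[{poly K}]_2) (A B : 'M[F]_2) (a b : K).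

Definition represents P A := exists2 s, s != 0 & A = s *: poly_mx F P.

Lemma representsM P Q A B : represents P A -> represents Q B -> represents (P *m Q) (A *m B).
Proof.
move=> [s s0 ->] [t t0 ->]; exists (s * t); rewrite ?mulf_neq0 //.
by rewrite /poly_mx map_mxM -scalemxAl -scalemxAr scalerA.
Qed.

Lemma represents_scale P A c : c != 0 -> represents P A -> represents P (c *: A).
Proof. by move=> c0 [s s0 ->]; exists (c * s); rewrite ?mulf_neq0 // scalerA. Qed.

Lemma represents_subst P A a b : a != 0 -> represents P A ->
  represents (comp_mx a b P) (A ^^ aff a b).
Proof.
move=> a0 [s s0 ->]; exists (subst F (aff a b) s); rewrite ?fmorph_eq0 //.
by apply/matrixP => i j; rewrite !mxE rmorphM /= subst_aff.
Qed.

Lemma represents_det P A : A \in unitmx -> represents P A -> \det P != 0.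
Proof.
move=> uA [s s0 EA]; apply: contraTneq uA => d0.
by rewrite EA unitmxZ ?unitfE // unitmxE /poly_mx det_map_mx d0 rmorph0 unitr0.
Qed.

Lemma represents_exists A : exists P, represents P A.
Proof. by have [m [P [s [s0 EA _]]]] := height_le_exists A; exists P, s. Qed.

Lemma represents_const (J : 'M[K]_2) : represents (map_mx polyC J) (map_mx emb J).
Proof.
exists 1; rewrite ?oner_neq0 // scale1r; apply/matrixP => i j.
by rewrite !mxE rf_evalC.
Qed.

Lemma represents_inv P A : A \in unitmx -> represents P A -> represents (\adj P) (invmx A).
Proof.
move=> uA rP; have dP := represents_det uA rP; case: rP uA => s s0 -> uA.
have u0 : s ^+ 2 * ev (\det P) != 0 by rewrite mulf_neq0 ?expf_neq0 // rf_eval_neq0.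
have adjE : poly_mx F (\adj P) = \adj (poly_mx F P) by rewrite /poly_mx map_mx_adj.
have dE : ev (\det P) = \det (poly_mx F P) by rewrite /poly_mx det_map_mx.
have uP : poly_mx F P \in unitmx by move: uA; rewrite unitmxZ // unitfE.
exists (s * ev (\det P))^-1; first by rewrite invr_eq0 mulf_neq0 // rf_eval_neq0.
rewrite invmxZ // adjE dE /invmx uP scalerA -invrM ?unitfE ?mulf_neq0 //.
  by rewrite [_ * s]mulrC.
by rewrite -dE rf_eval_neq0.
Qed.

Lemma represents_cross P Q A c : c != 0 -> represents P A -> represents Q (c *: A) ->
  exists u v, [/\ u != 0, v != 0 & u *: P = v *: Q].
Proof.
move=> c0 [s s0 ->] [t t0]; rewrite scalerA => EQ.
have [p [q [q0 _ Epq]]] := rf_coprime (c * s / t).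
have z0 : c * s / t != 0 by rewrite !mulf_neq0 ?invr_eq0.
have q0' : ev q != 0 by rewrite rf_eval_neq0.
have p0 : p != 0 by apply: contraNneq z0 => p0; rewrite Epq p0 rmorph0 mul0r.
exists p, q; split=> //; apply/matrixP => i j; apply: (@rf_eval_inj _ F).
have := congr1 (fun B : 'M[F]_2 => B i j) EQ; rewrite !mxE !rmorphM /= => Eij.
have -> : ev p = ev q * (c * s / t) by rewrite Epq mulrC divfK.
rewrite -mulrA; congr (_ * _); apply: (mulfI t0).
by rewrite -Eij mulrA [t * _]mulrC divfK.
Qed.

End Representatives.

Section Gap.
Variable K : fieldType.
Implicit Types (P Q : 'M[{poly K}]_2) (a b : K).

(* The degeneration of [P], of degree [d], over infinity is measured by l = 2 d - deg (det P). *)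
Definition gap d l P :=
  (forall i j, (size (P i j) <= d.+1)%N) /\ (size (\det P) + l = (d + d).+1)%N.

Lemma size_mx2_mul P Q d e i j : (forall i j, (size (P i j) <= d.+1)%N) ->
  (forall i j, (size (Q i j) <= e.+1)%N) -> (size ((P *m Q) i j) <= (d + e).+1)%N.
Proof. move=> sP sQ; by rewrite mulmx2E size_polyD_leq ?size_polyM_leq.
Qed.

Lemma size_det_le P d : (forall i j, (size (P i j) <= d.+1)%N) ->
  (size (\det P) <= (d + d).+1)%N.
Proof. by move=> sP; rewrite det2 size_polyD_leq ?size_polyN ?size_polyM_leq. Qed.

Lemma gapM d l e k P Q : \det P != 0 -> \det Q != 0 -> gap d l P -> gap e k Q ->
  gap (d + e) (l + k) (P *m Q).
Proof.
move=> dP dQ [sP lP] [sQ lQ]; split=> [i j|]; first exact: size_mx2_mul.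
rewrite det_mulmx size_mul //; move: dP dQ lP lQ; rewrite -!size_poly_gt0.
by case: (size _) => // p _; case: (size _) => // q _; lia.
Qed.

Lemma gap_comp d l P a b : a != 0 -> gap d l P -> gap d l (comp_mx a b P).
Proof. by move=> a0 [sP lP]; split=> [i j|]; rewrite ?mxE ?det_comp_mx size_comp_lin. Qed.

Lemma gap_exists P : \det P != 0 -> exists d l, gap d l P /\ top_mx d P != 0.
Proof.
move=> dP; pose s := \max_(ij : 'I_2 * 'I_2) size (P ij.1 ij.2).
have sP i j : (size (P i j) <= s)%N by apply: (leq_bigmax (F := fun ij => size (P ij.1 ij.2)) (i, j)).
have P0 : P != 0 by apply: contraNneq dP => ->; rewrite det0.
have s0 : (0 < s)%N.
  rewrite lt0n; apply: contraNneq P0 => s0; apply/eqP/matrixP => i j.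
  by apply/eqP; have := sP i j; rewrite s0 size_poly_leq0 mxE.
have sP' i j : (size (P i j) <= s.-1.+1)%N by rewrite prednK.
have sd := size_det_le sP'.
exists s.-1, ((s.-1 + s.-1).+1 - size (\det P))%N; split; first by split; rewrite // subnKC.
have [[i j] Eij] : {ij | s = size (P ij.1 ij.2)}.
  by apply: eq_bigmax; rewrite card_prod !card_ord.
apply: contraTneq s0 => T0; have := congr1 (fun B : 'M[K]_2 => B i j) T0.
rewrite !mxE /= Eij /= => /eqP; rewrite -/(lead_coef _) lead_coef_eq0 => /eqP ->.
by rewrite size_poly0.
Qed.

End Gap.

Lemma adj2 (R : comNzRingType) (B : 'M[R]_2) : \adj B = (\tr B)%:M - B.
Proof.
have l0 (k : 'I_1) : lift (ord0 : 'I_2) k = ord_max by apply: val_inj; rewrite (ord1 k).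
have l1 (k : 'I_1) : lift (ord_max : 'I_2) k = ord0 by apply: val_inj; rewrite (ord1 k).
rewrite mxtrace2; apply: mx2_eq; rewrite !mxE /cofactor det_mx11 !mxE ?l0 ?l1 /= ?mulr1n ?mulr0n ?expr0 ?expr1;
  ring.
Qed.

(** Cayley-Hamilton for A B with a factor B cancelled. *)
Lemma mx2_sandwich (R : comNzRingType) (A B : 'M[R]_2) :
  A *m B *m A = \tr (A *m B) *: A - \det A *: \adj B.
Proof.
rewrite adj2 !mxtrace2 det2; apply: mx2_eq; rewrite !mulmx2E !mxE /= ?mulr1n ?mulr0n; ring.
Qed.

(** The polarized Cayley-Hamilton identity. *)
Lemma mx2_polar (R : comNzRingType) (A B : 'M[R]_2) :
  A *m B + B *m A = \tr A *: B + \tr B *: A + (\tr (A *m B) - \tr A * \tr B)%:M.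
Proof.
rewrite !mxtrace2; apply: mx2_eq; rewrite [LHS]mxE !mulmx2E !mxE /= ?mulr1n ?mulr0n; ring.
Qed.

(** For the leading matrices of f and g. If both traces vanish, then tr B = 0 and A B A = 0; since
    A^2 = tr(A) A, this gives A B = B A = 0, and polarization leaves tr(A) B = 0. *)
Lemma mx2_trace_product_neq0 (L : fieldType) (A B : 'M[L]_2) (c : L) :
  \det A = 0 -> \tr A != 0 -> B != 0 -> c != 0 -> A *m B = c *: (B *m A) ->
  \tr (A *m B) != 0 \/ \tr (A *m \adj B) != 0.
Proof.
move=> dA tA B0 c0 EAB; apply: NNPP => H.
have [t1 t2] : \tr (A *m B) = 0 /\ \tr (A *m \adj B) = 0.
  by split; apply/eqP/negPn/negP => n0; apply: H; [left | right].
have tB : \tr B = 0.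
  move: t2; rewrite adj2 mulmxBr mul_mx_scalar linearB linearZ /= t1 subr0 => /eqP.
  by rewrite mulf_eq0 (negPf tA) orbF => /eqP.
have ABA : A *m B *m A = 0 by rewrite mx2_sandwich t1 dA !scale0r subr0.
have AB : A *m B = 0.
  have : A *m (A *m B) = 0 by rewrite EAB -scalemxAr mulmxA ABA scaler0.
  have AA : A *m A = \tr A *: A.
    have := mx2_sandwich A 1%:M; rewrite !mulmx1 dA scale0r subr0 //.
  by rewrite mulmxA AA -scalemxAl => /eqP; rewrite scaler_eq0 (negPf tA) => /eqP.
have BA : B *m A = 0.
  by move/eqP: EAB; rewrite AB eq_sym scaler_eq0 (negPf c0) => /eqP.
have := mx2_polar A B; rewrite AB BA tB mxtrace0 mulr0 scale0r !addr0 subr0 raddf0 addr0.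
by move/esym/eqP; rewrite scaler_eq0 (negPf tA) (negPf B0).
Qed.

(** * Non-nilpotent leading matrix at infinity *)

Section HyperbolicInfinity.
Variables (K : closedFieldType) (F : ratfun K) (E : ratfun F).
Implicit Types (P Q : 'M[{poly K}]_2) (A B : 'M[F]_2) (a b be t : K) (f g : Cremona K).

(** The exponent k is natural, so its sign is carried by the two alternatives, which come from g and
    g^-1. The additive relations serve for translations, where the multiplicative ones are empty. *)
Definition commensurable a b l be t :=
  (exists k, be ^+ l = a ^+ k /\ (a = 1 -> be = 1 -> t * l%:R = b * k%:R)) \/
  (exists k, be ^+ l * a ^+ k = 1 /\ (a = 1 -> be = 1 -> t * l%:R + b * k%:R = 0)).

Lemma commute_cross f g a b be t A B P Q : a != 0 -> be != 0 ->
  is_jonq E f (aff a b) A -> is_jonq E g (aff be t) B -> commute g f ->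
  represents P A -> represents Q B ->
  exists u v, [/\ u != 0, v != 0 & u *: (comp_mx a b Q *m P) = v *: (comp_mx be t P *m Q)].
Proof.
move=> a0 be0 jf jg cgf rP rQ; have [_ [c c0 Ec]] := is_jonq_commute jf jg cgf.
have r1 := representsM (represents_subst b a0 rQ) rP.
have r2 := representsM (represents_subst t be0 rP) rQ.
rewrite Ec in r1; have [u [v [u0 v0 Euv]]] := represents_cross c0 r2 r1.
by exists v, u.
Qed.

Lemma hyperbolic_step f g a b be t A B P Q d l e : a != 0 -> be != 0 ->
  is_jonq E f (aff a b) A -> is_jonq E g (aff be t) B -> commute g f ->
  represents P A -> represents Q B -> gap d l P -> (forall i j, (size (Q i j) <= e.+1)%N) ->
  \tr (top_mx d P *m top_mx e Q) != 0 ->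
  exists k, be ^+ l = a ^+ k /\ (a = 1 -> be = 1 -> t * l%:R = b * k%:R).
Proof.
move=> a0 be0 jf jg cgf rP rQ [sP lP] sQ T0.
have [_ uA _] := jf; have [_ uB _] := jg.
have dP := represents_det uA rP; have dQ := represents_det uB rQ.
have [u [v [u0 v0 Euv]]] := commute_cross a0 be0 jf jg cgf rP rQ.
exists ((e + e).+1 - size (\det Q))%N.
apply: (hyperbolic_relation a0 be0 u0 v0 Euv sP sQ dP dQ lP _ T0).
by rewrite subnKC // size_det_le.
Qed.

Lemma top_mx_mul P Q d e : (forall i j, (size (P i j) <= d.+1)%N) ->
  (forall i j, (size (Q i j) <= e.+1)%N) ->
  top_mx (d + e) (P *m Q) = top_mx d P *m top_mx e Q.
Proof.
by move=> sP sQ; apply/matrixP => i j; rewrite !(mulmx2E, mxE) /= coefD !coefM_top.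
Qed.

Lemma top_mx_comp P d a b : (forall i j, (size (P i j) <= d.+1)%N) ->
  top_mx d (comp_mx a b P) = a ^+ d *: top_mx d P.
Proof. by move=> sP; apply/matrixP => i j; rewrite !mxE /= coef_comp_lin_top. Qed.

Lemma top_mx_scale P d (u : {poly K}) : (forall i j, (size (P i j) <= d.+1)%N) ->
  top_mx ((size u).-1 + d) (u *: P) = lead_coef u *: top_mx d P.
Proof.
by move=> sP; apply/matrixP => i j; rewrite !mxE /= coefM_top // leqSpred.
Qed.

(** Determinants show that u and v have the same degree, so the relation can be read on leading
    matrices, where substitutions only contribute scalars. *)
Lemma top_mx_cross a b be t u v P Q d e : a != 0 -> be != 0 -> u != 0 -> v != 0 ->
  u *: (comp_mx a b Q *m P) = v *: (comp_mx be t P *m Q) ->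
  (forall i j, (size (P i j) <= d.+1)%N) -> (forall i j, (size (Q i j) <= e.+1)%N) ->
  \det P != 0 -> \det Q != 0 ->
  exists2 c, c != 0 & top_mx d P *m top_mx e Q = c *: (top_mx e Q *m top_mx d P).
Proof.
move=> a0 be0 u0 v0 Euv sP sQ dP dQ.
have sP' i j : (size (comp_mx be t P i j) <= d.+1)%N by rewrite mxE size_comp_lin.
have sQ' i j : (size (comp_mx a b Q i j) <= e.+1)%N by rewrite mxE size_comp_lin.
have suv : size u = size v.
  have := congr1 (fun A : 'M[{poly K}]_2 => size (\det A)) Euv; rewrite !detZ !det_mulmx !det_comp_mx.
  have cP : \det P \Po lin be t != 0 by rewrite -size_poly_eq0 size_comp_lin // size_poly_eq0.
  have cQ : \det Q \Po lin a b != 0 by rewrite -size_poly_eq0 size_comp_lin // size_poly_eq0.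
  rewrite !expr2 !size_mul ?mulf_neq0 // !size_comp_lin //.
  move: u0 v0 dP dQ; rewrite -!size_poly_gt0.
  move: (size u) (size v) (size (\det P)) (size (\det Q)) => *; lia.
have E1 : top_mx ((size u).-1 + (d + e)) (u *: (comp_mx a b Q *m P)) =
    (lead_coef u * a ^+ e) *: (top_mx e Q *m top_mx d P).
  rewrite [(d + e)%N]addnC top_mx_scale => [|i j]; last exact: size_mx2_mul.
  by rewrite top_mx_mul // top_mx_comp // -scalemxAl scalerA.
have E2 : top_mx ((size u).-1 + (d + e)) (v *: (comp_mx be t P *m Q)) =
    (lead_coef v * be ^+ d) *: (top_mx d P *m top_mx e Q).
  rewrite suv top_mx_scale => [|i j]; last exact: size_mx2_mul.
  by rewrite top_mx_mul // top_mx_comp // -scalemxAl scalerA.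
have cv0 : lead_coef v * be ^+ d != 0 by rewrite mulf_neq0 ?lead_coef_eq0 ?expf_neq0.
have cu0 : lead_coef u * a ^+ e != 0 by rewrite mulf_neq0 ?lead_coef_eq0 ?expf_neq0.
exists ((lead_coef v * be ^+ d)^-1 * (lead_coef u * a ^+ e)); first by rewrite mulf_neq0 ?invr_eq0.
by rewrite -scalerA -E1 Euv E2 scalerA mulVf // scale1r.
Qed.

Lemma det_top_mx P d : (forall i j, (size (P i j) <= d.+1)%N) ->
  \det (top_mx d P) = (\det P)`_(d + d).
Proof. by move=> sP; rewrite !det2 !mxE coefB !coefM_top. Qed.

Lemma aff_inv be t : be != 0 -> invmx (aff be t) = aff be^-1 (- (t / be)).
Proof.
move=> be0; have u : aff be t \in unitmx by rewrite unit_aff.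
rewrite -[RHS](mulKmx u) mx2_mul (_ : mx2 _ _ _ _ = 1%:M) ?mulmx1 //.
by rewrite scalar_mx2; congr mx2; field.
Qed.

Lemma hyperbolic_centralizer f a b A P d l : a != 0 -> is_jonq E f (aff a b) A ->
  represents P A -> gap d l P -> \det (top_mx d P) = 0 -> \tr (top_mx d P) != 0 ->
  forall g be t B, be != 0 -> commute g f -> is_jonq E g (aff be t) B -> commensurable a b l be t.
Proof.
move=> a0 jf rP gP dP0 tP0 g be t B be0 cgf jg; have [sP lP] := gP.
have [_ uA _] := jf; have [_ uB _] := jg; have [Q rQ] := represents_exists B.
have dP := represents_det uA rP; have dQ := represents_det uB rQ.
have [e [k [[sQ _] tQ0]]] := gap_exists dQ.
have [u [v [u0 v0 Euv]]] := commute_cross a0 be0 jf jg cgf rP rQ.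
have [c c0 Ec] := top_mx_cross a0 be0 u0 v0 Euv sP sQ dP dQ.
have [T0|T0] := mx2_trace_product_neq0 dP0 tP0 tQ0 c0 Ec.
  by left; apply: hyperbolic_step jf jg cgf rP rQ gP sQ T0.
(* In the other case g is replaced by g^-1, which is represented by the adjugate of a transform of
   Q. *)
have cgf' : commute g^-1%g f by apply: commute_sym; apply: commuteV; apply: commute_sym.
have be0' : be^-1 != 0 by rewrite invr_eq0.
have := is_jonqV jg; rewrite aff_inv // => jg'.
have uB' : B ^^ aff be^-1 (- (t / be)) \in unitmx by rewrite subst_unitmx.
have rQ' := represents_inv uB' (represents_subst (- (t / be)) be0' rQ).
have sQ1 i j : (size (comp_mx be^-1 (- (t / be)) Q i j) <= e.+1)%N by rewrite mxE size_comp_lin.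
have adjE (R : comNzRingType) (M : 'M[R]_2) :
    \adj M = mx2 (M ord_max ord_max) (- M ord0 ord_max) (- M ord_max ord0) (M ord0 ord0).
  by rewrite adj2 mxtrace2; apply: mx2_eq; rewrite !mx2E !mxE /= ?mulr1n ?mulr0n; ring.
have sQ2 i j : (size (\adj (comp_mx be^-1 (- (t / be)) Q) i j) <= e.+1)%N.
  by rewrite adjE mxE; case: ifP => _; case: ifP => _; rewrite ?size_polyN.
have [|m [E1 E2]] := hyperbolic_step a0 be0' jf jg' cgf' rP rQ' gP sQ2.
  have -> : top_mx e (\adj (comp_mx be^-1 (- (t / be)) Q)) = be^-1 ^+ e *: \adj (top_mx e Q).
    rewrite !adjE scale_mx2; apply: mx2_eq; rewrite mxE !mx2E /= ?coefN !mxE ?coef_comp_lin_top ?mulrN //.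
  by rewrite -scalemxAr linearZ mulf_neq0 // expf_neq0.
right; exists m; split=> [|a1 be1]; first by rewrite -E1 -exprMn mulfV // expr1n.
have ib : be^-1 = 1 by rewrite be1 invr1.
by rewrite -(E2 a1 ib) ib mulr1 mulNr subrr.
Qed.

End HyperbolicInfinity.




Lemma adj_mx2 (R : comNzRingType) (a b c d : R) : \adj (mx2 a b c d) = mx2 d (- b) (- c) a.
Proof.
by rewrite adj2 mxtrace2 !mx2E; apply: mx2_eq; rewrite !mx2E !mxE /= ?mulr1n ?mulr0n; ring.
Qed.

Lemma size_leq_top (R : nzSemiRingType) (p : {poly R}) n : (size p <= n.+1)%N -> p`_n = 0 -> (size p <= n)%N.
Proof.
move=> sp p0; apply/leq_sizeP => i; rewrite leq_eqVlt => /orP[/eqP <- //|ni].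
by apply: nth_default; apply: leq_trans sp ni.
Qed.

(** * Reduction at infinity by elementary transformations *)

Section InfinityAlternative.
Variables (K : closedFieldType) (F : ratfun K) (E : ratfun F).
Local Notation emb := (rf_emb F).
Implicit Types (P Q : 'M[{poly K}]_2) (A B C : 'M[F]_2) (a b be t : K) (f g h : Cremona K).

Definition gap_le k A := exists P d l, [/\ represents P A, gap d l P & (l <= k)%N].

Lemma gap_le_exists A : A \in unitmx -> exists k, gap_le k A.
Proof.
move=> uA; have [P rP] := represents_exists A.
by have [d [l [gP _]]] := gap_exists (represents_det uA rP); exists l, P, d, l.
Qed.

Lemma gap_leM j k A B : A \in unitmx -> B \in unitmx -> gap_le j A -> gap_le k B ->
  gap_le (j + k) (A *m B).
Proof.
move=> uA uB [P [d [l [rP gP lj]]]] [Q [e [m [rQ gQ mk]]]].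
exists (P *m Q), (d + e)%N, (l + m)%N; split; first exact: representsM.
  by apply: gapM gP gQ; [apply: represents_det rP | apply: represents_det rQ].
exact: leq_add.
Qed.

Lemma gap_le_subst k A a b : a != 0 -> gap_le k A -> gap_le k (A ^^ aff a b).
Proof.
move=> a0 [P [d [l [rP gP lk]]]]; exists (comp_mx a b P), d, l.
by split; [apply: represents_subst | apply: gap_comp | ].
Qed.

Lemma gap_le_scale k A c : c != 0 -> gap_le k A -> gap_le k (c *: A).
Proof. by move=> c0 [P [d [l [rP gP lk]]]]; exists P, d, l; split=> //; apply: represents_scale. Qed.

Definition bounded_gap f := exists k, forall n a b A,
  is_jonq E (f ^+ n)%g (aff a b) A -> gap_le k A.

Definition commensurable_centralizer f a b := exists2 l, (0 < l)%N &
  forall g be t B, commute g f -> is_jonq E g (aff be t) B -> commensurable a b l be t.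

Lemma bounded_gap_conj f h C : is_jonq E h 1%:M C -> bounded_gap (f ^ h)%g -> bounded_gap f.
Proof.
move=> jh [k fk]; have [_ uC _] := jh.
have [p hp] := gap_le_exists uC; have uC' : invmx C \in unitmx by rewrite unitmx_inv.
have [q hq] := gap_le_exists uC'; exists (p + k + q)%N => n a b A jA.
have [uM uA _] := jA; have a0 : a != 0 by rewrite -(unit_aff a b).
have := is_jonq_conj jA jh; rewrite conjXg => jB; have := fk _ _ _ _ jB; set B := _ *m C => hB.
have -> : A = (C ^^ aff a b) *m B *m invmx C.
  rewrite /B -!mulmxA mulmxV // mulmx1 map_invmx mulKVmx // subst_unitmx //.
have [_ uB _] := jB.
by apply: gap_leM hq => //; [rewrite unitmx_mul subst_unitmx uC uB |
  apply: gap_leM => //; [rewrite subst_unitmx | apply: gap_le_subst]].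
Qed.

Lemma commensurable_centralizer_conj f h C a b : is_jonq E h 1%:M C ->
  commensurable_centralizer (f ^ h)%g a b -> commensurable_centralizer f a b.
Proof.
move=> jh [l l0 fl]; exists l => // g be t B cgf jg.
apply: (fl (g ^ h)%g _ _ _ _ (is_jonq_conj jg jh)).
by rewrite /commute -!conjMg cgf.
Qed.

Lemma aff_mul a b be t : aff a b *m aff be t = aff (a * be) (a * t + b).
Proof. by rewrite mx2_mul /aff; congr mx2; ring. Qed.

Lemma jonq_aff_expg f a b A n : is_jonq E f (aff a b) A ->
  exists a' b' A', is_jonq E (f ^+ n)%g (aff a' b') A'.
Proof.
move=> jf; elim: n => [|n [a' [b' [A' jn]]]].
  by exists 1, 0, 1%:M; have := is_jonq1 E; rewrite scalar_mx2.
exists (a' * a), (a' * b + b'), ((A' ^^ aff a b) *m A).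
by rewrite -aff_mul expgSr; apply: is_jonqM.
Qed.

(** Gaps add up under products, so gap 0 passes to all iterates. *)
Lemma gap0_bounded f a b A : is_jonq E f (aff a b) A -> gap_le 0 A -> bounded_gap f.
Proof.
move=> jf g0; exists 0%N => n a2 b2 A2 jA2.
have [_ uA _] := jf; have a0 : a != 0 by case: jf; rewrite unit_aff.
have [a' [b' [A' [jA' gA']]]] : exists a' b' A', is_jonq E (f ^+ n)%g (aff a' b') A' /\ gap_le 0 A'.
  elim: n {jA2} => [|n [a' [b' [A' [jn gn]]]]].
    exists 1, 0, 1%:M; have := is_jonq1 E; rewrite scalar_mx2; split=> //.
    exists (1%:M), 0%N, 0%N; split=> //; last first.
      by split=> [i j|]; rewrite ?det1 ?size_poly1 // mxE; case: eqP; rewrite ?size_poly1 ?size_poly0.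
    by exists 1; rewrite ?oner_neq0 // /poly_mx map_mx1 scale1r scalar_mx2.
  exists (a' * a), (a' * b + b'), ((A' ^^ aff a b) *m A); split.
    by rewrite -aff_mul expgSr; apply: is_jonqM.
  have [_ uA' _] := jn; apply: (@gap_leM 0 0) => //; first by rewrite subst_unitmx.
  exact: gap_le_subst.
have [_ [c c0 ->]] := is_jonq_uniq jA' jA2; exact: gap_le_scale.
Qed.

Lemma bounded_gap_square f a b A : is_jonq E f (aff a b) A -> bounded_gap (f * f)%g -> bounded_gap f.
Proof.
move=> jf [k fk]; have [_ uA _] := jf; have a0 : a != 0 by case: jf; rewrite unit_aff.
have [m hm] := gap_le_exists uA; exists (k + m)%N => n a2 b2 A2 jA2.
have En : (f ^+ n = (f * f) ^+ n./2 * f ^+ (odd n))%g.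
  by rewrite -expg2 -expgnA -expgnDr mul2n addnC odd_double_half.
have ff : is_jonq E (f * f)%g (aff (a * a) (a * b + b)) ((A ^^ aff a b) *m A).
  by rewrite -aff_mul; apply: is_jonqM.
have [a' [b' [A' jA']]] := jonq_aff_expg n./2 ff; have hA' := fk _ _ _ _ jA'.
have hle j j' B : (j <= j')%N -> gap_le j B -> gap_le j' B.
  by move=> jj [P [d [l [rP gP lj]]]]; exists P, d, l; split=> //; apply: leq_trans jj.
case: (odd n) En => En; rewrite En in jA2.
  have := is_jonqM jA' jf => j2; have [_ [c c0 ->]] := is_jonq_uniq j2 jA2.
  apply: gap_le_scale => //; have [_ uA' _] := jA'; apply: gap_leM => //.
    by rewrite subst_unitmx.
  exact: gap_le_subst.
rewrite expg0 mulg1 in jA2; have [_ [c c0 ->]] := is_jonq_uniq jA' jA2.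
by apply: gap_le_scale => //; apply: hle hA'; rewrite leq_addr.
Qed.

Lemma represents_blowup a b : a != 0 ->
  represents (mx2 1 0 0 (lin a b)) (invmx (mx2 (rf_gen F) 0 0 1) ^^ aff a b).
Proof.
move=> a0; have g0 : rf_gen F != 0.
  by apply/eqP => g0; apply: (@rf_gen_neq_const _ F 0); rewrite g0 rmorph0.
have uD : mx2 (rf_gen F) 0 0 1 \in unitmx by rewrite unitmx2 mulr1 mulr0 subr0.
have rD : represents (mx2 'X 0 0 1) (mx2 (rf_gen F) 0 0 1).
  by exists 1; rewrite ?oner_neq0 // scale1r /poly_mx map_mx2 /= rf_evalX rmorph0 rmorph1.
have := represents_subst b a0 (represents_inv uD rD).
rewrite adj_mx2 /comp_mx map_mx2 /= comp_polyX rmorph1 oppr0 comp_poly0 //.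
Qed.

(* The elementary transformation y |-> x y. *)
Lemma nilpotent_step f a b A P d l : is_jonq E f (aff a b) A -> represents P A ->
  gap d l.+2 P -> top_mx d P = mx2 0 1 0 0 ->
  exists h C B Q, [/\ is_jonq E h 1%:M C, is_jonq E (f ^ h)%g (aff a b) B, represents Q B & gap d l Q].
Proof.
move=> jf rP [sP lP] top; have a0 : a != 0 by case: jf; rewrite unit_aff.
have dP : \det P != 0 by apply: represents_det rP; case: jf.
have g0 : rf_gen F != 0.
  by apply/eqP => g0; apply: (@rf_gen_neq_const _ F 0); rewrite g0 rmorph0.
have uD : mx2 (rf_gen F) 0 0 1 \in unitmx by rewrite unitmx2 mulr1 mulr0 subr0.
have [h jh] := exists_jonq E (unitmx1 K 2) uD.
have jfh := is_jonq_conj jf jh; set B := _ *m _ in jfh.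
exists h, (mx2 (rf_gen F) 0 0 1), B, (mx2 1 0 0 (lin a b) *m P *m mx2 'X 0 0 1); split; [exact: jh | exact: jfh | |].
  apply: representsM; first by apply: representsM => //; apply: represents_blowup.
  by exists 1; rewrite ?oner_neq0 // scale1r /poly_mx map_mx2 /= rf_evalX rmorph0 rmorph1.
have [p00 p01 p10 p11] : [/\ (P ord0 ord0)`_d = 0, (P ord0 ord_max)`_d = 1,
    (P ord_max ord0)`_d = 0 & (P ord_max ord_max)`_d = 0].
  have e i j := congr1 (fun B : 'M[K]_2 => B i j) top.
  have := e ord0 ord0; have := e ord0 ord_max; have := e ord_max ord0; have := e ord_max ord_max.
  by rewrite !mx2E !mxE /= => -> -> -> ->.
have s00 := size_leq_top (sP ord0 ord0) p00; have s10 := size_leq_top (sP ord_max ord0) p10.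
have s11 := size_leq_top (sP ord_max ord_max) p11.
case: d sP lP top p00 p01 p10 p11 s00 s10 s11 => [|d] sP lP top p00 p01 p10 p11 s00 s10 s11.
  by move: lP; rewrite !addnS.
(* As the gap is at least 2, the coefficient of det P just below the top vanishes; given the shape
   of the leading matrix, it is minus the coefficient of x^d in this entry. The entry can then be
   multiplied by two linear factors without exceeding the degree bound, while det P gains degree
   2. *)
have s10' : (size (P ord_max ord0) <= d)%N.
  apply: size_leq_top => //; have : (\det P)`_(d.+1 + d) = 0.
    by rewrite nth_default //; move: lP; move: (size _) => n; lia.
  rewrite det2 coefB !coefM_top // p00 p01 mul0r mul1r sub0r.
  by move/eqP; rewrite oppr_eq0 => /eqP.
have sX (p : {poly K}) n : (size p <= n)%N -> (size (p * 'X)%R <= n.+1)%N.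
  move=> sp; have [->|p0] := eqVneq p 0; first by rewrite mul0r size_poly0.
  by rewrite size_mulX.
have L0 : lin a b != 0 by rewrite -size_poly_eq0 size_lin.
have sL (p : {poly K}) n : (size p <= n)%N -> (size (lin a b * p)%R <= n.+1)%N.
  move=> sp; have [->|p0] := eqVneq p 0; first by rewrite mulr0 size_poly0.
  by rewrite size_mul // size_lin.
split=> [i j|].
  rewrite [P]mx2P !mx2_mul !(mul0r, mulr0, mul1r, mulr1, add0r, addr0) mxE.
  case: ifP => _; case: ifP => _ //; first exact: sX.
    by rewrite -mulrA; apply: sL; apply: sX.
  exact: sL.
rewrite !det_mulmx !det_mx2 !(mul0r, mulr0, mul1r, mulr1, subr0).
rewrite size_mulX ?mulf_neq0 // size_mul // size_lin //.
by move: lP; rewrite !addnS !addSn /= => -[<-].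
Qed.

Lemma constant_conj f a b A P d l (J : 'M[K]_2) : is_jonq E f (aff a b) A -> represents P A ->
  gap d l P -> J \in unitmx ->
  exists h C B Q, [/\ is_jonq E h 1%:M C, is_jonq E (f ^ h)%g (aff a b) B, represents Q B, gap d l Q &
    top_mx d Q = invmx J *m top_mx d P *m J].
Proof.
move=> jf rP [sP lP] uJ; have a0 : a != 0 by case: jf; rewrite unit_aff.
have dP : \det P != 0 by apply: represents_det rP; case: jf.
have uJ' := unit_map_mx F uJ; have [h jh] := exists_jonq E (unitmx1 K 2) uJ'.
have cst (M : 'M[K]_2) : comp_mx a b (map_mx polyC M) = map_mx polyC M.
  by apply/matrixP => i j; rewrite !mxE comp_polyC.
have sC (M : 'M[K]_2) i j : (size (map_mx polyC M i j) <= 1)%N by rewrite mxE size_polyC_leq1.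
have topC (M : 'M[K]_2) : top_mx 0 (map_mx polyC M) = M.
  by apply/matrixP => i j; rewrite !mxE /= coefC.
have gC (M : 'M[K]_2) : M \in unitmx -> \det (map_mx polyC M) != 0 /\ gap 0 0 (map_mx polyC M).
  rewrite unitmxE unitfE => dM; rewrite /gap det_map_mx polyC_eq0 size_polyC dM; split=> //; split.
have uiJ : invmx J \in unitmx by rewrite unitmx_inv.
have jfh := is_jonq_conj jf jh; set B := _ *m _ in jfh.
exists h, (map_mx emb J), B, (map_mx polyC (invmx J) *m P *m map_mx polyC J).
split; [exact: jh | exact: jfh | | |].
- apply: representsM (represents_const F J); apply: representsM rP.
  by rewrite -map_invmx -{1}[map_mx polyC _]cst; apply/represents_subst/represents_const.
- have [d1 g1] := gC _ uiJ; have [d2 g2] := gC _ uJ.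
  have := gapM (d := 0 + d) (l := 0 + l) _ d2 (gapM d1 dP g1 (conj sP lP)) g2.
  by rewrite !addn0 !add0n; apply; rewrite det_mulmx mulf_neq0.
- rewrite -[X in top_mx X _ = _](addn0 d) -[X in top_mx (X + _) _ = _](add0n d).
  rewrite top_mx_mul //; last by move=> i j; apply: size_mx2_mul.
  by rewrite top_mx_mul // !topC.
Qed.

(* The gap decreases by 2 at each elementary transformation, until it is at most 1 or the
   leading matrix is not nilpotent. *)
Lemma infinity_alternative f a b A P d l : is_jonq E f (aff a b) A -> represents P A ->
  gap d l P -> bounded_gap f \/ commensurable_centralizer f a b.
Proof.
elim/ltn_ind: l f A P d => l IHl f A P d jf rP gP; have [sP lP] := gP.
have a0 : a != 0 by case: jf; rewrite unit_aff.
have [_ uA _] := jf; have dP := represents_det uA rP.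
case: l IHl gP lP => [|l] IHl gP lP.
  by left; apply: gap0_bounded jf _; exists P, d, 0%N.
have dT : \det (top_mx d P) = 0.
  by rewrite det_top_mx // nth_default //; move: lP; rewrite addnS => -[<-]; rewrite leq_addr.
have [tT|tT] := eqVneq (\tr (top_mx d P)) 0; last first.
  right; exists l.+1 => // g be t B cgf jg.
  apply: (hyperbolic_centralizer a0 jf rP gP dT tT _ cgf jg).
  by case: jg; rewrite unit_aff.
have TT : top_mx d P *m top_mx d P = 0.
  have := mx2_sandwich (top_mx d P) 1%:M; rewrite !mulmx1 dT tT !scale0r subr0 //.
case: l IHl gP lP => [|l] IHl gP lP.
  (* Gap 1 with nilpotent leading matrix: the square has gap 2 for the degree 2d, but its leading
     matrix vanishes, so the degree bound drops by one and the gap becomes 0. *)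
  left; apply: bounded_gap_square (jf) _.
  have := is_jonqM jf jf; rewrite aff_mul => /gap0_bounded; apply.
  exists (comp_mx a b P *m P), (d + d).-1, 0%N; split=> //.
    by apply: representsM => //; apply: represents_subst.
  have dcP : \det (comp_mx a b P) != 0.
    by rewrite det_comp_mx -size_poly_eq0 size_comp_lin // size_poly_eq0.
  have [sQ lQ] := gapM dcP dP (gap_comp b a0 gP) gP.
  have d0 : (0 < d + d)%N by move: lP; rewrite addn1 => -[<-]; rewrite size_poly_gt0.
  have scP i j : (size (comp_mx a b P i j) <= d.+1)%N by rewrite mxE size_comp_lin.
  split=> [i j|].
    rewrite prednK //; apply: size_leq_top => //.
    have := congr1 (fun B : 'M[K]_2 => B i j) (top_mx_mul scP sP).
    by rewrite top_mx_comp // -scalemxAl TT scaler0 mxE [RHS]mxE.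
  by move: lQ d0; move: (size _) => n; lia.
have IH h C B Q e : is_jonq E h 1%:M C -> is_jonq E (f ^ h)%g (aff a b) B -> represents Q B ->
    gap e l Q -> bounded_gap f \/ commensurable_centralizer f a b.
  move=> jh jB rQ gQ; have [] := IHl l _ _ _ _ _ jB rQ gQ; first by rewrite ltnW.
    by left; apply: bounded_gap_conj jh _.
  by right; apply: commensurable_centralizer_conj jh _.
have [T0|T0] := eqVneq (top_mx d P) 0.
  (* The degree bound was not sharp; lowering it by one lowers the gap by 2. *)
  apply: (IHl l _ f A P d.-1 jf rP); first exact: ltnW.
  case: d sP lP T0 {IH IHl gP dT tT TT} => [|d] sP lP T0; first by move: lP; rewrite addn0 !addnS.
  split=> [i j|]; last by move: lP; rewrite !addnS !addSn /= => -[].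
  by apply: size_leq_top => //; have := congr1 (fun B : 'M[K]_2 => B i j) T0; rewrite !mxE.
have nsc : ~ is_scalar_mx (top_mx d P).
  move/is_scalar_mxP=> [c Ec]; move/eqP: T0; apply; rewrite Ec; move: dT; rewrite Ec det_scalar.
  by move/eqP; rewrite expf_eq0 => /andP[_ /eqP ->]; apply/matrixP => i j; rewrite !mxE mul0rn.
have [||C uC] := @mx2_diagonal_or_jordan _ (top_mx d P) 0 0 _ _ nsc; rewrite ?addr0 ?mul0r ?dT ?tT //.
rewrite eqxx => EC.
have [h [C' [B [Q [jh jB rQ gQ topQ]]]]] := constant_conj jf rP gP uC.
have {}topQ : top_mx d Q = mx2 0 1 0 0 by rewrite topQ -mulmxA EC mulKmx.
have [h' [C'' [B' [Q' [jh' jB' rQ' gQ']]]]] := nilpotent_step jB rQ gQ topQ.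
have := is_jonqM jh jh'; rewrite mul1mx => jhh.
by apply: (IH _ _ B' Q' d jhh _ rQ' gQ'); rewrite conjgM.
Qed.

End InfinityAlternative.




(** * Zeros of the determinant *)

Section Primitive.
Variables (K : closedFieldType) (F : ratfun K).
Implicit Types (P Q : 'M[{poly K}]_2) (A B : 'M[F]_2) (a b x : K).

(** Over an algebraically closed field: the entries have no common factor. *)
Definition primitive P := forall x, exists i j, ~~ root (P i j) x.

Lemma primitive_exists A : A \in unitmx -> exists2 P, represents P A & primitive P.
Proof.
move=> uA; have [P rP] := represents_exists A.
have [n] := ubnP (size (\det P)); elim: n P rP => // n IHn P rP sP.
have dP := represents_det uA rP.
case: (classic (primitive P)) => [pP|nP]; first by exists P.
have [x Px] : exists x, forall i j, root (P i j) x.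
  apply: NNPP => H; apply: nP => x; apply: NNPP => Hx; apply: H; exists x => i j.
  by apply: NNPP => /negP nij; apply: Hx; exists i, j.
pose Q := map_mx (fun p => p %/ ('X - x%:P)) P.
have EP : P = ('X - x%:P) *: Q.
  apply/matrixP => i j; rewrite !mxE mulrC divpK //.
  by have := Px i j; rewrite root_factor_theorem.
apply: (IHn Q).
  case: rP => s s0 ->; exists (s * rf_eval F ('X - x%:P)).
    by rewrite mulf_neq0 // rf_eval_neq0 polyXsubC_eq0.
  by apply/matrixP => i j; rewrite {1}EP !mxE rmorphM /= mulrA.
have dQ : \det Q != 0 by apply: contraNneq dP => dQ; rewrite EP detZ dQ mulr0.
move: sP; rewrite EP detZ expr2 -mulrA !size_mul ?mulf_neq0 ?polyXsubC_eq0 // !size_XsubC.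
by move: (size _) => k; lia.
Qed.

(** After reducing u / v to lowest terms, a root of the new v would be a common root of the entries
    of P; so it is constant. *)
Lemma primitive_dvd P Q (u v : {poly K}) : primitive P -> v != 0 -> u *: P = v *: Q ->
  exists w, Q = w *: P.
Proof.
move=> pP v0 E0; pose g := gcdp u v.
have g0 : g != 0 by rewrite gcdp_eq0 negb_and v0 orbT.
have Eu : u = (u %/ g) * g by rewrite divpK // dvdp_gcdl.
have Ev : v = (v %/ g) * g by rewrite divpK // dvdp_gcdr.
have cop : coprimep (u %/ g) (v %/ g) by apply: coprimep_div_gcd; rewrite v0 orbT.
move: E0 cop; rewrite {1}Eu {1}Ev; set u' := u %/ g; set v' := v %/ g => E0 cop.
have {}E0 : u' *: P = v' *: Q.
  apply/matrixP => i j; apply: (mulIf g0).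
  have := congr1 (fun B : 'M[{poly K}]_2 => B i j) E0; rewrite !mxE.
  by rewrite mulrAC => ->; rewrite mulrAC.
have v'0 : v' != 0 by apply: contraNneq v0 => v'0; rewrite Ev -/v' v'0 mul0r.
have [sv|sv] := eqVneq (size v') 1%N; last first.
  have /closed_rootP[x vx] := sv; have [i [j Pij]] := pP x.
  have := congr1 (fun B : 'M[{poly K}]_2 => (B i j).[x]) E0; rewrite !mxE !hornerM.
  have -> : v'.[x] = 0 by apply/rootP.
  rewrite mul0r => /eqP; rewrite mulf_eq0 -!rootE (negPf Pij) orbF => ux.
  have := coprimep_root cop ux; move: vx; rewrite rootE => /eqP ->.
  by rewrite eqxx.
have [c c0 Ec] : exists2 c, c != 0 & v' = c%:P.
  by move/eqP/size_poly1P: sv => [c c0 Ec]; exists c.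
exists (c^-1%:P * u'); rewrite -scalerA E0 scalerA Ec -polyCM mulVf // scale1r //.
Qed.

(** Dividing by w lowers the degree bound by deg w and the degree of the determinant by 2 deg w. *)
Lemma gap_primitive P Q w d l : \det Q != 0 -> Q = w *: P -> gap d l Q -> exists e, gap e l P.
Proof.
move=> dQ EQ [sQ lQ]; have w0 : w != 0.
  by apply: contraNneq dQ => w0; rewrite EQ w0 scale0r det0.
have dP : \det P != 0 by apply: contraNneq dQ => dP; rewrite EQ detZ dP mulr0.
have P0 : P != 0 by apply: contraNneq dP => ->; rewrite det0.
have wd : (size w <= d.+1)%N.
  have [i [j Pij]] : exists i j, P i j != 0.
    apply: NNPP => H; move/eqP: P0; apply; apply/matrixP => i j; rewrite mxE.
    by apply/eqP/negPn/negP => n0; apply: H; exists i, j.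
  apply: leq_trans (sQ i j); rewrite EQ mxE size_mul // -subn1 -addnBA ?size_poly_gt0 //.
  exact: leq_addr.
exists (d - (size w).-1)%N; split=> [i j|].
  have [->|Pij] := eqVneq (P i j) 0; first by rewrite size_poly0.
  have := sQ i j; rewrite EQ mxE size_mul //; move: w0; rewrite -size_poly_gt0 => w0.
  by move: wd w0; move: (size w) (size (P i j)) => p q; lia.
move: lQ; rewrite EQ detZ expr2 !size_mul ?mulf_neq0 //.
move: w0 dP; rewrite -!size_poly_gt0; move: wd; move: (size w) (size (\det P)) => p q; lia.
Qed.

End Primitive.

(** * Zeros shared by the determinant of an iterate and its transform by g *)

Section CommonRoots.
Variables (K : closedFieldType) (F : ratfun K) (E : ratfun F).
Implicit Types (P Q : 'M[{poly K}]_2) (A B : 'M[F]_2) (a b be t x : K) (f g : Cremona K).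

Lemma closed_field_roots (p : {poly K}) : p != 0 -> exists s : seq K, forall x, (x \in s) = root p x.
Proof.
move=> p0; have [s Es] := closed_field_poly_normal p; exists s => x.
by rewrite Es rootZ ?lead_coef_eq0 // root_prod_XsubC.
Qed.

(** By the chain rule f^n is represented by a product of transforms of P along the orbit, and the
    primitive representative divides this product. *)
Lemma power_det_root f a b A P n a' b' A' Q x : is_jonq E f (aff a b) A -> represents P A ->
  is_jonq E (f ^+ n)%g (aff a' b') A' -> represents Q A' -> primitive Q -> root (\det Q) x ->
  exists i, root (\det P) (iter i (fun z => a * z + b) x).
Proof.
move=> jf rP jn rQ pQ Qx; have a0 : a != 0 by case: jf; rewrite unit_aff.
have [a2 [b2 [A2 [X [j2 rX rootX]]]]] : exists a2 b2 A2 X, [/\ is_jonq E (f ^+ n)%g (aff a2 b2) A2,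
    represents X A2 & forall x, root (\det X) x ->
      exists i, root (\det P) (iter i (fun z => a * z + b) x)].
  elim: n {jn} => [|n [a2 [b2 [A2 [X [j2 rX rootX]]]]]].
    exists 1, 0, 1%:M, 1%:M; split; first by have := is_jonq1 E; rewrite scalar_mx2.
      by exists 1; rewrite ?oner_neq0 // /poly_mx map_mx1 scale1r.
    by move=> y; rewrite det1 (negPf (root1 y)).
  exists (a2 * a), (a2 * b + b2), ((A2 ^^ aff a b) *m A), (comp_mx a b X *m P); split.
  - by rewrite -aff_mul expgSr; apply: is_jonqM.
  - by apply: representsM => //; apply: represents_subst.
  move=> y; rewrite det_mulmx rootM det_comp_mx => /orP[Xy|Py]; last by exists 0%N.
  have [|i Pi] := rootX (a * y + b).
    by move: Xy; rewrite /root horner_comp /lin hornerD hornerM !hornerC hornerX.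
  by exists i.+1; rewrite iterSr.
apply: rootX; have [_ [c c0 Ec]] := is_jonq_uniq jn j2; rewrite Ec in rX.
have [u [v [u0 v0 Euv]]] := represents_cross c0 rQ rX.
have [w ->] := primitive_dvd pQ v0 Euv.
by rewrite detZ rootM Qx orbT.
Qed.

(** Commutation makes adj(Q(M^n x)) P(g x) Q(x) a polynomial multiple of the primitive P. Hence R
    divides det P(g x) det Q(M^n x) det Q(x), and its degree exceeds that of the last two factors
    together. *)
Lemma common_root f g n a b be t A B P Q R : is_jonq E (f ^+ n)%g (aff a b) A ->
  is_jonq E g (aff be t) B -> commute g f -> represents P A -> primitive P -> represents Q B ->
  R %| \det P -> (2 * size (\det Q) < size R)%N -> exists2 x, root R x & root (\det P) (be * x + t).
Proof.
move=> jf jg cgf rP pP rQ RP sR.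
have a0 : a != 0 by case: jf; rewrite unit_aff.
have be0 : be != 0 by case: jg; rewrite unit_aff.
have dQ : \det Q != 0 by apply: represents_det rQ; case: jg.
have cQ : \det Q \Po lin a b != 0 by rewrite -size_poly_eq0 size_comp_lin // size_poly_eq0.
have cgfn : commute g (f ^+ n)%g by apply: commuteX.
have [u [v [u0 v0 Euv]]] := commute_cross a0 be0 jf jg cgfn rP rQ.
have E1 : (u * (\det Q \Po lin a b)) *: P = v *: (\adj (comp_mx a b Q) *m (comp_mx be t P *m Q)).
  rewrite scalemxAr -Euv -scalemxAr mulmxA mul_adj_mx det_comp_mx mul_scalar_mx scalerA //.
have [w Ew] := primitive_dvd pP v0 E1.
have := congr1 determinant Ew; rewrite detZ !det_mulmx.
have -> : \det (\adj (comp_mx a b Q)) = \det Q \Po lin a b.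
  by rewrite [comp_mx a b Q]mx2P adj_mx2 !det_mx2 -det_comp_mx det2; ring.
rewrite det_comp_mx => Edet.
have Rdvd : R %| (\det P \Po lin be t) * ((\det Q \Po lin a b) * \det Q).
  by rewrite mulrCA Edet dvdp_mull.
have [cop|ncop] := boolP (coprimep R (\det P \Po lin be t)).
  move: Rdvd; rewrite Gauss_dvdpr // => /dvdp_leq; rewrite mulf_neq0 // => /(_ isT).
  rewrite size_mul // size_comp_lin //.
  move: sR; move: (size R) (size (\det Q)) => r q; lia.
have := ncop; rewrite coprimep_def => /closed_rootP[x].
rewrite root_gcd => /andP[Rx Px]; exists x => //.
by move: Px; rewrite /root horner_comp /lin hornerD hornerM !hornerC hornerX.
Qed.

(** The factor R collects the zeros that can be used, such as those outside a fixed point of the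
    base action. *)
Definition many_roots f (good : K -> Prop) := forall m, exists n a b A P R,
  [/\ is_jonq E (f ^+ n)%g (aff a b) A /\ represents P A, primitive P, R %| \det P, (m < size R)%N &
      forall x, root R x -> good x].

(** The finite set consists of the zeros of det P for one representative of f, so it serves for all
    g; only the iterate n depends on g. *)
Lemma many_roots_centralizer f a b A good : is_jonq E f (aff a b) A -> many_roots f good ->
  exists s : seq K, forall g be t B, commute g f -> is_jonq E g (aff be t) B ->
  exists x i j, [/\ good x, iter i (fun z => a * z + b) x \in s &
    iter j (fun z => a * z + b) (be * x + t) \in s].
Proof.
move=> jf many; have [P rP] := represents_exists A.
have dP : \det P != 0 by apply: represents_det rP; case: jf.
have [s sP] := closed_field_roots dP; exists s => g be t B cgf jg.
have [Q rQ] := represents_exists B.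
have [n [a' [b' [A' [P' [R [[jn rP'] pP' RP sR goodR]]]]]]] := many (2 * size (\det Q))%N.
have [x Rx Px] := common_root jn jg cgf rP' pP' rQ RP sR.
have P'x : root (\det P') x by apply: root_dvdp Rx.
have [i Pi] := power_det_root jf rP jn rP' pP' P'x.
have [j Pj] := power_det_root jf rP jn rP' pP' Px.
by exists x, i, j; rewrite !sP; split=> //; apply: goodR.
Qed.

End CommonRoots.




(** * Exchanging the two fixed points *)

Section Reversal.
Variables (K : closedFieldType) (F : ratfun K).
Local Notation emb := (rf_emb F).
Local Notation gen := (rf_gen F).
Local Notation ev := (@rf_eval K F).
Implicit Types (p q : {poly K}) (P : 'M[{poly K}]_2) (x : K).

Definition swap : 'M[K]_2 := mx2 0 1 1 0.

Lemma unit_swap : swap \in unitmx.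
Proof. by rewrite unitmx2 mul0r mul1r sub0r oppr_eq0 oner_eq0. Qed.

Definition rev_poly d p := \poly_(i < d.+1) p`_(d - i).

Lemma horner_rev_poly (L : fieldType) (j : {rmorphism K -> L}) d p (z : L) : z != 0 ->
  (size p <= d.+1)%N -> (map_poly j (rev_poly d p)).[z] = z ^+ d * (map_poly j p).[z^-1].
Proof.
move=> z0 sp; have s1 : (size (map_poly j p) <= d.+1)%N by rewrite size_map_poly.
have s2 : (size (map_poly j (rev_poly d p)) <= d.+1)%N by rewrite size_map_poly size_poly.
rewrite (horner_coef_wide _ s1) (horner_coef_wide _ s2) (reindex_inj rev_ord_inj) mulr_sumr.
apply: eq_bigr => i _ /=; rewrite !coef_map /= coef_poly subSS ltnS leq_subr subKn ?leq_ord //.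
rewrite mulrCA; congr (_ * _); have le := leq_ord i.
have -> : z ^+ d = z ^+ (d - i) * z ^+ i by rewrite -exprD subnK.
by rewrite exprVn mulfK // expf_neq0.
Qed.

Lemma gen_neq0 : gen != 0.
Proof. by apply/eqP => g0; apply: (@rf_gen_neq_const _ F 0); rewrite g0 rmorph0. Qed.

Lemma subst_swap p : subst F swap (ev p) = (map_poly emb p).[gen^-1].
Proof.
rewrite {1}/rf_eval -horner_map -map_poly_comp; congr _.[_].
  by apply: eq_map_poly => c /=; rewrite subst_const // unit_swap.
rewrite subst_gen ?unit_swap // /homography !mxE /= rmorph0 rmorph1.
by rewrite mul0r mul1r add0r addr0 div1r.
Qed.

Lemma rf_eval_rev_poly d p : (size p <= d.+1)%N ->
  ev (rev_poly d p) = gen ^+ d * subst F swap (ev p).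
Proof. by move=> sp; rewrite subst_swap -horner_rev_poly ?gen_neq0. Qed.

Definition rev_mx d P := map_mx (rev_poly d) P.

Lemma represents_swap P (A : 'M[F]_2) d : (forall i j, (size (P i j) <= d.+1)%N) -> represents P A ->
  represents (rev_mx d P) (A ^^ swap).
Proof.
move=> sP [s s0 ->]; exists (subst F swap s / gen ^+ d).
  by rewrite mulf_neq0 ?invr_eq0 ?expf_neq0 ?gen_neq0 ?fmorph_eq0.
apply/matrixP => i j; rewrite !mxE rmorphM /= rf_eval_rev_poly // mulrA divfK //.
by rewrite expf_neq0 ?gen_neq0.
Qed.

Lemma det_rev_mx P d : (forall i j, (size (P i j) <= d.+1)%N) ->
  \det (rev_mx d P) = rev_poly (d + d) (\det P).
Proof.
move=> sP; apply: (@rf_eval_inj _ F); rewrite rf_eval_rev_poly ?size_det_le //.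
rewrite !det2 !(rmorphB, rmorphM) /= !mxE !rf_eval_rev_poly // exprD; ring.
Qed.

Lemma rev_mx_primitive P d : (forall i j, (size (P i j) <= d.+1)%N) -> top_mx d P != 0 ->
  primitive P -> primitive (rev_mx d P).
Proof.
move=> sP tP pP x; have [->|x0] := eqVneq x 0.
  apply: NNPP => H; move/eqP: tP; apply; apply/matrixP => i j; rewrite !mxE /=.
  apply/eqP/negPn/negP => n0; apply: H; exists i, j.
  by rewrite /root mxE horner_coef0 coef_poly subn0.
have [i [j Pij]] := pP x^-1; exists i, j; rewrite /root mxE.
have := horner_rev_poly idfun x0 (sP i j); rewrite !map_poly_id // => ->.
by rewrite mulf_neq0 ?expf_neq0.
Qed.

(* The order of vanishing of [\det P] at 0 is the gap at infinity after the exchange x |-> 1/x. *)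
Lemma gap_rev_mx P d e l m R : (forall i j, (size (P i j) <= d.+1)%N) -> \det P != 0 ->
  primitive P -> \det P = R * 'X^m -> gap e l (rev_mx d P) -> (m <= l)%N.
Proof.
move=> sP dP pP ER [sQ lQ]; have [i [j Pij]] := pP 0.
(* As P(0) is nonzero, some entry of the reversed matrix has degree exactly d. *)
have de : (d <= e)%N.
  rewrite -ltnS; apply: leq_trans (sQ i j); rewrite ltnNge; apply: contra Pij => sd.
  have : (rev_mx d P i j)`_d = 0 by rewrite nth_default.
  by rewrite mxE coef_poly ltnSn subnn /root horner_coef0 => ->.
have R0 : R != 0 by apply: contraNneq dP => R0; rewrite ER R0 mul0r.
have sd := size_det_le sP; have sm : (m <= d + d)%N.
  move: sd; rewrite ER size_mulXn //; move: R0; rewrite -size_poly_gt0.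
  by move: (size R) => r; lia.
have : (size (\det (rev_mx d P)) <= (d + d).+1 - m)%N.
  rewrite det_rev_mx //; apply/leq_sizeP => k km; rewrite coef_poly.
  case: ltnP => // kd; rewrite ER coefMXn ifT //; move: km kd sm; lia.
move: lQ de sm; move: (size _) => r; lia.
Qed.

End Reversal.




(** * Multipliers of the centralizer *)

Section Multipliers.
Variables (K : closedFieldType) (F : ratfun K) (E : ratfun F).
Implicit Types (P Q : 'M[{poly K}]_2) (A B : 'M[F]_2) (a b be t x : K) (f g c : Cremona K).

Lemma bounded_gap_primitive f : bounded_gap E f -> exists k, forall n a b A P,
  is_jonq E (f ^+ n)%g (aff a b) A -> represents P A -> primitive P ->
  exists e l, (l <= k)%N /\ gap e l P.
Proof.
move=> [k fk]; exists k => n a b A P jn rP pP; have [_ uA _] := jn.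
have [Q [d [l [rQ gQ lk]]]] := fk _ _ _ _ jn.
rewrite -[A]scale1r in rQ.
have [u [v [u0 v0 Euv]]] := represents_cross (oner_neq0 F) rP rQ; rewrite scale1r in rQ.
have [w Ew] := primitive_dvd pP v0 Euv.
have [e gP] := gap_primitive (represents_det uA rQ) Ew gQ.
by exists e, l.
Qed.

(** The gap and the degree of the determinant add up to twice the degree bound of the entries; if
    both were bounded, so would be the heights. *)
Lemma dets_unbounded f : unbounded_growth E f -> bounded_gap E f -> forall m, exists n,
  forall a b A P, is_jonq E (f ^+ n)%g (aff a b) A -> represents P A -> primitive P ->
  (m < size (\det P))%N.
Proof.
move=> uf bf m; have [k fk] := bounded_gap_primitive bf; have [n nP] := uf (m + k)%N.
exists n => a b A P jn rP pP; have [e [l [lk [sP lP]]]] := fk _ _ _ _ _ jn rP pP.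
rewrite ltnNge; apply/negP => dm; apply: (nP _ _ jn).
case: rP => s s0 EA; exists P, s; split=> // i j; apply: leq_trans (sP i j) _.
move: lP dm lk; move: (size _) => r; lia.
Qed.

Lemma jonq_scaling_expg f a A n : is_jonq E f (aff a 0) A ->
  exists A', is_jonq E (f ^+ n)%g (aff (a ^+ n) 0) A'.
Proof.
move=> jf; elim: n => [|n [A' jn]].
  by exists 1%:M; have := is_jonq1 E; rewrite scalar_mx2.
exists ((A' ^^ aff a 0) *m A); have := is_jonqM jn jf.
by rewrite aff_mul mulr0 addr0 -exprSr -expgSr.
Qed.

Lemma jonq_swap f a A c : is_jonq E c (swap K) 1%:M -> is_jonq E f (aff a 0) A ->
  is_jonq E (f ^ c)%g (aff a^-1 0) (A ^^ swap K).
Proof.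
move=> jc jf; have a0 : a != 0 by case: jf; rewrite unit_aff.
have uS := unit_swap K.
have SS : swap K *m swap K = 1%:M by rewrite mx2_mul scalar_mx2; congr mx2; ring.
have VS : invmx (swap K) = swap K by rewrite -[RHS](mulKmx uS) SS mulmx1.
have := is_jonqM (is_jonqV jc) (is_jonqM jf jc); rewrite -conjgE VS.
rewrite (_ : invmx _ = 1%:M) ?map_mx1 ?mul1mx ?mulmx1; last by rewrite invmx1.
rewrite (_ : swap K *m _ = a *: aff a^-1 0); last first.
  by rewrite !mx2_mul scale_mx2; congr mx2; rewrite ?mulfV //; ring.
move=> j; have := is_jonq_scale (_ : a^-1 != 0) (oner_neq0 F) j.
by rewrite invr_eq0 scale1r scalerA mulVf // scale1r; apply.
Qed.

(** Write k = l q + r with r < l: then be / a^q is an l-th root of a^r, and there are finitely many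
    of these. The second alternative adds their inverses. *)
Lemma scaling_commensurable a l : (0 < l)%N -> a != 0 -> exists s : seq K,
  forall be, be != 0 -> commensurable a 0 l be 0 -> exists q i j, q \in s /\ be * a ^+ i = q * a ^+ j.
Proof.
move=> l0 a0; pose p : {poly K} := \prod_(r < l) ('X^l - (a ^+ r)%:P).
have p0 : p != 0.
  by apply/prodf_neq0 => r _; rewrite -size_poly_eq0 size_XnsubC.
have [s sP] := closed_field_roots p0.
have sE z k : z ^+ l = a ^+ k -> z / a ^+ (k %/ l) \in s.
  move=> Ez; rewrite sP /root horner_prod; apply/eqP.
  have lt : (k %% l < l)%N by rewrite ltn_mod.
  rewrite (bigD1 (Ordinal lt)) //= !(hornerE, hornerXn) expr_div_n Ez -exprM.
  by rewrite {1}(divn_eq k l) exprD mulrAC mulfV ?mul1r ?expf_neq0 // subrr mul0r.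
exists (s ++ [seq z^-1 | z <- s]) => be be0 [] [k [Ek _]].
  exists (be / a ^+ (k %/ l)), 0%N, (k %/ l)%N; rewrite mem_cat sE //.
  by rewrite mulr1 divfK // expf_neq0.
have {}Ek : be^-1 ^+ l = a ^+ k.
  by apply: (mulfI (expf_neq0 l be0)); rewrite Ek -exprMn mulfV // expr1n.
exists (be^-1 / a ^+ (k %/ l))^-1, (k %/ l)%N, 0%N; rewrite mem_cat map_f ?orbT ?sE //.
by rewrite mulr1 invf_div invrK mulrC.
Qed.

Lemma translation_commensurable l : (0 < l)%N -> (forall n, (0 < n)%N -> n%:R != 0 :> K) ->
  exists s : seq K, forall t, commensurable 1 1 l 1 t -> exists q i j, q \in s /\ t + i%:R = q + j%:R.
Proof.
move=> l0 ch0; have l0' := ch0 l l0; exists ([seq r%:R / l%:R | r <- iota 0 l] ++ [seq - (r%:R / l%:R) | r <- iota 0 l]).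
have div k : k%:R = ((k %/ l)%:R + (k %% l)%:R / l%:R) * l%:R :> K.
  by rewrite mulrDl divfK // -natrM -natrD -divn_eq.
have mem k : (k %% l)%N \in iota 0 l by rewrite mem_iota ltn_mod.
move=> t [] [k [_ /(_ erefl erefl)]]; rewrite mul1r (div k) => Et.
  exists ((k %% l)%:R / l%:R), 0%N, (k %/ l)%N; split.
    by rewrite mem_cat; apply/orP; left; apply/mapP; exists (k %% l)%N.
  by rewrite addr0 addrC; apply: (mulIf l0').
exists (- ((k %% l)%:R / l%:R)), (k %/ l)%N, 0%N; split.
  by rewrite mem_cat; apply/orP; right; apply/mapP; exists (k %% l)%N.
move: Et => /eqP; rewrite -mulrDl mulf_eq0 (negPf l0') orbF addrA => /eqP/addr0_eq <-.
by rewrite opprK addr0.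
Qed.

(** The alternative at infinity is applied to f and to its conjugate by x |-> 1/x. If the gaps are
    bounded at both fixed points, the determinants of the iterates have unboundedly many nonzero
    zeros, counted with multiplicity. *)
Lemma scaling_multipliers f a A : is_jonq E f (aff a 0) A -> unbounded_growth E f ->
  exists s : seq K, forall g be B, commute g f -> is_jonq E g (aff be 0) B ->
  exists q i j, q \in s /\ be * a ^+ i = q * a ^+ j.
Proof.
move=> jf uf; have a0 : a != 0 by case: jf; rewrite unit_aff.
have [c jc] := exists_jonq E (unit_swap K) (unitmx1 F 2).
have jf' := jonq_swap jc jf.
have infinity h a' B : is_jonq E h (aff a' 0) B -> bounded_gap E h \/ commensurable_centralizer E h a' 0.
  move=> jh; have [P rP] := represents_exists B; have [_ uB _] := jh.
  have [d [l [gP _]]] := gap_exists (represents_det uB rP).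
  exact: infinity_alternative jh rP gP.
have [bf|[l l0 comm]] := infinity _ _ _ jf; last first.
  have [s sP] := scaling_commensurable l0 a0; exists s => g be B cgf jg.
  by apply: sP (comm _ _ _ _ cgf jg); case: jg; rewrite unit_aff.
have [bf'|[l l0 comm]] := infinity _ _ _ jf'; last first.
  have [s sP] := scaling_commensurable l0 a0; exists s => g be B cgf jg.
  have be0 : be != 0 by case: jg; rewrite unit_aff.
  apply: sP => //; have cgf' : commute (g ^ c)%g (f ^ c)%g by rewrite /commute -!conjMg cgf.
  have trivial2 k : a = 1 -> be = 1 -> 0 * l%:R = 0 * k%:R :> K by rewrite !mul0r.
  have trivial3 k : a = 1 -> be = 1 -> 0 * l%:R + 0 * k%:R = 0 :> K by rewrite !mul0r addr0.
  case: (comm _ _ _ _ cgf' (jonq_swap jc jg)) => [] [k [Ek _]]; [left|right]; exists k.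
    by split; [apply: invr_inj; rewrite -!exprVn | exact: trivial2].
  by split; [rewrite -[LHS]invrK invfM -!exprVn Ek invr1 | exact: trivial3].
have [k' fk'] := bounded_gap_primitive bf'.
have many : many_roots E f (fun x => x != 0).
  move=> m; have [n nP] := dets_unbounded uf bf (m + k')%N.
  have [A' jn] := jonq_scaling_expg n jf; have [_ uA' _] := jn.
  have [P rP pP] := primitive_exists uA'; have dP := represents_det uA' rP.
  (* R is det P without its zeros at 0; by [gap_rev_mx] their number is at most the gap after the
     exchange, so R keeps a large degree. *)
  have [e [R R0 ER]] := multiplicity_XsubC (\det P) 0; rewrite dP /= in R0.
  rewrite subr0 in ER.
  have [d [l [[sP _] tP]]] := gap_exists dP.
  have := jonq_swap jc jn; rewrite conjXg => jn'.
  have [e' [l' [lk' gR]]] := fk' _ _ _ _ _ jn' (represents_swap sP rP) (rev_mx_primitive sP tP pP).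
  have el := gap_rev_mx F sP dP pP ER gR.
  exists n, (a ^+ n), 0, A', P, R; split=> //.
  - by rewrite ER dvdp_mulr.
  - have := nP _ _ _ _ jn rP pP; rewrite ER size_mulXn; last first.
      by apply: contraNneq dP => R00; rewrite ER R00 mul0r.
    by move: (leq_trans el lk'); move: (size R) => r; lia.
  - by move=> x Rx; apply: contraNneq R0 => <-.
have [s sP] := many_roots_centralizer jf many.
have it i x : iter i (fun z => a * z + 0) x = a ^+ i * x.
  by elim: i => [|i IHi]; rewrite ?mul1r //= IHi addr0 exprS mulrA.
(* Both a^i x and a^j be x lie in s, and x is nonzero, so be is a quotient of elements of s up to a
   power of a. *)
exists [seq z.2 / z.1 | z <- [seq (x, y) | x <- s, y <- s]] => g be B cgf jg.
have [x [i [j [x0]]]] := sP _ _ _ _ cgf jg; rewrite !it addr0 => si sj.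
exists (a ^+ j * (be * x) / (a ^+ i * x)), j, i; split.
  apply/mapP; exists (a ^+ i * x, a ^+ j * (be * x)) => //.
  by apply/allpairsP; exists (a ^+ i * x, a ^+ j * (be * x)).
by field; rewrite x0 expf_neq0.
Qed.

(** Infinity is the only fixed point of a translation, so every affine zero of the determinants can
    be used. *)
Lemma translation_multipliers f A : (forall n, (0 < n)%N -> n%:R != 0 :> K) ->
  is_jonq E f (aff 1 1) A -> unbounded_growth E f ->
  exists s : seq K, forall g t B, commute g f -> is_jonq E g (aff 1 t) B ->
  exists q i j, q \in s /\ t + i%:R = q + j%:R.
Proof.
move=> ch0 jf uf; have [P rP] := represents_exists A; have [_ uA _] := jf.
have [d [l [gP _]]] := gap_exists (represents_det uA rP).
have [bf|[l' l0 comm]] := infinity_alternative jf rP gP; last first.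
  have [s sP] := translation_commensurable l0 ch0; exists s => g t B cgf jg.
  by apply: sP (comm _ _ _ _ cgf jg).
have many : many_roots E f (fun x => True).
  move=> m; have [n nP] := dets_unbounded uf bf m.
  have [a' [b' [A' jn]]] := jonq_aff_expg n jf; have [_ uA' _] := jn.
  have [Q rQ pQ] := primitive_exists uA'.
  by exists n, a', b', A', Q, (\det Q); split=> //; apply: nP jn rQ pQ.
have [s sP] := many_roots_centralizer jf many.
have it i x : iter i (fun z => 1 * z + 1) x = x + i%:R.
  by elim: i => [|i IHi]; rewrite ?addr0 //= IHi mul1r -addrA -mulrSr.
exists [seq z.2 - z.1 | z <- [seq (x, y) | x <- s, y <- s]] => g t B cgf jg.
have [x [i [j [_]]]] := sP _ _ _ _ cgf jg; rewrite !it mul1r => si sj.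
exists ((x + t + j%:R) - (x + i%:R)), j, i; split; last by ring.
apply/mapP; exists (x + i%:R, x + t + j%:R) => //.
by apply/allpairsP; exists (x + i%:R, x + t + j%:R).
Qed.

End Multipliers.




(** * Extensions of Z by a finite cyclic group *)

Lemma least_witness (P : nat -> Prop) n : P n -> exists2 m, P m & forall k, P k -> (m <= k)%N.
Proof.
elim/ltn_ind: n => n IHn Pn; case: (classic (exists2 m, (m < n)%N & P m)) => [[m mn]|H].
  exact: IHn.
by exists n => // k Pk; rewrite leqNgt; apply/negP => kn; apply: H; exists k.
Qed.

Section IntegerPowers.
Variable G : groupType.
Implicit Types (g h : G) (u v : int).
Local Open Scope group_scope.

Definition zpow g v := match v with Posz n => g ^+ n | Negz n => g ^- n.+1 end.

Lemma zpow_sub g m n : zpow g (Posz m - Posz n)%R = g ^+ m * g ^- n.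
Proof.
case: (leqP n m) => [nm|mn]; first by rewrite subzn // /zpow expgnFr.
rewrite -opprB subzn ?(ltnW mn) //.
have : (0 < n - m)%N by rewrite subn_gt0.
case E : (n - m)%N => [//|k] _; rewrite -NegzE /zpow -E expgnFr ?(ltnW mn) // invgM invgK //.
Qed.

Lemma int_sub v : exists m n, v = (Posz m - Posz n)%R.
Proof.
by case: v => n; [exists n, 0%N; rewrite subr0 | exists 0%N, n.+1; rewrite sub0r -NegzE].
Qed.

Lemma zpowD g u v : zpow g (u + v)%R = zpow g u * zpow g v.
Proof.
have [m [n ->]] := int_sub u; have [m' [n' ->]] := int_sub v.
rewrite addrACA -opprD -!PoszD !zpow_sub [(n + n')%N]addnC !expgnDr invgM !mulgA; congr (_ * _).
rewrite -!mulgA; congr (_ * _); apply: commuteV; exact: commuteX2.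
Qed.

Lemma zpowXl g d v : zpow (g ^+ d) v = zpow g (Posz d * v)%R.
Proof.
by have [m [n ->]] := int_sub v; rewrite mulrBr -!PoszM !zpow_sub -!expgnA.
Qed.

Lemma zpowX g d v : zpow g v ^+ d = zpow (g ^+ d) v.
Proof. by case: v => n; rewrite /zpow ?expVgn expgnAC. Qed.

End IntegerPowers.

Section FiniteByCyclic.
Variables (G : groupType) (S : G -> Prop) (a : G).
Local Open Scope group_scope.
Hypotheses (S1 : S 1) (SM : forall g h, S g -> S h -> S (g * h)) (SV : forall g, S g -> S g^-1).
Hypotheses (Scomm : forall g h, S g -> S h -> commute g h) (Sa : S a).
Hypothesis a_inf : forall n, (0 < n)%N -> a ^+ n <> 1.

Let SX g n : S g -> S (g ^+ n).
Proof. by move=> Sg; elim: n => [|n Sn] //; rewrite expgS; apply: SM. Qed.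

Let SZ g v : S g -> S (zpow g v).
Proof. by case: v => n Sg; rewrite /zpow; [|apply: SV]; apply: SX. Qed.

Let zpow_inj u v : zpow a u = zpow a v -> u = v.
Proof.
move=> E; apply/eqP; rewrite -subr_eq0; apply/eqP.
have : zpow a (u - v)%R = 1 by rewrite zpowD E -zpowD subrr.
case: (u - v)%R => n; rewrite /zpow => En; last by case: (a_inf (ltn0Sn n)); rewrite -[LHS]invgK En invg1.
by case: n En => // n /(a_inf (ltn0Sn n)).
Qed.

(** One representative is kept for each label q in s that occurs; elements with the same label
    differ by a power of a. *)
Lemma finite_cosets (T : eqType) (rel : G -> T -> Prop) (s : seq T) :
  (forall g h q, S g -> S h -> rel g q -> rel h q -> exists i j, g * a ^+ i = h * a ^+ j) ->
  (forall g, S g -> exists2 q, q \in s & rel g q) ->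
  exists2 l : seq G, (forall h, h \in l -> S h) &
    forall g, S g -> exists2 h, h \in l & exists v, g = h * zpow a v.
Proof.
move=> relP cov.
have [l lS lP] : exists2 l : seq G, (forall h, h \in l -> S h) &
    forall g, S g -> (exists2 q, q \in s & rel g q) -> exists2 h, h \in l & exists v, g = h * zpow a v.
  elim: s {cov} => [|q s [l lS lP]]; first by exists [::] => // g _ [].
  case: (classic (exists2 h, S h & rel h q)) => [[h Sh hq]|H]; last first.
    exists l => // g Sg [q']; rewrite inE => /orP[/eqP->|q's gq']; first by move=> gq; case: H; exists g.
    by apply: lP => //; exists q'.
  exists (h :: l) => [h'|g Sg [q']]; first by rewrite inE => /orP[/eqP->|/lS].
  rewrite inE => /orP[/eqP->|q's] gq'.
    have [i [j E]] := relP g h q Sg Sh gq' hq; exists h; first by rewrite inE eqxx.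
    by exists (Posz j - Posz i)%R; rewrite zpow_sub mulgA -E mulgK.
  have [|h' h'l E] := lP g Sg; first by exists q'.
  by exists h' => //; rewrite inE h'l orbT.
by exists l => // g Sg; apply: lP => //; apply: cov.
Qed.

Variable l : seq G.
Hypothesis lS : forall h, h \in l -> S h.
Hypothesis lP : forall g, S g -> exists2 h, h \in l & exists v, g = h * zpow a v.

Lemma finite_index_cyclic : finite_index_in (cyclic_subset a) S.
Proof.
split=> [g [n [->|->]]|]; [exact: SX | by apply: SV; exact: SX |].
exists l => // g /lP[h hl [v ->]]; exists h => //; rewrite mulKg.
by case: v => n; [exists n; left | exists n.+1; right].
Qed.

(** Two of the powers of g of exponent at most [size l] lie in the same coset. Their difference of
    exponents divides the factorial, which gives an exponent independent of g. *)
Lemma power_in_cyclic g : S g -> exists2 v, (0 < size l)%N & g ^+ (size l)`! = zpow a v.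
Proof.
move=> Sg; have l0 : (0 < size l)%N by have [h] := lP S1; case: l.
have [c cP] : exists c : 'I_(size l).+1 -> 'I_(size l),
    forall x : 'I_(size l).+1, exists v, g ^+ x = nth 1 l (c x) * zpow a v.
  apply: (@fin_all_exists 'I_(size l).+1 (fun=> 'I_(size l)) (fun x i => exists v, g ^+ x = nth 1 l i * zpow a v)) => x; have [h hl hv] := lP (SX x Sg).
  have hi : (index h l < size l)%N by rewrite index_mem.
  by exists (Ordinal hi); rewrite /= nth_index.
have [inj|/injectivePn[x [y xy Exy]]] := boolP (injectiveb c).
  by have := leq_card c (injectiveP _ inj); rewrite !card_ord ltnn.
wlog lt : x y xy Exy / (x < y)%N.
  move=> W; case: (ltngtP x y) => [|lt|E]; first exact: W.
    by apply: (W y x) => //; rewrite eq_sym.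
  by move: xy; rewrite (val_inj E) eqxx.
have [u Eu] := cP x; have [v Ev] := cP y; rewrite -Exy in Ev.
have Eyx : g ^+ (y - x) = zpow a (v - u)%R.
  apply: (mulgI (g ^+ x)); rewrite -expgnDr subnKC ?(ltnW lt) // Ev Eu -mulgA -zpowD.
  by congr (_ * zpow a _); rewrite addrC subrK.
have dv : (y - x %| (size l)`!)%N.
  rewrite dvdn_fact // subn_gt0 lt /=; apply: leq_trans (leq_subr _ _) _.
  by rewrite -ltnS.
exists (Posz ((size l)`! %/ (y - x)) * (v - u))%R => //.
by rewrite -{1}(divnK dv) mulnC expgnA Eyx zpowX zpowXl.
Qed.

(** Let b satisfy b^M = a^d with d > 0 least. Every g^M is a power of a, and division by d shows
    that g times a power of b is killed by M, hence is a power of t. *)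
Lemma finite_cyclic_times_Z :
  (forall M, (0 < M)%N -> exists t n, [/\ S t, t ^+ n.+1 = 1,
     forall i j, (i <= n)%N -> (j <= n)%N -> t ^+ i = t ^+ j -> i = j &
     forall g, S g -> g ^+ M = 1 -> exists i, g = t ^+ i]) ->
  iso_finite_cyclic_times_Z S.
Proof.
move=> torsion; set M := (size l)`!; have M0 : (0 < M)%N := fact_gt0 _.
have [t [n [St tn t_inj tP]]] := torsion M M0.
pose D d := (0 < d)%N /\ exists2 g, S g & g ^+ M = a ^+ d.
have DM : D M by split=> //; exists a.
have [d [d0 [b Sb Eb]] dmin] := least_witness DM.
have decomp g : S g -> exists v, (g * zpow b (- v)%R) ^+ M = 1.
  move=> Sg; have [w _ Ew] := power_in_cyclic Sg; exists (w %/ d)%Z.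
  have E : (g * zpow b (- (w %/ d)%Z)) ^+ M = zpow a (w %% d)%Z.
    rewrite expgMn; last by apply: Scomm => //; apply: SZ.
    rewrite Ew zpowX Eb zpowXl -zpowD; congr zpow.
    by rewrite {1}(divz_eq w d) mulrN [(Posz d * _)%R]mulrC addrAC subrr add0r.
  have d0' : Posz d != 0%R by rewrite eqz_nat -lt0n.
  have := modz_ge0 w d0'; have : ((w %% d)%Z < d)%R by rewrite ltz_pmod.
  case Er : (w %% d)%Z E => [r|r] // E rd _; rewrite E.
  case: r {Er} E rd => [|r] E rd; first by rewrite /zpow expg0.
  have := dmin r.+1; rewrite leqNgt; move: rd; rewrite ltz_nat => ->; move/(_ _)/implyP.
  move=> H; suff /H : D r.+1 by [].
  by split=> //; exists (g * zpow b (- (w %/ d)%Z)) => //; apply: SM => //; apply: SZ.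
pose phi (u : 'I_n.+1 * int) := t ^+ u.1 * zpow b u.2.
have tmod i : t ^+ (i %% n.+1) = t ^+ i.
  by rewrite {2}(divn_eq i n.+1) expgnDr mulnC expgnA tn expg1n mul1g.
exists n, phi; split.
- move=> [i u] [j v]; rewrite /phi /= zpowD tmod expgnDr -!mulgA; congr (_ * _).
  by rewrite !mulgA; congr (_ * _); apply: Scomm; [apply: SX | apply: SZ].
(* This power kills the torsion part and leaves a power of a that determines u. *)
- have phiX i u : (t ^+ i * zpow b u) ^+ n.+1 ^+ M = zpow a (Posz (d * n.+1) * u)%R.
    rewrite expgMn; last by apply: Scomm; [apply: SX | apply: SZ].
    by rewrite expgnAC tn expg1n mul1g zpowX zpowX expgnAC Eb -expgnA zpowXl.
  move=> [i u] [j v]; rewrite /phi /= => E.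
  have Euv : u = v.
    have := phiX i u; rewrite E phiX => /zpow_inj /(mulfI _) -> //.
    by rewrite eqz_nat muln_eq0 negb_or -!lt0n d0.
  move: E; rewrite Euv => /mulIg /t_inj; rewrite !leq_ord => /(_ isT isT) Eij.
  by congr pair; apply: val_inj.
- move=> g; split=> [Sg|[[i v] ->]]; last by apply: SM; [apply: SX | apply: SZ].
  have [v Ev] := decomp g Sg; have [|i Ei] := tP _ _ Ev; first by apply: SM => //; apply: SZ.
  have lt : (i %% n.+1 < n.+1)%N by rewrite ltn_mod.
  exists (Ordinal lt, v); rewrite /phi /= tmod -Ei -mulgA -zpowD addNr.
  by rewrite (_ : zpow b 0%R = 1) ?mulg1.
Qed.

End FiniteByCyclic.




(** As P is an arbitrary proposition, r is built by case analysis instead of with [filter]. *)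
Lemma seq_comprehension (T : eqType) (P : T -> Prop) (s : seq T) :
  exists2 r, uniq r & forall x, x \in r <-> x \in s /\ P x.
Proof.
elim: s => [|y s [r ur rP]]; first by exists [::] => // x; split=> [|[]].
have [ys|ys] := boolP (y \in s).
  exists r => // x; rewrite inE rP; split=> [[-> Px]|[/orP[/eqP->|xs] Px]] //.
  by rewrite orbT.
case: (classic (P y)) => [Py|nPy].
  exists (y :: r) => [|x]; first by rewrite /= ur andbT; apply/negP => /rP[]; rewrite (negPf ys).
  rewrite !inE; split=> [/orP[/eqP->|/rP[-> Px]]|[/orP[->|xs] Px]] //.
  - by rewrite eqxx.
  - by rewrite orbT.
  - by apply/orP; right; apply/rP.
exists r => // x; rewrite inE rP; split=> [[-> Px]|[/orP[/eqP->|xs] Px]] //.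
by rewrite orbT.
Qed.

(** * Subgroups of K^* and of K *)

Section MultiplicativeCharacter.
Variables (G : groupType) (S : G -> Prop) (a : G) (K : closedFieldType) (chi : G -> K).
Hypotheses (S1 : S 1%g) (SM : forall g h, S g -> S h -> S (g * h)%g) (SV : forall g, S g -> S g^-1%g).
Hypotheses (Sa : S a) (chiM : forall g h, S g -> S h -> chi (g * h)%g = chi g * chi h).
Hypothesis chi0 : forall g, S g -> chi g != 0.
Hypothesis chi_inj : forall g h, S g -> S h -> chi g = chi h -> g = h.

Let SX g n : S g -> S (g ^+ n)%g.
Proof. by move=> Sg; elim: n => [|n Sn] //; rewrite expgS; apply: SM. Qed.

Let chi1 : chi 1%g = 1.
Proof. by apply: (mulfI (chi0 S1)); rewrite -chiM // mul1g mulr1. Qed.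

Let chiX g n : S g -> chi (g ^+ n)%g = chi g ^+ n.
Proof. by move=> Sg; elim: n => [|n IHn]; rewrite ?chi1 // expgS chiM ?IHn ?exprS //; apply: SX. Qed.

Let Scomm g h : S g -> S h -> commute g h.
Proof. by move=> Sg Sh; apply: chi_inj; rewrite ?chiM 1?mulrC //; apply: SM. Qed.

(** The values of [chi] on M-torsion elements form a finite subgroup of K^*, which is cyclic; t lies
    over a generator. *)
Lemma torsion_cyclic M : (0 < M)%N -> exists t n, [/\ S t, (t ^+ n.+1 = 1)%g,
  forall i j, (i <= n)%N -> (j <= n)%N -> (t ^+ i = t ^+ j)%g -> i = j &
  forall g, S g -> (g ^+ M = 1)%g -> exists i, g = (t ^+ i)%g].
Proof.
move=> M0; have p0 : ('X^M - 1%:P : {poly K}) != 0 by rewrite -size_poly_eq0 size_XnsubC.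
have [s sP] := closed_field_roots p0.
have [r ur rP] := seq_comprehension (fun z => exists2 g, S g & chi g = z) s.
have sE z : (z \in s) = (z ^+ M == 1).
  by rewrite sP /root !(hornerE, hornerXn) subr_eq0.
have rM z w : z \in r -> w \in r -> z * w \in r.
  move=> /rP[zs [g Sg Eg]] /rP[ws [h Sh Eh]]; apply/rP; split; last first.
    by exists (g * h)%g; rewrite ?chiM ?Eg ?Eh //; apply: SM.
  by move: zs ws; rewrite !sE exprMn => /eqP-> /eqP->; rewrite mulr1.
have r1 : 1 \in r by apply/rP; split; [rewrite sE expr1n | exists 1%g].
have r0 z : z \in r -> z != 0 by move=> /rP[_ [g Sg <-]]; apply: chi0.
(* Multiplication by z permutes r and so preserves the nonzero product of its elements. *)
have rX z : z \in r -> z ^+ size r = 1.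
  move=> zr; have zI : injective ( *%R z) by apply/mulfI/r0.
  have um : uniq (map ( *%R z) r) by rewrite map_inj_uniq.
  have sub : {subset map ( *%R z) r <= r} by move=> _ /mapP[w wr ->]; apply: rM.
  have [_ Em] := uniq_min_size um sub (eq_leq (esym (size_map _ _))).
  have pm : perm_eq (map ( *%R z) r) r by apply: uniq_perm.
  have P0 : \prod_(x <- r) x != 0 by rewrite prodf_seq_neq0; apply/allP => x xr; apply: r0.
  apply: (mulIf P0); rewrite mul1r -[RHS](perm_big _ pm) big_map big_split /=.
  by rewrite big_const_seq count_predT iter_mulr_1.
have n0 : (0 < size r)%N by case: (r) r1.
have [|z zr zprim] := hasP (cyclic.has_prim_root n0 _ ur (leqnn _)).
  by apply/allP => z zr; rewrite unity_rootE rX.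
have /rP[_ [t St Et]] := zr.
exists t, (size r).-1; rewrite prednK //; split=> // [|i j iN jN Eij|g Sg gM].
- by apply: chi_inj => //; [apply: SX | rewrite chiX // Et rX].
- have := congr1 chi Eij; rewrite !chiX // Et => /eqP; rewrite (eq_prim_root_expr zprim).
  have lt k : (k <= (size r).-1)%N -> (k < size r)%N by rewrite -{2}(prednK n0) ltnS.
  by rewrite !modn_small ?lt // => /eqP.
have gr : chi g \in r.
  by apply/rP; split; [rewrite sE -chiX // gM chi1 | exists g].
have [i Ei] := prim_rootP zprim (rX _ gr); exists i.
by apply: chi_inj => //; [apply: SX | rewrite chiX // Et].
Qed.

Lemma multiplicative_subgroup (s : seq K) : (forall n, (0 < n)%N -> chi a ^+ n != 1) ->
  (forall g, S g -> exists q i j, q \in s /\ chi g * chi a ^+ i = q * chi a ^+ j) ->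
  iso_finite_cyclic_times_Z S /\ finite_index_in (cyclic_subset a) S.
Proof.
move=> a_inf cov; have a_inf' n : (0 < n)%N -> (a ^+ n)%g <> 1%g.
  by move=> n0 En; have := a_inf n n0; rewrite -chiX // En chi1 eqxx.
pose rel g q := exists i j, chi g * chi a ^+ i = q * chi a ^+ j.
have [||l lS lP] := @finite_cosets G S a K rel s.
- move=> g h q Sg Sh [i [j E1]] [i' [j' E2]]; exists (i + j')%N, (i' + j)%N.
  apply: chi_inj; [by apply: SM => //; apply: SX | by apply: SM => //; apply: SX |].
  rewrite !chiM ?chiX //; try exact: SX.
  by rewrite !exprD mulrA E1 mulrA E2 mulrAC.
- by move=> g /cov[q [i [j [qs E]]]]; exists q => //; exists i, j.
split; last exact: finite_index_cyclic lS lP.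
by apply: (finite_cyclic_times_Z S1 SM SV Scomm Sa a_inf' lP); apply: torsion_cyclic.
Qed.

End MultiplicativeCharacter.

Section AdditiveCharacter.
Variables (G : groupType) (S : G -> Prop) (a : G) (K : fieldType) (chi : G -> K).
Hypotheses (S1 : S 1%g) (SM : forall g h, S g -> S h -> S (g * h)%g) (SV : forall g, S g -> S g^-1%g).
Hypotheses (Sa : S a) (chiD : forall g h, S g -> S h -> chi (g * h)%g = chi g + chi h).
Hypothesis chi_inj : forall g h, S g -> S h -> chi g = chi h -> g = h.

Let SX g n : S g -> S (g ^+ n)%g.
Proof. by move=> Sg; elim: n => [|n Sn] //; rewrite expgS; apply: SM. Qed.

Let chi1 : chi 1%g = 0.
Proof. by apply: (addrI (chi 1%g)); rewrite -chiD // mul1g addr0. Qed.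

Let chiX g n : S g -> chi (g ^+ n)%g = chi g *+ n.
Proof. by move=> Sg; elim: n => [|n IHn]; rewrite ?chi1 // expgS chiD ?IHn ?mulrS //; apply: SX. Qed.

Let Scomm g h : S g -> S h -> commute g h.
Proof. by move=> Sg Sh; apply: chi_inj; rewrite ?chiD 1?addrC //; apply: SM. Qed.

Lemma additive_subgroup (s : seq K) : (forall n, (0 < n)%N -> n%:R != 0 :> K) -> chi a = 1 ->
  (forall g, S g -> exists q i j, q \in s /\ chi g + i%:R = q + j%:R) ->
  iso_finite_cyclic_times_Z S /\ finite_index_in (cyclic_subset a) S.
Proof.
move=> ch0 Ea cov; have a_inf n : (0 < n)%N -> (a ^+ n)%g <> 1%g.
  by move=> n0 En; have := ch0 n n0; rewrite -Ea -chiX // En chi1 eqxx.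
pose rel g q := exists i j, chi g + i%:R = q + j%:R.
have [||l lS lP] := @finite_cosets G S a K rel s.
- move=> g h q Sg Sh [i [j E1]] [i' [j' E2]]; exists (i + j')%N, (i' + j)%N.
  apply: chi_inj; [by apply: SM => //; apply: SX | by apply: SM => //; apply: SX |].
  rewrite !chiD ?chiX //; try exact: SX.
  by rewrite Ea !mulrnDr addrA E1 addrA E2 addrAC.
- by move=> g /cov[q [i [j [qs E]]]]; exists q => //; exists i, j.
split; last exact: finite_index_cyclic lS lP.
(* K is torsion-free in characteristic 0, so the finite factor is trivial. *)
apply: (finite_cyclic_times_Z S1 SM SV Scomm Sa a_inf lP) => M M0.
exists 1%g, 0%N; split=> //; [by move=> i j; rewrite !leqn0 => /eqP-> /eqP-> | move=> g Sg gM].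
exists 0%N; apply: chi_inj => //; rewrite chi1; apply/eqP.
have := congr1 chi gM; rewrite chiX // chi1 -mulr_natr => /eqP.
by rewrite mulf_eq0 (negPf (ch0 M M0)) orbF.
Qed.

End AdditiveCharacter.




(** * The plane Cremona group *)

Section FractionRatfun.
Variable L : fieldType.
Local Notation FL := {fraction {poly L}}.

Let emb : {rmorphism L -> FL} := (@tofrac {poly L} \o polyC).

Lemma frac_horner (p : {poly L}) : (map_poly emb p).[tofrac 'X] = tofrac p.
Proof.
elim/poly_ind: p => [|p c IHp]; first by rewrite map_poly0 horner0 rmorph0.
by rewrite rmorphD rmorphM /= map_polyX map_polyC hornerMXaddC IHp rmorphD rmorphM.
Qed.

Fact frac_eval_eq0 (p : {poly L}) : (map_poly emb p).[tofrac 'X] = 0 -> p = 0.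
Proof. by rewrite frac_horner => /eqP; rewrite tofrac_eq0 => /eqP. Qed.

Fact frac_eval_numden (z : FL) : exists n d : {poly L},
  d != 0 /\ z = (map_poly emb n).[tofrac 'X] / (map_poly emb d).[tofrac 'X].
Proof.
have [n [d [d0 Ez]]] := frac_numden z; exists n, d; split=> //.
by rewrite !frac_horner.
Qed.

End FractionRatfun.

Section AffineMapForm.
Variables (K : closedFieldType) (F : ratfun K) (E : ratfun F).
Variables (h : K -> E) (e : F -> E) (x y : E).
Hypotheses (hE : forall c, h c = const E c) (eE : forall z, e z = rf_emb E z).
Hypotheses (xE : x = rf_emb E (rf_gen F)) (yE : y = rf_gen E).

Lemma eval_at_form (p : {mpoly K[3]}) :
  mmap h (tnth [tuple x; y; 1]) p = eval_at (rf_emb E (rf_gen F)) (rf_gen E) p.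
Proof. by rewrite xE yE /eval_at /mmap; apply: eq_bigr => m _; rewrite hE. Qed.

Lemma affine_map_form (f : Cremona K) u v :
  (mmap h (tnth [tuple x; y; 1]) (tnth (cr_forms f) ord0) /
     mmap h (tnth [tuple x; y; 1]) (tnth (cr_forms f) ord_max) = u /\
   mmap h (tnth [tuple x; y; 1]) (tnth (cr_forms f) (inord 1)) /
     mmap h (tnth [tuple x; y; 1]) (tnth (cr_forms f) ord_max) = v) <->
  affine_map f u v.
Proof. by rewrite !eval_at_form. Qed.

(** The maps h, e and the elements x, y are arbitrary up to pointwise equations, through which alone
    the concrete fraction field is matched with E. *)
Lemma jonq_form (f : Cremona K) M A : M \in unitmx -> A \in unitmx ->
  (mmap h (tnth [tuple x; y; 1]) (tnth (cr_forms f) ord0) /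
     mmap h (tnth [tuple x; y; 1]) (tnth (cr_forms f) ord_max) = homography (map_mx h M) x /\
   mmap h (tnth [tuple x; y; 1]) (tnth (cr_forms f) (inord 1)) /
     mmap h (tnth [tuple x; y; 1]) (tnth (cr_forms f) ord_max) = homography (map_mx e A) y) <->
  is_jonq E f M A.
Proof.
move=> uM uA; rewrite affine_map_form (map_mx_eq _ hE) (map_mx_eq _ eE) xE yE.
by split=> [H|[_ _ H]]; [split|].
Qed.

Lemma affine_scale_form (f : Cremona K) t :
  (mmap h (tnth [tuple x; y; 1]) (tnth (cr_forms f) ord0) /
     mmap h (tnth [tuple x; y; 1]) (tnth (cr_forms f) ord_max) = x /\
   mmap h (tnth [tuple x; y; 1]) (tnth (cr_forms f) (inord 1)) /
     mmap h (tnth [tuple x; y; 1]) (tnth (cr_forms f) ord_max) = h t * y) <->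
  affine_map f (rf_emb E (rf_gen F)) (const E t * rf_gen E).
Proof. by rewrite affine_map_form hE xE yE. Qed.

Lemma affine_translate_form (f : Cremona K) t :
  (mmap h (tnth [tuple x; y; 1]) (tnth (cr_forms f) ord0) /
     mmap h (tnth [tuple x; y; 1]) (tnth (cr_forms f) ord_max) = x /\
   mmap h (tnth [tuple x; y; 1]) (tnth (cr_forms f) (inord 1)) /
     mmap h (tnth [tuple x; y; 1]) (tnth (cr_forms f) ord_max) = y + h t) <->
  affine_map f (rf_emb E (rf_gen F)) (rf_gen E + const E t).
Proof. by rewrite affine_map_form hE xE yE. Qed.

End AffineMapForm.


Section Bridge.
Variable K : closedFieldType.
Local Notation Kx := {fraction {poly K}}.
Local Notation Kxy := {fraction {poly {fraction {poly K}}}}.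
Definition Fx : ratfun K := @RatFun K (Kx : fieldType) (@tofrac {poly K} \o polyC) (tofrac 'X)
  (@frac_eval_eq0 K) (@frac_eval_numden K).

Lemma Kxy_horner (p : {poly Kx}) : (map_poly (@Kx_to_Kxy K) p).[coord_y K] = tofrac p.
Proof.
elim/poly_ind: p => [|p c IHp]; first by rewrite map_poly0 horner0 rmorph0.
by rewrite rmorphD rmorphM /= map_polyX map_polyC hornerMXaddC IHp rmorphD rmorphM.
Qed.

Fact Kxy_eval_eq0 (p : {poly Kx}) : (map_poly (@Kx_to_Kxy K) p).[coord_y K] = 0 -> p = 0.
Proof. by rewrite Kxy_horner => /eqP; rewrite tofrac_eq0 => /eqP. Qed.

Fact Kxy_eval_numden (z : Kxy) : exists n d : {poly Kx},
  d != 0 /\ z = (map_poly (@Kx_to_Kxy K) n).[coord_y K] / (map_poly (@Kx_to_Kxy K) d).[coord_y K].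
Proof.
have [n [d [d0 Ez]]] := frac_numden z; exists n, d.
split.
  exact d0.
apply: (etrans Ez).
exact (f_equal2 (fun u v : Kxy => u / v) (esym (Kxy_horner n)) (esym (Kxy_horner d))).
Qed.

Definition Exy : ratfun Fx := @RatFun Fx (Kxy : fieldType) (@Kx_to_Kxy K) (coord_y K)
  Kxy_eval_eq0 Kxy_eval_numden.

Lemma K_to_KxyE (c : K) : (K_to_Kxy c : Exy) = @const K Fx Exy c.
Proof. reflexivity. Qed.

Lemma Kx_to_KxyE (z : Fx) : (Kx_to_Kxy z : Exy) = rf_emb Exy z.
Proof. reflexivity. Qed.

Lemma coord_xE : (coord_x K : Exy) = rf_emb Exy (rf_gen Fx).
Proof. reflexivity. Qed.

Lemma coord_yE : (coord_y K : Exy) = rf_gen Exy.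
Proof. reflexivity. Qed.

Lemma is_affine_map_jonq (f : Cremona K) (M : 'M[K]_2) (A : 'M[Kx]_2) : M \in unitmx -> (A : 'M[Fx]_2) \in unitmx ->
  is_affine_map f (homography (map_mx (@K_to_Kxy K) M) (coord_x K))
                  (homography (map_mx (@Kx_to_Kxy K) A) (coord_y K)) <-> is_jonq Exy f M A.
Proof.
move=> uM uA.
(* Only the kernel conversion is practicable here, not unification. *)
exact_no_check (@jonq_form K Fx Exy (@K_to_Kxy K) (@Kx_to_Kxy K) (coord_x K) (coord_y K) K_to_KxyE Kx_to_KxyE coord_xE coord_yE f M A uM uA).
Qed.

End Bridge.




(** * The action of the centralizer on the base *)

Section Action.
Variables (K : closedFieldType) (F : ratfun K) (E : ratfun F).
Local Notation emb := (rf_emb F).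
Local Notation X := (rf_emb E (rf_gen F)).
Local Notation Y := (rf_gen E).
Implicit Types (f g h : Cremona K) (P Q : PGL 2 K).

(** The analogue of [base_action] over a presented field K(x, y); [base_actionP] identifies the
    two. *)
Definition acts f P := exists (M : GLn 2 K) (A : 'M[F]_2), P = pgl_class M /\ is_jonq E f (val M) A.

Lemma pgl_class_eq (M N : GLn 2 K) c : c != 0 -> val N = c *: val M -> pgl_class M = pgl_class N.
Proof. by move=> c0 EN; apply/pgl_classP/pgl_eqP; exists c. Qed.

Lemma acts_uniq f P Q : acts f P -> acts f Q -> P = Q.
Proof.
move=> [M [A [-> jM]]] [N [B [-> jN]]]; have [[c c0 EN] _] := is_jonq_uniq jM jN.
exact: pgl_class_eq c0 EN.
Qed.

Lemma actsM f g P Q : acts f P -> acts g Q -> acts (f * g)%g (P * Q)%g.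
Proof.
move=> [M [A [-> jM]]] [N [B [-> jN]]]; exists (gl_mul M N), ((A ^^ val N) *m B).
by split; [rewrite pgl_classM | apply: is_jonqM].
Qed.

Lemma acts1 : acts 1%g 1%g.
Proof. by exists (gl_one 2 K), 1%:M; split=> //; apply: is_jonq1. Qed.

Lemma actsV f P : acts f P -> acts f^-1%g P^-1%g.
Proof.
move=> [M [A [-> jM]]]; exists (gl_inv M), (invmx (A ^^ (invmx (val M)))).
by split; [rewrite pgl_classV | apply: is_jonqV].
Qed.

Lemma jonq_acts f M A : is_jonq E f M A -> exists P, acts f P.
Proof.
move=> jf; have [uM _ _] := jf.
by exists (pgl_class (exist (fun A => A \in unitmx) M uM)), (exist (fun A => A \in unitmx) M uM), A.
Qed.

Lemma acts_one f : acts f 1%g <-> exists A, is_jonq E f 1%:M A.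
Proof.
split=> [[M [A [EM jf]]]|[A jf]]; last by exists (gl_one 2 K), A.
have [c c0 /= Ec] : exists2 c, c != 0 & val (gl_one 2 K) = c *: val M.
  by apply/pgl_eqP/pgl_classP.
by exists A; have := is_jonq_scale c0 (oner_neq0 F) jf; rewrite -Ec scale1r.
Qed.

Lemma acts_infinite_order f P M A : acts f P -> is_jonq E f M A ->
  (forall n, (0 < n)%N -> (P ^+ n)%g <> 1%g) -> infinite_order M.
Proof.
move=> fP jf Pn n c n0 Mn; have fPn m : acts (f ^+ m)%g (P ^+ m)%g.
  by elim: m => [|m IHm]; [exact: acts1 | rewrite !expgS; apply: actsM].
have [A' jn] : exists A', is_jonq E (f ^+ n)%g (M ^+ n) A'.
  elim: n {n0 Mn} => [|n [A' jn]]; first by exists 1%:M; apply: is_jonq1.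
  by exists ((A' ^^ M) *m A); rewrite expgSr exprSr; apply: is_jonqM.
apply: (Pn n n0); apply: acts_uniq (fPn n) _; apply/acts_one.
rewrite Mn in jn; have c0 : c != 0.
  have [u _ _] := jn; apply: contraTneq u => ->.
  by rewrite scalar_mx2 unitmx2 mul0r subrr eqxx.
have ci0 : c^-1 != 0 by rewrite invr_eq0.
exists A'; have := is_jonq_scale ci0 (oner_neq0 F) jn.
by rewrite scale1r scale_scalar_mx mulVf.
Qed.

Lemma jonq_scaling g t : (t != 0 /\ affine_map g X (const E t * Y)) <->
  t != 0 /\ is_jonq E g 1%:M (mx2 (emb t) 0 0 1).
Proof.
have hX : homography (map_mx (@const _ _ E) 1%:M) X = X by rewrite map_mx1 homography1.
have hY : homography (map_mx (rf_emb E) (mx2 (emb t) 0 0 1)) Y = const E t * Y.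
  by rewrite map_mx2 /homography !mx2E rmorph0 rmorph1 mul0r add0r addr0 divr1.
split=> [[t0 gt]|[t0 [_ _ gt]]]; split=> //; last by move: gt; rewrite hX hY.
split; [exact: unitmx1 | | by rewrite hX hY].
by rewrite unitmx2 mulr1 mulr0 subr0 fmorph_eq0.
Qed.

Lemma jonq_translation g t : affine_map g X (Y + const E t) <-> is_jonq E g 1%:M (mx2 1 (emb t) 0 1).
Proof.
have hX : homography (map_mx (@const _ _ E) 1%:M) X = X by rewrite map_mx1 homography1.
have hY : homography (map_mx (rf_emb E) (mx2 1 (emb t) 0 1)) Y = Y + const E t.
  by rewrite map_mx2 /homography !mx2E rmorph0 rmorph1 mul0r add0r mul1r divr1.
split=> [gt|[_ _ gt]]; last by move: gt; rewrite hX hY.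
split; [exact: unitmx1 | | by rewrite hX hY].
by rewrite unitmx2 mulr1 mulr0 subr0 oner_neq0.
Qed.

Section Wandering.
Variables (f : Cremona K) (fb : PGL 2 K).
Hypotheses (ffb : acts f fb) (uf : unbounded_growth E f).
Hypothesis fb_inf : forall n, (0 < n)%N -> (fb ^+ n)%g <> 1%g.

Definition base_centralizer P := exists2 g, commute g f & acts g P.

Let S := base_centralizer.

Lemma normal_form_conj (N C : 'M[K]_2) c a b g A g0 : is_jonq E g0 C 1%:M ->
  is_jonq E g N A -> c != 0 -> invmx C *m N *m C = c *: aff a b ->
  exists A', is_jonq E (g ^ g0)%g (aff a b) A'.
Proof.
move=> j0 jg c0 Ec; have := is_jonqM (is_jonqV j0) (is_jonqM jg j0); rewrite mulmxA -conjgE Ec.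
set A' := _ *m _ => j; have ci0 : c^-1 != 0 by rewrite invr_eq0.
exists A'; have := is_jonq_scale ci0 (oner_neq0 F) j.
by rewrite scale1r scalerA mulVf // scale1r.
Qed.

Lemma base_centralizer1 : S 1%g.
Proof. by exists 1%g; [apply: commute_sym; apply: commute1 | exact: acts1]. Qed.

Lemma base_centralizerM P Q : S P -> S Q -> S (P * Q)%g.
Proof.
move=> [g cg gP] [h ch hQ]; exists (g * h)%g; last exact: actsM.
by apply: commute_sym; apply: commuteM; apply: commute_sym.
Qed.

Lemma base_centralizerV P : S P -> S P^-1%g.
Proof.
move=> [g cg gP]; exists g^-1%g; last exact: actsV.
by apply: commute_sym; apply: commuteV; apply: commute_sym.
Qed.

Lemma base_centralizer_base : S fb.
Proof. by exists f. Qed.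

Variables (g0 : Cremona K) (C : 'M[K]_2) (a b : K) (A0 : 'M[F]_2).
Hypotheses (uC : C \in unitmx) (j0 : is_jonq E g0 C 1%:M) (jf : is_jonq E (f ^ g0)%g (aff a b) A0).

Let uf0 : unbounded_growth E (f ^ g0)%g := unbounded_growth_conj j0 uf.

(** This depends on the chosen representative, so only quotients of entries are meaningful. *)
Definition coordinates P := invmx C *m val (repr P) *m C.

Lemma coordinatesM P Q : exists2 c, c != 0 & coordinates (P * Q)%g = c *: (coordinates P *m coordinates Q).
Proof.
have [c c0 Ec] := pgl_reprK (gl_mul (repr P) (repr Q)).
exists c => //; rewrite /coordinates (_ : repr (P * Q)%g = repr (pgl_class (gl_mul (repr P) (repr Q)))) // Ec /=.
by rewrite !mulmxA mulmxK // -scalemxAr -scalemxAl !mulmxA.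
Qed.

Lemma coordinates_inj P Q c : c != 0 -> coordinates Q = c *: coordinates P -> P = Q.
Proof.
move=> c0 E0; have E1 : val (repr Q) = c *: val (repr P).
  have : C *m coordinates Q *m invmx C = c *: (C *m coordinates P *m invmx C).
    by rewrite E0 -scalemxAr -scalemxAl.
  by rewrite /coordinates !mulmxA mulmxV // !mul1mx -!mulmxA mulmxV // !mulmx1.
by rewrite -[P]reprK -[Q]reprK; apply: pgl_class_eq c0 E1.
Qed.

Lemma centralizer_coordinates g P : commute g f -> acts g P -> exists N B,
  [/\ is_jonq E (g ^ g0)%g N B, exists c, aff a b *m N = c *: (N *m aff a b) &
      exists2 c, c != 0 & coordinates P = c *: N].
Proof.
move=> cgf [M [A [-> jg]]].
have := is_jonqM (is_jonqV j0) (is_jonqM jg j0); rewrite mulmxA -conjgE.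
set N := _ *m C; set B := _ *m _ => jN; exists N, B; split=> //.
  have cgf0 : commute (g ^ g0)%g (f ^ g0)%g by rewrite /commute -!conjMg cgf.
  have [[c c0 Ec] _] := is_jonq_commute jf jN cgf0; exists c^-1.
  by rewrite Ec scalerA mulVf // scale1r.
have [c c0 Ec] := pgl_reprK M; exists c => //.
by rewrite /coordinates Ec -scalemxAr -scalemxAl.
Qed.

Lemma scaling_base_centralizer : b = 0 -> a != 0 -> (forall n, (0 < n)%N -> a ^+ n != 1) ->
  iso_finite_cyclic_times_Z S /\ finite_index_in (cyclic_subset fb) S.
Proof.
move=> b0 a0 a_inf; have jf' := jf; rewrite b0 in jf'.
have [s sP] := scaling_multipliers jf' uf0.
(* The multiplier: on the base centralizer the coordinates are diagonal by [centralizer_diag], and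
   the quotient ignores the scalar. *)
pose chi P := coordinates P ord0 ord0 / coordinates P ord_max ord_max.
have SP P : S P -> exists g be k B, [/\ commute g (f ^ g0)%g, is_jonq E g (aff be 0) B,
    be != 0, k != 0 & coordinates P = k *: aff be 0].
  move=> [g cgf gP]; have [N [B [jN [c Ec] [k k0 Ek]]]] := centralizer_coordinates cgf gP.
  rewrite b0 in Ec; have [uN _ _] := jN.
  have [|be [k' [be0 k'0 EN]]] := centralizer_diag a0 _ (a_inf 2 isT) uN Ec.
    by have := a_inf 1%N isT; rewrite expr1.
  exists (g ^ g0)%g, be, (k * k'), B; rewrite mulf_neq0 //; split=> //.
  - by rewrite /commute -!conjMg cgf.
  - have ki0 : k'^-1 != 0 by rewrite invr_eq0.
    have := is_jonq_scale ki0 (oner_neq0 F) jN.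
    by rewrite EN scalerA mulVf // !scale1r.
  - by rewrite Ek EN scalerA.
have chiE P be k : k != 0 -> coordinates P = k *: aff be 0 -> chi P = be.
  by move=> k0 E0; rewrite /chi E0 !mxE /= mulr1 mulrAC mulfV // mul1r.
have chi_fb : chi fb = a.
  have [M [A [EM jM]]] := ffb; have [c c0 Ec] := pgl_reprK M.
  have := is_jonqM (is_jonqV j0) (is_jonqM jM j0); rewrite mulmxA -conjgE => jN.
  have [[k k0 Ek] _] := is_jonq_uniq jf jN.
  apply: (chiE _ _ (c * k)); first by rewrite mulf_neq0.
  by rewrite /coordinates EM Ec -scalemxAr -scalemxAl Ek scalerA b0.
apply: (@multiplicative_subgroup _ S fb K chi base_centralizer1 base_centralizerM
  base_centralizerV base_centralizer_base _ _ _ s).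
- move=> P Q /SP[_ [be [k [_ [_ _ be0 k0 E1]]]]] /SP[_ [be' [k' [_ [_ _ be0' k0' E2]]]]].
  have [c c0 Ec] := coordinatesM P Q; rewrite (chiE _ _ _ k0 E1) (chiE _ _ _ k0' E2).
  apply: (chiE _ _ (c * (k * k'))); first by rewrite !mulf_neq0.
  by rewrite Ec E1 E2 -scalemxAl -scalemxAr !scalerA aff_mul mulr0 addr0 !mulrA.
- by move=> P /SP[_ [be [k [_ [_ _ be0 k0 E1]]]]]; rewrite (chiE _ _ _ k0 E1).
- move=> P Q /SP[_ [be [k [_ [_ _ be0 k0 E1]]]]] /SP[_ [be' [k' [_ [_ _ be0' k0' E2]]]]].
  rewrite (chiE _ _ _ k0 E1) (chiE _ _ _ k0' E2) => Ebe.
  apply: (@coordinates_inj _ _ (k' / k)); first by rewrite mulf_neq0 ?invr_eq0.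
  by rewrite E1 E2 Ebe scalerA divfK.
- by move=> n n0; rewrite chi_fb a_inf.
move=> P /SP[g [be [k [B [cgf jg be0 k0 E1]]]]]; rewrite (chiE _ _ _ k0 E1) chi_fb.
exact: sP cgf jg.
Qed.

Lemma translation_base_centralizer : a = 1 -> b = 1 -> (forall n, (0 < n)%N -> n%:R != 0 :> K) ->
  iso_finite_cyclic_times_Z S /\ finite_index_in (cyclic_subset fb) S.
Proof.
move=> a1 b1 ch0; have jf' := jf; rewrite a1 b1 in jf'.
have [s sP] := translation_multipliers ch0 jf' uf0.
(* The translation length; by [centralizer_unipotent] the coordinates are unipotent up to a
   scalar. *)
pose chi P := coordinates P ord0 ord_max / coordinates P ord_max ord_max.
have SP P : S P -> exists g t k B, [/\ commute g (f ^ g0)%g, is_jonq E g (aff 1 t) B,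
    k != 0 & coordinates P = k *: aff 1 t].
  move=> [g cgf gP]; have [N [B [jN [c Ec] [k k0 Ek]]]] := centralizer_coordinates cgf gP.
  rewrite a1 b1 in Ec; have [uN _ _] := jN.
  have [t [k' [k'0 EN]]] := centralizer_unipotent uN Ec.
  exists (g ^ g0)%g, t, (k * k'), B; rewrite mulf_neq0 //; split=> //.
  - by rewrite /commute -!conjMg cgf.
  - have ki0 : k'^-1 != 0 by rewrite invr_eq0.
    have := is_jonq_scale ki0 (oner_neq0 F) jN.
    by rewrite EN scalerA mulVf // !scale1r.
  - by rewrite Ek EN scalerA.
have chiE P t k : k != 0 -> coordinates P = k *: aff 1 t -> chi P = t.
  by move=> k0 E0; rewrite /chi E0 !mxE /= mulr1 mulrAC mulfV // mul1r.
have chi_fb : chi fb = 1.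
  have [M [A [EM jM]]] := ffb; have [c c0 Ec] := pgl_reprK M.
  have := is_jonqM (is_jonqV j0) (is_jonqM jM j0); rewrite mulmxA -conjgE => jN.
  have [[k k0 Ek] _] := is_jonq_uniq jf jN.
  apply: (chiE _ _ (c * k)); first by rewrite mulf_neq0.
  by rewrite /coordinates EM Ec -scalemxAr -scalemxAl Ek scalerA a1 b1.
apply: (@additive_subgroup _ S fb K chi base_centralizer1 base_centralizerM
  base_centralizerV base_centralizer_base _ _ s) => //.
- move=> P Q /SP[_ [t [k [_ [_ _ k0 E1]]]]] /SP[_ [t' [k' [_ [_ _ k0' E2]]]]].
  have [c c0 Ec] := coordinatesM P Q; rewrite (chiE _ _ _ k0 E1) (chiE _ _ _ k0' E2).
  apply: (chiE _ _ (c * (k * k'))); first by rewrite !mulf_neq0.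
  by rewrite Ec E1 E2 -scalemxAl -scalemxAr !scalerA aff_mul !mul1r addrC !mulrA.
- move=> P Q /SP[_ [t [k [_ [_ _ k0 E1]]]]] /SP[_ [t' [k' [_ [_ _ k0' E2]]]]].
  rewrite (chiE _ _ _ k0 E1) (chiE _ _ _ k0' E2) => Et.
  apply: (@coordinates_inj _ _ (k' / k)); first by rewrite mulf_neq0 ?invr_eq0.
  by rewrite E1 E2 Et scalerA divfK.
move=> P /SP[g [t [k [B [cgf jg k0 E1]]]]]; rewrite (chiE _ _ _ k0 E1).
exact: sP cgf jg.
Qed.

Lemma centralizer_acts_coordinates g : commute g f -> exists P, acts g P.
Proof.
move=> cgf; have cgf0 : commute (g ^ g0)%g (f ^ g0)%g by rewrite /commute -!conjMg cgf.
have [N [B jN]] := centralizer_jonq jf uf0 cgf0.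
have := is_jonqM (is_jonqM j0 jN) (is_jonqV j0); rewrite conjgE mulVKg mulgK.
exact: jonq_acts.
Qed.

End Wandering.

Lemma wandering_centralizer f fb : acts f fb -> unbounded_growth E f ->
  (forall n, (0 < n)%N -> (fb ^+ n)%g <> 1%g) ->
  [/\ forall g, commute g f -> exists P, acts g P, iso_finite_cyclic_times_Z (base_centralizer f) &
      finite_index_in (cyclic_subset fb) (base_centralizer f)].
Proof.
move=> ffb uf fb_inf; have [M [A [_ jf]]] := ffb.
have iM := acts_infinite_order ffb jf fb_inf; have [uM _ _] := jf.
have [C uC [c c0 cases]] := infinite_order_normal_form uM iM.
have [g0 j0] := exists_jonq E uC (unitmx1 F 2).
case: cases => [[a [a0 a_inf Ec]]|[ch0 Ec]].
  have [A' jf0] := normal_form_conj j0 jf c0 Ec.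
  have [iso fin] := scaling_base_centralizer ffb uf uC j0 jf0 (erefl _) a0 a_inf.
  by split=> // g cgf; apply: (centralizer_acts_coordinates uf j0 jf0 cgf).
have [A' jf0] := normal_form_conj j0 jf c0 Ec.
have [iso fin] := translation_base_centralizer ffb uf uC j0 jf0 (erefl _) (erefl _) ch0.
by split=> // g cgf; apply: (centralizer_acts_coordinates uf j0 jf0 cgf).
Qed.

End Action.




(** * Return to the definitions over the iterated fraction field *)

Section Dictionary.
Variable K : closedFieldType.
Implicit Types (f g : Cremona K) (P : PGL 2 K).

Lemma base_actionP f P : base_action f P <-> acts (Exy K) f P.
Proof.
split=> [[M [A [EP fMA]]]|[M [A [EP jf]]]].
  exists M, (val A); split; first exact: EP.
  exact: (proj1 (is_affine_map_jonq f (valP M) (valP A)) fMA).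
have uA : A \in unitmx by case: jf.
exists M, (exist (fun A => A \in unitmx) A uA); split; first exact: EP.
exact: (proj2 (is_affine_map_jonq f (valP M) uA) jf).
Qed.

Lemma scalingP g : scaling g <->
  exists2 t : K, t != 0 & is_jonq (Exy K) g 1%:M (mx2 (rf_emb (Fx K) t) 0 0 1).
Proof.
have H t : is_affine_map g (coord_x K) (K_to_Kxy t * coord_y K) <->
    affine_map g (rf_emb (Exy K) (rf_gen (Fx K))) (const (Exy K) t * rf_gen (Exy K)).
  exact_no_check (@affine_scale_form K (Fx K) (Exy K) (@K_to_Kxy K) (coord_x K) (coord_y K)
    (@K_to_KxyE K) (@coord_xE K) (@coord_yE K) g t).
split=> [[t t0 gt]|[t t0 jg]]; exists t => //.
  by have [_] := proj1 (jonq_scaling _ g t) (conj t0 (proj1 (H t) gt)).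
by have [_ gt] := proj2 (jonq_scaling _ g t) (conj t0 jg); apply: (proj2 (H t)).
Qed.

Lemma translationP g : translation g <->
  exists t : K, is_jonq (Exy K) g 1%:M (mx2 1 (rf_emb (Fx K) t) 0 1).
Proof.
have H t : is_affine_map g (coord_x K) (coord_y K + K_to_Kxy t) <->
    affine_map g (rf_emb (Exy K) (rf_gen (Fx K))) (rf_gen (Exy K) + const (Exy K) t).
  exact_no_check (@affine_translate_form K (Fx K) (Exy K) (@K_to_Kxy K) (coord_x K) (coord_y K)
    (@K_to_KxyE K) (@coord_xE K) (@coord_yE K) g t).
split=> [[t gt]|[t jg]]; exists t.
  exact: (proj1 (jonq_translation _ g t) (proj1 (H t) gt)).
exact: (proj2 (H t) (proj2 (jonq_translation _ g t) jg)).
Qed.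

End Dictionary.

Theorem theorem3p2 (K : closedFieldType) (f : Cremona K)
    (f_twist : jonquieres_twist f) (f_wandering : base_wandering f) :
  ((forall g, Cent f g -> exists! P, base_action g P) /\
   (forall g h P Q, Cent f g -> Cent f h -> base_action g P -> base_action h Q ->
      base_action (g * h)%g (P * Q)%g)) /\
  (~ trivial_subset (Cent0 f) ->
     Jonq_conjugate (Cent0 f) (@scaling K) \/
     Jonq_conjugate (Cent0 f) (@translation K) \/
     (torsion_subset (Cent0 f) /\
      ([pchar K] =i pred0 -> has_order_two (Cent0 f)))) /\
  (iso_finite_cyclic_times_Z (Centb f) /\
   (forall fb, base_action f fb -> finite_index_in (cyclic_subset fb) (Centb f))).
Proof.
have uf := linear_growth_unbounded (Exy K) (proj2 f_twist).
have [fb0 /base_actionP ffb0 fb_inf] := f_wandering.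
have [cent_acts iso fin] := wandering_centralizer ffb0 uf fb_inf.
have Centb_eq P : Centb f P <-> base_centralizer (Exy K) f P.
  by split=> [[g cg /base_actionP gP]|[g cg gP]]; exists g => //; apply/base_actionP.
have Cent0_eq g : Cent0 f g <-> cent0 (Exy K) f g.
  split=> [[cg /base_actionP/acts_one jg]|[cg jg]]; split=> //.
  by apply/base_actionP/acts_one.
split; [split | split; [|split]].
- move=> g cg; have [P gP] := cent_acts g cg; exists P; split; first exact/base_actionP.
  by move=> Q /base_actionP gQ; apply: acts_uniq gP gQ.
- by move=> g h P Q _ _ /base_actionP gP /base_actionP hQ; apply/base_actionP; apply: actsM.
- move=> nontriv; have [M [A [_ jf]]] := ffb0; have [uM _ _] := jf.
  have fixM := fixed_field (F := Fx K) uM (acts_infinite_order ffb0 jf fb_inf).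
  have ex : exists2 g, cent0 (Exy K) f g & g <> 1%g.
    apply: NNPP => H; apply: nontriv => g; split=> [/Cent0_eq cg|->].
      by apply: NNPP => g1; apply: H; exists g.
    by apply/Cent0_eq; split; [apply: commute_sym; apply: commute1 | exists 1%:M; apply: is_jonq1].
  have JonqI h : (exists C, is_jonq (Exy K) h 1%:M C) -> Jonq h.
    by move=> jh; exists 1%g; apply/base_actionP/acts_one.
  have [[h jh H]|[[h jh H]|[tors two]]] := cent0_structure jf uf fixM ex.
  + left; exists h; first exact: JonqI.
    by move=> g; rewrite Cent0_eq H; split=> /scalingP.
  + right; left; exists h; first exact: JonqI.
    by move=> g; rewrite Cent0_eq H; split=> /translationP.
  right; right; split=> [g /Cent0_eq/tors gg|ch0].
    by exists 2; rewrite // expg2.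
  have two0 : 2%:R != 0 :> K by apply/negP => two0; have := ch0 2; rewrite !inE /= two0.
  have [s s1 sP] := two two0; exists s => // g; rewrite Cent0_eq; exact: sP.
- have [k [phi [phiM phi_inj phiP]]] := iso; exists k, phi; split=> // P.
  by rewrite Centb_eq.
move=> fb /base_actionP ffb; rewrite (acts_uniq ffb ffb0).
case: fin => [sub [l lS lP]]; split=> [P /sub|]; first by rewrite Centb_eq.
exists l => [q /lS|P]; rewrite Centb_eq //; exact: lP.
Qed.
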